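(* There exist absolute constants $c_1,c_2,c_3>0$ and, for every $d$, a distribution $\mathcal{D}$ over covariance matrices $\Sigma\in\mathbb{R}^{d\times d}$ with $\mathbb{I}\preceq\Sigma\preceq 2\mathbb{I}$ such that the following holds. Let $\alpha\le c_1$, let $\varepsilon,\delta\in[0,1]$ with $\delta\le c_2\min\left\{\frac{1}{n},\frac{d^2}{n\log(n/d^2)}\right\}$, and let $M:\mathbb{R}^{n\times d}\to\mathbb{R}^{d\times d}$ be an $(\varepsilon,\delta)$-differentially private mechanism such that, for $\Sigma\sim\mathcal{D}$ and $X\sim\mathcal{N}(0,\Sigma)^{\otimes n}$, it satisfies $\mathbb{E}_{X,M}\left[\|M(X)-\Sigma\|_{\Sigma}^2\right]\le\alpha^2$. Then $n\ge c_3\frac{d^2}{\alpha\varepsilon}$. (That is, $\alpha=O(1)$, $\delta\le O(\min\{1/n, d^2/(n\log(n/d^2))\})$, and $n\ge\Omega(d^2/(\alpha\varepsilon))$.)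
   Context: A randomized algorithm $M:\mathcal{X}^n\to\mathcal{Y}$ is $(\varepsilon,\delta)$-differentially private if for every pair of datasets $X,X'\in\mathcal{X}^n$ differing in exactly one entry and every measurable $Y\subseteq\mathcal{Y}$, $\Pr[M(X)\in Y]\le e^{\varepsilon}\Pr[M(X')\in Y]+\delta$. For a positive definite $\Sigma$ and a matrix $A$, the Mahalanobis norm is $\|A\|_{\Sigma}=\|\Sigma^{-1/2}A\Sigma^{-1/2}\|_F$. $\mathcal{N}(0,\Sigma)^{\otimes n}$ denotes $n$ i.i.d. samples from $\mathcal{N}(0,\Sigma)$; the expectation is over the samples and the internal randomness of $M$ (the accuracy guarantee is required for the covariance matrices $\Sigma$ drawn from $\mathcal{D}$). *)

(* Defs.v *)
From HB Require Import structures.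
From mathcomp Require Import all_boot all_order all_algebra.
From mathcomp Require Import all_classical all_reals all_analysis.
From mathcomp Require Import measurable_realfun.

Set Implicit Arguments.
Unset Strict Implicit.
Unset Printing Implicit Defensive.

Import Order.TTheory GRing.Theory Num.Theory.
Import numFieldNormedType.Exports.

Local Open Scope classical_set_scope.
Local Open Scope ring_scope.

Definition measure_matrix_display : measure_display -> measure_display.
Proof. exact. Qed.

(* The sigma-algebra on matrices is generated by the entries, as the library
   does for tuples; over the reals this is the Borel sigma-algebra of
   R^(m x n). *)
Section measurable_matrix.
Context {d : measure_display} {T : measurableType d}.
Variables m n : nat.

Definition entry (ij : 'I_m * 'I_n) (A : 'M[T]_(m, n)) : T := A ij.1 ij.2.

Definition measurable_mx : set (set 'M[T]_(m, n)) :=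
  <<s \bigcup_ij preimage_set_system setT (entry ij) measurable >>.

Let mx_set0 : measurable_mx set0.
Proof. exact: sigma_algebra0. Qed.

Let mx_setC A : measurable_mx A -> measurable_mx (~` A).
Proof. exact: sigma_algebraC. Qed.

Let mx_bigcup (F : (set 'M[T]_(m, n))^nat) :
  (forall i, measurable_mx (F i)) -> measurable_mx (\bigcup_i F i).
Proof. exact: sigma_algebra_bigcup. Qed.

HB.instance Definition _ := @isMeasurable.Build (measure_matrix_display d)
  'M[T]_(m, n) measurable_mx mx_set0 mx_setC mx_bigcup.

Lemma measurable_entry (i : 'I_m) (j : 'I_n) :
  measurable_fun [set: 'M[T]_(m, n)] (fun A => A i j).
Proof.
move=> _ B mB; apply: sub_sigma_algebra.
by exists (i, j) => //; exists B.
Qed.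

Lemma measurable_fun_mxP d' (U : measurableType d') (f : U -> 'M[T]_(m, n)) :
  (forall i j, measurable_fun [set: U] (fun u => f u i j)) ->
  measurable_fun [set: U] f.
Proof.
move=> mf; apply: (@measurability _ _ U 'M[T]_(m, n) setT f
  (\bigcup_ij preimage_set_system setT (entry ij) measurable)) => //.
move=> _ [_ [[i j] _ [B mB <-]] <-].
by rewrite setTI; exact: (mf i j).
Qed.

End measurable_matrix.

Section iid.
Context {d : measure_display} {T : measurableType d} {R : realType}.

Definition consT (n : nat) (xt : T * n.-tuple T) : n.+1.-tuple T :=
  [tuple of xt.1 :: xt.2].

Let measurable_consT n : measurable_fun setT (@consT n).
Proof. exact: measurable_cons. Qed.

HB.instance Definition _ (n : nat) :=
  isMeasurableFun.Build _ _ _ _ (@consT n) (@measurable_consT n).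

(* The law of n independent draws from P. *)
Fixpoint iid (P : probability T R) (n : nat) : probability (n.-tuple T) R :=
  match n with
  | 0 => \d_([tuple])
  | n'.+1 => distribution (P \x iid P n')%E (@consT n')
  end.

End iid.

Section matrices.
Context {R : realType}.

Definition psdmx n (A : 'M[R]_n) : Prop :=
  A^T = A /\ forall x : 'rV[R]_n, 0 <= (x *m A *m x^T) 0 0.

Definition loewner_le n (A B : 'M[R]_n) : Prop := psdmx (B - A).

(* The positive semidefinite square root, unique when A is positive
   semidefinite (and 0 when there is none). *)
Definition sqrtmx n (A : 'M[R]_n) : 'M[R]_n :=
  xget 0 [set B | psdmx B /\ B *m B = A].

Definition frobenius m n (A : 'M[R]_(m, n)) : R :=
  Num.sqrt (\sum_i \sum_j A i j ^+ 2).

Definition mahalanobis n (S A : 'M[R]_n) : R :=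
  frobenius (invmx (sqrtmx S) *m A *m invmx (sqrtmx S)).

End matrices.

Section gaussian.
Context {R : realType}.

(* [normal_prob] lives on [measurableTypeR R], whose measurable sets are those
   of R under another display. *)
Definition row_of_tuple n (t : n.-tuple (measurableTypeR R)) : 'rV[R]_n :=
  \row_j tnth t j.

Let measurable_row_of_tuple n : measurable_fun setT (@row_of_tuple n).
Proof.
apply: measurable_fun_mxP => i j.
under eq_fun do rewrite mxE.
exact: (@measurable_tnth _ (measurableTypeR R)).
Qed.

HB.instance Definition _ (n : nat) := isMeasurableFun.Build _ _ _ _
  (@row_of_tuple n) (@measurable_row_of_tuple n).

Definition mulmx_right m n p (B : 'M[R]_(n, p)) (A : 'M[R]_(m, n)) :
  'M[R]_(m, p) := A *m B.

Let measurable_mulmx_right m n p (B : 'M[R]_(n, p)) :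
  measurable_fun setT (@mulmx_right m n p B).
Proof.
apply: measurable_fun_mxP => i j.
rewrite /mulmx_right; under eq_fun do rewrite mxE.
apply: measurable_sum => k.
by apply: measurable_funM => //; exact: measurable_entry.
Qed.

HB.instance Definition _ m n p (B : 'M[R]_(n, p)) :=
  isMeasurableFun.Build _ _ _ _ (@mulmx_right m n p B)
    (@measurable_mulmx_right m n p B).

Definition std_gaussian (d : nat) : probability 'rV[R]_d R :=
  distribution (iid (normal_prob 0 1) d) (@row_of_tuple d).

(* N(0, S) is the law of S^(1/2) g, written as the row vector g^T S^(1/2),
   for g standard normal. *)
Definition gaussian (d : nat) (S : 'M[R]_d) : probability 'rV[R]_d R :=
  distribution (std_gaussian d) (@mulmx_right 1 d d (sqrtmx S)).

End gaussian.

Section privacy.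
Context {R : realType} {dX dY : measure_display}.
Context {X : measurableType dX} {Y : measurableType dY}.

Definition neighbors (n : nat) (x x' : n.-tuple X) : Prop :=
  exists i : 'I_n, tnth x i <> tnth x' i /\
    forall j : 'I_n, j != i -> tnth x j = tnth x' j.

Definition differentially_private (n : nat) (eps delta : R)
    (M : R.-pker (n.-tuple X) ~> Y) : Prop :=
  forall x x' : n.-tuple X, neighbors x x' ->
  forall A : set Y, measurable A ->
    (M x A <= (expR eps)%:E * M x' A + delta%:E)%E.

End privacy.

(* min {1/n, d^2 / (n log (n/d^2))} in the extended reals, where 1/0 = +oo.
   The second term only constrains when n > d^2: taking the positive part of
   the logarithm makes it +oo for n <= d^2, instead of negative. *)
Definition delta_bound {R : realType} (n d : nat) : \bar R :=
  (Order.min (n%:R%:E)^-1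
    ((d%:R ^+ 2)%:E /
     (n%:R * Num.max 0 (ln (n%:R / d%:R ^+ 2)))%:E))%E.

(* Main.v *)
(** Fingerprinting. Let y and w be independent standard Gaussian vectors and
z = y C + w. Then y + z/2 is centred Gaussian with covariance
S = 5/4 I + (C + C^T)/2 + C^T C/4, and the score of the entry C_jk is y_j w_k.
For C with independent uniform entries of size O(1/d), integrating by parts in
each entry against the weight (1 - u^2)/2 shows that an accurate (clamped)
estimate of S correlates with the sum of the scores of the n samples by order
d^2. By privacy each sample contributes only O(eps alpha + delta d): the clamped
statistic is dominated by (|y|^2 + |w|^2)/4, which controls the delta-term. The
law of y + z/2 is identified with that of g S^(1/2), g standard Gaussian, by
uniqueness of the Haar measure on R^d and completing the square; S^(1/2) is
constructed by Banach's fixed point theorem. *)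
Require Import Defs.
From HB Require Import structures.
From mathcomp Require Import all_boot all_order all_algebra.
From mathcomp Require Import all_classical all_reals all_analysis.
From mathcomp Require Import measurable_realfun.
From mathcomp Require Import ring lra.

Set Implicit Arguments.
Unset Strict Implicit.
Unset Printing Implicit Defensive.

Import Order.TTheory GRing.Theory Num.Theory.
Import numFieldNormedType.Exports.

Local Open Scope classical_set_scope.
Local Open Scope ring_scope.

(** * Product measures and resampling *)

Section iid_theory.
Context {R : realType} {d : measure_display} {T : measurableType d}.
Local Open Scope ereal_scope.

(** The score of a row of N(0, S) with respect to S involves the inverse of S. The latent pair (y,
    z) avoids this: relative to the law of (y, w) it has density exp(<yC, z> - |yC|^2 / 2), whose
    exponent is a quadratic polynomial in each entry of C. The mechanism reads only y + z/2, so
    changing one latent pair changes at most one row, and privacy controls statistics of latent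
    pairs. The weight vanishes at both ends of [-1, 1]: integration by parts leaves no boundary term
    and yields an exact identity for every bounded estimator. In the privacy step the statistic of
    one record is signed and unbounded, while privacy compares nonnegative functions. Its positive
    and negative parts are therefore compared separately with the value for an independent record,
    which is the same for both because (y, w) and (-y, w) have the same law. Entries of size 1/(8d)
    give C spectral norm O(1), so that I <= S <= 2I, and, after multiplying the scores by this size,
    a signal of order d against errors of order alpha d, n eps alpha / d and n delta. *)

Lemma integral_iid0 (P : probability T R) (F : 0.-tuple T -> \bar R) :
  measurable_fun setT F -> \int[iid P 0]_t F t = F [tuple].
Proof. by move=> mF; rewrite /= integral_dirac// diracT mul1e. Qed.

Lemma measurable_consr n (x : T) :
  measurable_fun setT (fun t : n.-tuple T => [tuple of x :: t]).
Proof. by apply: measurable_cons => //; exact: measurable_cst. Qed.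

Lemma integral_iidS (P : probability T R) n (F : n.+1.-tuple T -> \bar R) :
  measurable_fun setT F -> (forall t, 0 <= F t) ->
  \int[iid P n.+1]_t F t = \int[P]_x \int[iid P n]_t F [tuple of x :: t].
Proof.
move=> mF F0.
have mc : measurable_fun setT (@consT _ T n) by exact: measurable_cons.
transitivity (\int[(P \x iid P n)]_z (F \o @consT _ T n) z).
  by rewrite /= ge0_integral_pushforward//= preimage_setT.
by rewrite fubini_tonelli1//; [exact: measurableT_comp|move=> z /=; exact: F0].
Qed.

End iid_theory.

Section mktuple.
Context {R : realType} {dA dB dC : measure_display}.
Context {A : measurableType dA} {B : measurableType dB} {C : measurableType dC}.
Local Open Scope ereal_scope.

Lemma measurable_mktuple n (S : nat -> A -> C) :
  (forall i, measurable_fun setT (S i)) ->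
  measurable_fun setT (fun t : n.-tuple A => [tuple S i (tnth t i) | i < n]).
Proof.
move=> mS; apply/measurable_fun_tnthP => i.
rewrite (_ : _ \o _ = S i \o (fun t => tnth t i)).
  by apply: measurableT_comp => //; exact: measurable_tnth.
by apply/funext => t /=; rewrite tnth_mktuple.
Qed.

Lemma mktuple_cons n (S : nat -> A -> C) x (t : n.-tuple A) :
  [tuple S i (tnth [tuple of x :: t] i) | i < n.+1] =
  [tuple of S 0%N x :: [tuple S i.+1 (tnth t i) | i < n]].
Proof.
apply: eq_from_tnth => i; rewrite tnth_mktuple.
case: (unliftP ord0 i) => [j ->|->]; last by rewrite !tnth0.
by rewrite !tnthS tnth_mktuple lift0.
Qed.

Lemma measurable_prod_tnth n (f : nat -> B -> R) :
  (forall i, measurable_fun setT (f i)) ->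
  measurable_fun setT (fun t : n.-tuple B => (\prod_(i < n) f i (tnth t i))%R).
Proof.
move=> mf; apply: measurable_prod => i _.
by apply: measurableT_comp => //; exact: measurable_tnth.
Qed.

End mktuple.

Section iid_transfer.
Context {R : realType} {dA dB dC : measure_display}.
Context {A : measurableType dA} {B : measurableType dB} {C : measurableType dC}.
Local Open Scope ereal_scope.

(* Changes of variables (with densities) of each draw tensorise. *)
Lemma iid_transfer (P : probability A R) (Q : probability B R) n
    (S : nat -> A -> C) (S' : nat -> B -> C) (f : nat -> B -> R) :
  (forall i, measurable_fun setT (S i)) ->
  (forall i, measurable_fun setT (S' i)) ->
  (forall i, measurable_fun setT (f i)) -> (forall i b, (0 <= f i b)%R) ->
  (forall i F, measurable_fun setT F -> (forall c : C, 0 <= F c) ->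
     \int[P]_a F (S i a) = \int[Q]_b (F (S' i b) * (f i b)%:E)) ->
  forall F : n.-tuple C -> \bar R,
    measurable_fun setT F -> (forall t, 0 <= F t) ->
  \int[iid P n]_t F [tuple S i (tnth t i) | i < n] =
  \int[iid Q n]_t (F [tuple S' i (tnth t i) | i < n] *
                   (\prod_(i < n) f i (tnth t i))%:E).
Proof.
elim: n S S' f => [|n IH] S S' f mS mS' mf f0 H F mF F0.
  rewrite integral_iid0; last first.
    by apply: measurableT_comp => //; exact: (measurable_mktuple mS).
  rewrite integral_iid0; last first.
    apply: emeasurable_funM; last first.
      by apply/measurable_EFinP; exact: (measurable_prod_tnth mf).
    by apply: measurableT_comp => //; exact: (measurable_mktuple mS').
  by rewrite big_ord0 mule1; congr F; rewrite [LHS]tuple0 [RHS]tuple0.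
have mFc (c : C) : measurable_fun setT (fun t : n.-tuple C => F [tuple of c :: t]).
  by apply: measurableT_comp => //; exact: measurable_consr.
rewrite integral_iidS//; last first.
  by apply: measurableT_comp => //; exact: (measurable_mktuple mS).
rewrite integral_iidS/=; first last.
- by move=> t; rewrite mule_ge0// lee_fin prodr_ge0.
- apply: emeasurable_funM; last first.
    by apply/measurable_EFinP; exact: (measurable_prod_tnth mf).
  by apply: measurableT_comp => //; exact: (measurable_mktuple mS').
(* [G c] is the integral over the tail, already transferred to Q, when the head has image c. It
   depends on the head only through c, so the one-draw hypothesis [H] applies to it. *)
pose G (c : C) := \int[iid Q n]_t (F [tuple of c :: [tuple S' i.+1 (tnth t i) | i < n]] *
   (\prod_(i < n) f i.+1 (tnth t i))%:E).
have mG2 : measurable_fun setT (fun z : C * n.-tuple B =>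
   F [tuple of z.1 :: [tuple S' i.+1 (tnth z.2 i) | i < n]] *
   (\prod_(i < n) f i.+1 (tnth z.2 i))%:E).
  apply: emeasurable_funM.
    apply: measurableT_comp => //; apply: measurable_cons => //.
    apply: (@measurableT_comp _ _ _ _ _ _ (fun t => [tuple S' i.+1 (tnth t i) | i < n])) => //.
    exact: (measurable_mktuple (S := fun i => S' i.+1)).
  apply/measurable_EFinP.
  apply: (@measurableT_comp _ _ _ _ _ _ (fun t : n.-tuple B => (\prod_(i < n) f i.+1 (tnth t i))%R)) => //.
  exact: (measurable_prod_tnth (f := fun i => f i.+1)).
have G20 z : 0 <= F [tuple of z.1 :: [tuple S' i.+1 (tnth z.2 i) | i < n]] *
   (\prod_(i < n) f i.+1 (tnth z.2 i))%:E.
  by rewrite mule_ge0// lee_fin prodr_ge0.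
transitivity (\int[P]_a G (S 0%N a)).
  apply: eq_integral => a _; under eq_integral do rewrite mktuple_cons.
  have := IH (fun i => S i.+1) (fun i => S' i.+1) (fun i => f i.+1)
    (fun i => mS i.+1) (fun i => mS' i.+1) (fun i => mf i.+1)
    (fun i => f0 i.+1) (fun i => H i.+1) _ (mFc (S 0%N a)) (fun t => F0 _).
  exact.
rewrite (H 0%N G); last 2 first.
- exact: (measurable_fun_fubini_tonelli_F _ mG2 G20).
- by move=> c; apply: integral_ge0 => t _; exact: (G20 (c, t)).
apply: eq_integral => b _; rewrite /G muleC -ge0_integralZl//; last 3 first.
- exact: (measurableT_comp mG2 (pair1_measurable _)).
- by move=> t _; exact: (G20 (_, t)).
- by rewrite lee_fin.
apply: eq_integral => t _; rewrite mktuple_cons muleCA; congr (_ * _).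
rewrite -EFinM; congr (_%:E); rewrite [RHS]big_ord_recl tnth0; congr (_ * _)%R.
by apply: eq_bigr => i _; rewrite tnthS.
Qed.

End iid_transfer.

Definition tset {T} n (t : n.-tuple T) (i : 'I_n) (x : T) : n.-tuple T :=
  [tuple if j == i then x else tnth t j | j < n].

Lemma tnth_tset T n (t : n.-tuple T) i x j :
  tnth (tset t i x) j = if j == i then x else tnth t j.
Proof. by rewrite tnth_mktuple. Qed.

Lemma tset_cons0 T n (x0 x : T) (t : n.-tuple T) :
  tset [tuple of x0 :: t] ord0 x = [tuple of x :: t].
Proof.
apply: eq_from_tnth => j; rewrite tnth_tset.
by case: (unliftP ord0 j) => [k ->|->]; rewrite ?tnth0// !tnthS.
Qed.

Lemma tset_consS T n (x0 x : T) (t : n.-tuple T) i :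
  tset [tuple of x0 :: t] (lift ord0 i) x = [tuple of x0 :: tset t i x].
Proof.
apply: eq_from_tnth => j; rewrite tnth_tset.
case: (unliftP ord0 j) => [k ->|->]; last by rewrite !tnth0.
by rewrite (inj_eq lift_inj) !tnthS tnth_tset.
Qed.

Lemma tset_tset T n (t : n.-tuple T) i (x y : T) :
  tset (tset t i x) i y = tset t i y.
Proof. by apply: eq_from_tnth => j; rewrite !tnth_tset; case: (j == i). Qed.

Section integral_cst_prob.
Context {R : realType} {d : measure_display} {T : measurableType d}.
Local Open Scope ereal_scope.

Lemma integral_cst_prob (P : probability T R) (c : \bar R) : \int[P]_x c = c.
Proof.
transitivity (c * P setT); first exact: integral_cst.
by rewrite probability_setT mule1.
Qed.

End integral_cst_prob.

Section resample.
Context {R : realType} {d : measure_display} {T : measurableType d}.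
Local Open Scope ereal_scope.

Lemma measurable_tset n (i : 'I_n) :
  measurable_fun setT (fun z : n.-tuple T * T => tset z.1 i z.2).
Proof.
apply/measurable_fun_tnthP => j.
rewrite (_ : _ \o _ = if j == i then snd else (fun t => tnth t j) \o fst).
  case: ifP => _; first exact: measurable_snd.
  by apply: (measurableT_comp (measurable_tnth j)); exact: measurable_fst.
by apply/funext => z /=; rewrite tnth_tset; case: ifP.
Qed.

(** Isolates the integral over one coordinate with the others frozen; both the integration by parts
    in one entry of C and the replacement of one record rest on it. At the head coordinate it is
    Tonelli, elsewhere induction. *)
Lemma integral_iid_resample (P : probability T R) n (i : 'I_n)
    (F : n.-tuple T -> \bar R) :
  measurable_fun setT F -> (forall t, 0 <= F t) ->
  \int[iid P n]_t F t = \int[iid P n]_t \int[P]_x F (tset t i x).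
Proof.
elim: n i F => [[]//|n IH] i F mF F0.
have mFt : measurable_fun setT (fun z : n.+1.-tuple T * T => F (tset z.1 i z.2)).
  by apply: measurableT_comp => //; exact: measurable_tset.
rewrite integral_iidS//.
rewrite [RHS]integral_iidS//; last 2 first.
- exact: (measurable_fun_fubini_tonelli_F _ mFt (fun=> F0 _)).
- by move=> t; apply: integral_ge0.
case: (unliftP ord0 i) => [j ij|i0]; subst i.
  apply: eq_integral => x _.
  rewrite (IH j)//; last by apply: measurableT_comp => //; exact: measurable_consr.
  by apply: eq_integral => t _; apply: eq_integral => y _; rewrite tset_consS.
under [in RHS]eq_integral => x _.
  under eq_integral => t _ do under eq_integral => y _ do rewrite tset_cons0.
  over.
rewrite [RHS]integral_cst_prob.
rewrite (fubini_tonelli (fun z : T * n.-tuple T => F [tuple of z.1 :: z.2]))//.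
by apply: measurableT_comp => //; exact: measurable_cons.
Qed.

Lemma integral_iid_tnth (P : probability T R) n (i : 'I_n) (f : T -> \bar R) :
  measurable_fun setT f -> (forall t, 0 <= f t) ->
  \int[iid P n]_t f (tnth t i) = \int[P]_x f x.
Proof.
move=> mf f0; rewrite (integral_iid_resample _ i)//; last first.
  by apply: measurableT_comp => //; exact: measurable_tnth.
under eq_integral => t _ do under eq_integral => y _ do rewrite tnth_tset eqxx.
by rewrite integral_cst_prob.
Qed.

(** Once coordinate i is redrawn, its old value is independent of the new tuple. The proof resamples
    coordinate i once more: the redrawn tuple forgets the outer value, and after Tonelli the inner
    resampling is undone. *)
Lemma integral_iid_indep_copy (P : probability T R) n (i : 'I_n)
    (H : T * n.-tuple T -> \bar R) :
  measurable_fun setT H -> (forall z, 0 <= H z) ->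
  \int[iid P n]_t \int[P]_x H (tnth t i, tset t i x) =
  \int[P]_x \int[iid P n]_t H (x, t).
Proof.
move=> mH H0.
have mH1 : measurable_fun setT
    (fun z : n.-tuple T * T => H (tnth z.1 i, tset z.1 i z.2)).
  apply: measurableT_comp => //; apply: measurable_fun_pair.
    by apply: (measurableT_comp (measurable_tnth i)).
  exact: measurable_tset.
rewrite (integral_iid_resample _ i); last 2 first.
- exact: (measurable_fun_fubini_tonelli_F _ mH1 (fun=> H0 _)).
- by move=> t; exact: integral_ge0.
have mH2 : measurable_fun setT (fun z : T * n.-tuple T =>
    \int[P]_y H (z.1, tset z.2 i y)).
  apply: (measurable_fun_fubini_tonelli_F
    (fun w : (T * n.-tuple T) * T => H (w.1.1, tset w.1.2 i w.2))) => //.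
  apply: measurableT_comp => //; apply: measurable_fun_pair.
    exact: measurableT_comp.
  apply: (measurableT_comp (measurable_tset i)
    (g := fun w : (T * n.-tuple T) * T => (w.1.2, w.2))).
  by apply: measurable_fun_pair => //; exact: measurableT_comp.
under eq_integral => t _ do under eq_integral => x _ do
  under eq_integral => y _ do rewrite tset_tset tnth_tset eqxx.
rewrite -(fubini_tonelli (fun z : T * n.-tuple T =>
    \int[P]_y H (z.1, tset z.2 i y)))//=; last first.
  by move=> z; exact: integral_ge0.
apply: eq_integral => x _; rewrite -(integral_iid_resample P i (F := fun t => H (x, t)))//.
exact: (measurableT_comp mH (pair1_measurable _)).
Qed.

End resample.

(** * Gaussian measures *)

Section normal.
Context {R : realType}.
Local Open Scope ereal_scope.
Notation mu := (@lebesgue_measure R).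

(** The change of variables is available for the Radon-Nikodym derivative; this agrees almost
    everywhere with [normal_pdf], since both have the same integral over every measurable set. *)
Lemma ge0_integral_normal_prob (m s : R) (F : measurableTypeR R -> \bar R) :
  measurable_fun setT F -> (forall x, 0 <= F x) ->
  \int[normal_prob m s]_x F x = \int[mu]_x (F x * (normal_pdf m s x)%:E).
Proof.
move=> mF F0; have dom := normal_prob_dominates m s.
rewrite -(Radon_Nikodym_SigmaFinite.change_of_variables dom)//.
apply: ge0_ae_eq_integral => //.
- apply: emeasurable_funM => //; apply: measurable_int.
  exact: (Radon_Nikodym_SigmaFinite.f_integrable dom).
- apply: emeasurable_funM => //; apply/measurable_EFinP.
  exact: measurable_normal_pdf.
- move=> x _; rewrite mule_ge0//; exact: Radon_Nikodym_SigmaFinite.f_ge0.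
- by move=> x _; rewrite mule_ge0// lee_fin normal_pdf_ge0.
- apply: ae_eqe_mul2l; apply: integral_ae_eq => //.
  + exact: (Radon_Nikodym_SigmaFinite.f_integrable dom).
  + by apply/measurable_EFinP; exact: measurable_normal_pdf.
  + by move=> E _ mE; rewrite -Radon_Nikodym_SigmaFinite.f_integral.
Qed.

(** The image of Lebesgue measure under a translation gives half-open intervals their length, which
    characterises Lebesgue measure. *)
Lemma ge0_integral_lebesgue_shift (v : R) (F : measurableTypeR R -> \bar R) :
  measurable_fun setT F -> (forall x, 0 <= F x) ->
  \int[mu]_x F (x + v)%R = \int[mu]_x F x.
Proof.
move=> mF F0.
have ms : measurable_fun setT (fun x : measurableTypeR R => (x + v)%R : measurableTypeR R).
  by apply: measurable_funD => //; exact: measurable_cst.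
rewrite -(@ge0_integral_pushforward _ _ _ _ _ _ ms mu setT F)//.
apply: eq_measure_integral => //= A mA _.
apply/esym; apply: (lebesgue_measure_unique (mu := pushforward mu _)) => //.
move=> X [[a b] /= ab <-]; rewrite lebesgue_measure_itv/= /pushforward.
rewrite (_ : _ @^-1` _ = `]a - v, b - v]%classic)%R; last first.
  by apply/seteqP; split=> x /=; rewrite !in_itv/= ltrBlDr lerBrDr.
rewrite lebesgue_measure_itv/= !lte_fin ltrD2r; case: ifP => // _.
by rewrite -!EFinB opprB addrA subrK.
Qed.

(** One-dimensional Cameron-Martin formula: the factor is the ratio of the standard normal densities
    at x - v and x. *)
Lemma ge0_integral_normal_shift (v : R) (F : measurableTypeR R -> \bar R) :
  measurable_fun setT F -> (forall x, 0 <= F x) ->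
  \int[normal_prob 0 1]_x F (x + v)%R =
  \int[normal_prob 0 1]_x (F x * (expR (v * x - v ^+ 2 / 2))%:E).
Proof.
move=> mF F0.
have ms : measurable_fun setT (fun x : measurableTypeR R => (x + v)%R : measurableTypeR R).
  by apply: measurable_funD => //; exact: measurable_cst.
have me : measurable_fun setT (fun x : measurableTypeR R => expR (v * x - v ^+ 2 / 2)).
  by apply: measurableT_comp => //; apply: measurable_funB.
have m1 : (1%R : R) != 0%R by rewrite oner_eq0.
rewrite !ge0_integral_normal_prob//; last 3 first.
- by apply: emeasurable_funM => //; exact/measurable_EFinP.
- by move=> x; rewrite mule_ge0// lee_fin expR_ge0.
- exact: (measurableT_comp mF ms).
rewrite -[RHS](ge0_integral_lebesgue_shift v); last 2 first.
- apply: emeasurable_funM; last first.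
    by apply/measurable_EFinP; exact: measurable_normal_pdf.
  by apply: emeasurable_funM => //; exact/measurable_EFinP.
- by move=> x; rewrite !mule_ge0// lee_fin ?expR_ge0 ?normal_pdf_ge0.
apply: eq_integral => x _; rewrite -muleA; congr (_ * _); rewrite -EFinM; congr (_%:E).
rewrite !(normal_pdfE _ m1)/= /normal_fun mulrCA -expRD; congr (_ * expR _)%R.
by field.
Qed.

End normal.

Section measurable_matrix_functions.
Context {R : realType} {d : measure_display} {U : measurableType d}.

Lemma measurable_mx_entry m n (f : U -> 'M[R]_(m, n)) i j :
  measurable_fun setT f -> measurable_fun setT (fun u => f u i j).
Proof. by move=> mf; exact: (measurableT_comp (measurable_entry i j) mf). Qed.

Lemma measurable_addmx m n (f g : U -> 'M[R]_(m, n)) :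
  measurable_fun setT f -> measurable_fun setT g ->
  measurable_fun setT (fun u => f u + g u).
Proof.
move=> mf mg; apply: measurable_fun_mxP => i j; under eq_fun do rewrite mxE.
by apply: measurable_funD; exact: measurable_mx_entry.
Qed.

Lemma measurable_oppmx m n (f : U -> 'M[R]_(m, n)) :
  measurable_fun setT f -> measurable_fun setT (fun u => - f u).
Proof.
move=> mf; apply: measurable_fun_mxP => i j; under eq_fun do rewrite mxE.
by apply: measurableT_comp => //; exact: measurable_mx_entry.
Qed.

Lemma measurable_scalemx m n (c : U -> R) (f : U -> 'M[R]_(m, n)) :
  measurable_fun setT c -> measurable_fun setT f ->
  measurable_fun setT (fun u => c u *: f u).
Proof.
move=> mc mf; apply: measurable_fun_mxP => i j; under eq_fun do rewrite mxE.
by apply: measurable_funM => //; exact: measurable_mx_entry.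
Qed.

Lemma measurable_trmx m n (f : U -> 'M[R]_(m, n)) :
  measurable_fun setT f -> measurable_fun setT (fun u => (f u)^T).
Proof.
move=> mf; apply: measurable_fun_mxP => i j; under eq_fun do rewrite mxE.
exact: measurable_mx_entry.
Qed.

Lemma measurable_mulmx m n p (f : U -> 'M[R]_(m, n)) (g : U -> 'M[R]_(n, p)) :
  measurable_fun setT f -> measurable_fun setT g ->
  measurable_fun setT (fun u => f u *m g u).
Proof.
move=> mf mg; apply: measurable_fun_mxP => i j; under eq_fun do rewrite mxE.
by apply: measurable_sum => k; apply: measurable_funM; exact: measurable_mx_entry.
Qed.

End measurable_matrix_functions.

Definition dotp {R : realType} d (x y : 'rV[R]_d) : R := \sum_j x 0 j * y 0 j.

Section dotp.
Context {R : realType} {d : nat}.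
Implicit Types x y z : 'rV[R]_d.

Lemma dotpE x y : dotp x y = (x *m y^T) 0 0.
Proof. by rewrite mxE; apply: eq_bigr => j _; rewrite mxE. Qed.

Lemma dotpC x y : dotp x y = dotp y x.
Proof. by apply: eq_bigr => j _; rewrite mulrC. Qed.

Lemma dotpDl x y z : dotp (x + y) z = dotp x z + dotp y z.
Proof. by rewrite !dotpE mulmxDl mxE. Qed.

Lemma dotpNl x z : dotp (- x) z = - dotp x z.
Proof. by rewrite !dotpE mulNmx mxE. Qed.

Lemma dotpZl a x z : dotp (a *: x) z = a * dotp x z.
Proof. by rewrite !dotpE -scalemxAl mxE. Qed.

Lemma dotpDr x y z : dotp z (x + y) = dotp z x + dotp z y.
Proof. by rewrite dotpC dotpDl !(dotpC z). Qed.

Lemma dotpNr x z : dotp z (- x) = - dotp z x.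
Proof. by rewrite dotpC dotpNl dotpC. Qed.

Lemma dotpZr a x z : dotp z (a *: x) = a * dotp z x.
Proof. by rewrite dotpC dotpZl dotpC. Qed.

Lemma dotp_ge0 x : 0 <= dotp x x.
Proof. by apply: sumr_ge0 => j _; rewrite -expr2 sqr_ge0. Qed.

Lemma dotp_mulmxl x y (A : 'M[R]_d) : dotp (x *m A) y = dotp x (y *m A^T).
Proof. by rewrite !dotpE trmx_mul trmxK mulmxA. Qed.

Lemma measurable_dotp (dU : measure_display) (U : measurableType dU)
    (f g : U -> 'rV[R]_d) :
  measurable_fun setT f -> measurable_fun setT g ->
  measurable_fun setT (fun u => dotp (f u) (g u)).
Proof.
move=> mf mg; apply: measurable_sum => j.
by apply: measurable_funM; exact: measurable_mx_entry.
Qed.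

End dotp.

(** Measurability by the shape of the function. Patterns such as [dotp ?v] and [mulmx ?A] catch
    eta-reduced functions; for sums and opposites the matrix rule is tried before the scalar one. *)
Ltac mfun := repeat (
  lazymatch goal with
  | mF : measurable_fun setT ?F |- measurable_fun setT ?F => exact: mF
  | mF : forall i, measurable_fun setT (?F i) |- measurable_fun setT (?F _) =>
      exact: mF
  | |- measurable_fun _ (fun _ => ?c) => exact: measurable_cst
  | |- measurable_fun _ (cst ?c) => exact: measurable_cst
  | |- measurable_fun _ (fun u => u) => exact: measurable_id
  | |- measurable_fun _ id => exact: measurable_id
  | |- measurable_fun _ fst => exact: measurable_fst
  | |- measurable_fun _ snd => exact: measurable_snd
  | mF : measurable_fun setT ?F |- measurable_fun setT (fun u => ?F _) =>
      apply: (measurableT_comp mF)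
  | mF : forall i, measurable_fun setT (?F i)
    |- measurable_fun setT (fun u => ?F _ _) =>
      apply: (measurableT_comp (mF _))
  | |- measurable_fun _ (fun u => (_, _)) => apply: measurable_fun_pair
  | |- measurable_fun _ (fun u => fst _) => apply: (measurableT_comp measurable_fst)
  | |- measurable_fun _ (fun u => snd _) => apply: (measurableT_comp measurable_snd)
  | |- measurable_fun _ (fun u => EFin _) => apply/measurable_EFinP
  | |- measurable_fun _ (fun u => mule _ _) => apply: emeasurable_funM
  | |- measurable_fun _ (fun u => dotp _ _) => apply: measurable_dotp
  | |- measurable_fun _ (dotp ?v) =>
      apply: (@measurable_dotp _ _ _ _ (fun=> v) id)
  | |- measurable_fun _ (GRing.scale ?c) =>
      apply: (@measurable_scalemx _ _ _ _ _ (fun=> c) id)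
  | |- measurable_fun _ (mulmx ?A) =>
      apply: (@measurable_mulmx _ _ _ _ _ _ (fun=> A) id)
  | |- measurable_fun _ (fun u => expR _) =>
      apply: (measurableT_comp (@measurable_expR _))
  | |- measurable_fun _ (fun u => GRing.mul _ _) => apply: measurable_funM
  | |- measurable_fun _ (fun u => GRing.exp _ _) => apply: measurable_funX
  | |- measurable_fun _ (fun u => mulmx _ _) => apply: measurable_mulmx
  | |- measurable_fun _ (fun u => trmx _) => apply: measurable_trmx
  | |- measurable_fun _ (fun u => GRing.scale _ _) => apply: measurable_scalemx
  | |- measurable_fun _ (fun u => fun_of_matrix _ _ _) =>
      apply: measurable_mx_entry
  | |- measurable_fun _ (fun u => bigop _ _ _) => apply: measurable_sum => ?
  | |- measurable_fun _ (fun u => Algebra.add _ _) =>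
      first [apply: measurable_addmx | apply: measurable_funD]
  | |- measurable_fun _ (Algebra.add ?A) =>
      first [apply: (@measurable_addmx _ _ _ _ _ (fun=> A) id)
            | apply: (measurable_funD (f := fun=> A) (g := id))]
  | |- measurable_fun _ (fun u => Algebra.opp _) =>
      first [apply: measurable_oppmx
            | apply: (measurableT_comp (@oppr_measurable _ _))]
  | |- measurable_fun _ Algebra.opp =>
      first [apply: (@measurable_oppmx _ _ _ _ _ id) | exact: oppr_measurable]
  end).

Section std_gaussian.
Context {R : realType} {d : nat}.
Local Open Scope ereal_scope.
Notation gam := (@std_gaussian R d).
Notation N01 := (@normal_prob R 0 1).

Lemma integral_std_gaussian (F : 'rV[R]_d -> \bar R) :
  measurable_fun setT F -> (forall x, 0 <= F x) ->
  \int[gam]_x F x = \int[iid N01 d]_t F (row_of_tuple t).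
Proof.
move=> mF F0; rewrite ge0_integral_pushforward//.
Qed.

Lemma gauss_shift v (F : 'rV[R]_d -> \bar R) :
  measurable_fun setT F -> (forall x, 0 <= F x) ->
  \int[gam]_x F (x + v)%R = \int[gam]_x (F x * (expR (dotp v x - dotp v v / 2))%:E).
Proof.
move=> mF F0.
(* [iid_transfer] indexes its maps by natural numbers, so the coordinates of v are extended by 0
   beyond d. *)
pose w (i : nat) : R := if insub i is Some j then v ord0 j else 0%R.
have wE (i : 'I_d) : w i = v ord0 i by rewrite /w valK.
have mrow : measurable_fun setT (@row_of_tuple R d) by exact: measurable_funPT.
rewrite !integral_std_gaussian//; last 3 first.
- by mfun.
- by move=> x; rewrite mule_ge0// lee_fin expR_ge0.
- by mfun.
have := @iid_transfer R _ _ _ (measurableTypeR R) (measurableTypeR R) (measurableTypeR R)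
  N01 N01 d (fun i x => (x + w i)%R) (fun i x => x)
  (fun i x => expR (w i * x - w i ^+ 2 / 2)).
move=> /(_ _ _ _ _ _ (F \o @row_of_tuple R d)) H.
transitivity (\int[iid N01 d]_t
  (F \o @row_of_tuple R d) [tuple (tnth t i + w i)%R | i < d]).
  apply: eq_integral => t _ /=; congr F; apply/rowP => j.
  by rewrite !mxE tnth_mktuple wE.
rewrite H//=.
- apply: eq_integral => t _; congr (F _ * _).
    by apply/rowP => j; rewrite !mxE tnth_mktuple.
  rewrite -expR_sum; congr ((expR _)%:E).
  rewrite sumrB /dotp mulr_suml; congr (_ - _)%R; apply: eq_bigr => i _; rewrite wE ?mxE//.
- by move=> i; apply: measurable_funD => //; exact: measurable_cst.
- by move=> i; apply: measurableT_comp => //; apply: measurable_funB.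
- by move=> i G mG G0; exact: ge0_integral_normal_shift.
- exact: measurableT_comp.
Qed.

End std_gaussian.

Section gaussian_linear.
Context {R : realType} {d : nat}.
Local Open Scope ereal_scope.
Notation gam := (@std_gaussian R d).
Implicit Types (F : 'rV[R]_d -> \bar R) (H : 'M[R]_d).

(* Up to a constant factor, the Lebesgue integral on R^d. *)
Definition gK F : \bar R := \int[gam]_x (F x * (expR (dotp x x / 2))%:E).

Lemma gK_ge0 F : (forall x, 0 <= F x) -> 0 <= gK F.
Proof.
by move=> F0; apply: integral_ge0 => x _; rewrite mule_ge0// lee_fin expR_ge0.
Qed.

Lemma eq_gK F G : F =1 G -> gK F = gK G.
Proof. by move=> FG; apply: eq_integral => x _; rewrite FG. Qed.

Lemma integral_gK F : measurable_fun setT F ->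
  \int[gam]_x F x = gK (fun x => F x * (expR (- (dotp x x / 2)))%:E).
Proof.
move=> mF; apply: eq_integral => x _.
by rewrite -muleA -EFinM -expRD addNr expR0 mule1.
Qed.

Lemma gK_normal : gK (fun x => (expR (- (dotp x x / 2)))%:E) = 1.
Proof.
rewrite -[RHS](integral_cst_prob gam 1) integral_gK//.
by apply: eq_gK => x; rewrite mul1e.
Qed.

(** The Cameron-Martin factor turns the weight exp(|x - v|^2 / 2) back into exp(|x|^2 / 2), so the
    weighted integral is translation invariant. *)
Lemma gK_shift v F : measurable_fun setT F -> (forall x, 0 <= F x) ->
  gK (fun x => F (x + v)%R) = gK F.
Proof.
move=> mF F0; rewrite /gK.
pose Fv x := F x * (expR (dotp (x - v) (x - v) / 2))%:E.
transitivity (\int[gam]_x Fv (x + v)%R).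
  by apply: eq_integral => x _; rewrite /Fv addrK.
rewrite gauss_shift; last 2 first.
- by rewrite /Fv; mfun.
- by move=> x; rewrite mule_ge0// lee_fin expR_ge0.
apply: eq_integral => x _; rewrite /Fv -muleA -EFinM -expRD; congr (_ * (expR _)%:E).
rewrite !(dotpDl, dotpDr, dotpNl, dotpNr) (dotpC x v); lra.
Qed.

Lemma gKZl F (c : \bar R) : measurable_fun setT F -> (forall x, 0 <= F x) ->
  0 <= c -> gK (fun x => c * F x) = c * gK F.
Proof.
move=> mF F0 c0; rewrite /gK -ge0_integralZl//; last 2 first.
- by mfun.
- by move=> x _; rewrite mule_ge0// lee_fin expR_ge0.
by apply: eq_integral => x _; rewrite muleA.
Qed.

Lemma gKZr F (c : \bar R) : measurable_fun setT F -> (forall x, 0 <= F x) ->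
  0 <= c -> gK (fun x => F x * c) = gK F * c.
Proof.
by move=> mF F0 c0; rewrite muleC -gKZl//; apply: eq_gK => x; rewrite muleC.
Qed.

Lemma gK_swap (F : 'rV[R]_d * 'rV[R]_d -> \bar R) :
  measurable_fun setT F -> (forall z, 0 <= F z) ->
  gK (fun x => gK (fun y => F (x, y))) = gK (fun y => gK (fun x => F (x, y))).
Proof.
move=> mF F0; rewrite /gK.
pose G (z : 'rV[R]_d * 'rV[R]_d) := F z *
  (expR (dotp z.1 z.1 / 2) * expR (dotp z.2 z.2 / 2))%:E.
have mG : measurable_fun setT G by rewrite /G; mfun.
have G0 z : 0 <= G z by rewrite mule_ge0// lee_fin mulr_ge0 ?expR_ge0.
transitivity (\int[gam]_x \int[gam]_y G (x, y)).
  apply: eq_integral => x _; rewrite muleC -ge0_integralZl//.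
  - by apply: eq_integral => y _; rewrite /G EFinM muleCA.
  - by mfun.
  - by move=> y _; rewrite mule_ge0// lee_fin expR_ge0.
rewrite fubini_tonelli//.
apply: eq_integral => y _; rewrite [RHS]muleC -ge0_integralZl//.
- by apply: eq_integral => x _; rewrite /G mulrC EFinM [RHS]muleCA.
- by mfun.
- by move=> x _; rewrite mule_ge0// lee_fin expR_ge0.
Qed.

Lemma measurable_gK (F : 'rV[R]_d * 'rV[R]_d -> \bar R) :
  measurable_fun setT F -> (forall z, 0 <= F z) ->
  measurable_fun setT (fun x => gK (fun y => F (x, y))).
Proof.
move=> mF F0.
apply: (measurable_fun_fubini_tonelli_F
  (fun z => F z * (expR (dotp z.2 z.2 / 2))%:E)).
- by mfun.
- by move=> z; rewrite mule_ge0// lee_fin expR_ge0.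
Qed.

(* Uniqueness of the Haar measure: both gK and F |-> gK (F \o *m H) are
   translation invariant. *)
Lemma gK_mulmx H : H \in unitmx ->
  exists2 c : \bar R, 0 <= c & forall F, measurable_fun setT F ->
    (forall x, 0 <= F x) -> gK (fun x => F (x *m H)) = c * gK F.
Proof.
move=> uH.
pose g (x : 'rV[R]_d) := (expR (- (dotp x x / 2)))%:E : \bar R.
have mg : measurable_fun setT g by rewrite /g; mfun.
have g0 x : 0 <= g x by rewrite lee_fin expR_ge0.
have gN x : g (- x)%R = g x by rewrite /g dotpNl dotpNr opprK.
(* This constant is 1/|det H|, kept as an integral; later uses normalise it away by testing on the
   constant function 1. *)
exists (gK (fun x => g (x *m H))); first exact: gK_ge0.
move=> F mF F0.
rewrite -gKZr//; [|by mfun|exact: gK_ge0].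
(* Integrating g(yH) F(x + yH) over x first gives the constant times [gK F]. Translating y by - x
   H^-1 instead gives g(yH - x) F(yH), whose integral over x is F(yH) because g has total mass 1. *)
transitivity (gK (fun y => gK (fun x => g (y *m H) * F (x + y *m H)%R))); last first.
  apply: eq_gK => y; rewrite gKZl//; last by mfun.
  by rewrite (gK_shift (y *m H)).
rewrite -(gK_swap (F := fun z => g (z.2 *m H) * F (z.1 + z.2 *m H)%R)); last 2 first.
- by mfun.
- by move=> z; rewrite mule_ge0.
transitivity (gK (fun x => gK (fun y => g (y *m H - x)%R * F (y *m H)))); last first.
  apply: eq_gK => x /=.
  rewrite -[RHS](gK_shift (- (x *m invmx H))); last 2 first.
  - by mfun.
  - by move=> y; rewrite mule_ge0.
  apply: eq_gK => y; rewrite mulmxDl mulNmx mulmxKV//.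
  by rewrite addrCA subrr addr0.
rewrite (gK_swap (F := fun z => g (z.2 *m H - z.1)%R * F (z.2 *m H))); last 2 first.
- by mfun.
- by move=> z; rewrite mule_ge0.
apply: eq_gK => y /=; rewrite gKZr//; last by mfun.
suff -> : gK (fun x => g (y *m H - x)%R) = 1 by rewrite mul1e.
rewrite -gK_normal -[RHS](gK_shift (- (y *m H)) mg g0).
by apply: eq_gK => x; rewrite -gN opprD opprK addrC.
Qed.

End gaussian_linear.

Section gaussian_covariance.
Context {R : realType} {d : nat}.
Local Open Scope ereal_scope.
Notation gam := (@std_gaussian R d).
Implicit Types (F : 'rV[R]_d -> \bar R) (H : 'M[R]_d).

(** Both sides integrate F against a multiple of the density exp(- x (H^2)^-1 x^T / 2); F = 1 shows
    that the multiples agree. This replaces any computation of the determinants. *)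
Lemma gauss_mulmx H (P : 'M[R]_d) (s : R) : (0 < s)%R -> H^T = H ->
  H \in unitmx -> H *m H = (P^T *m P + (s ^+ 2)%:M)%R -> forall F,
  measurable_fun setT F -> (forall x, 0 <= F x) ->
  \int[gam]_x F (x *m H) = \int[gam]_y \int[gam]_w F (y *m P + s *: w)%R.
Proof.
move=> s0 symH uH HH.
pose G := invmx (H *m H).
pose q (x : 'rV[R]_d) := (expR (- (dotp x (x *m G) / 2)))%:E : \bar R.
have mq : measurable_fun setT q by rewrite /q; mfun.
have q0 x : 0 <= q x by rewrite lee_fin expR_ge0.
have uHH : H *m H \in unitmx by rewrite unitmx_mul uH.
have HGH : H *m (G *m H) = 1%:M.
  by rewrite -(mulmxK uH (H *m (G *m H))) -!mulmxA (mulmxA G) (mulmxA (G *m H)) -(mulmxA G) mulVmx// mul1mx mulmxV.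
have [c c0 cE] := gK_mulmx uH.
have L F : measurable_fun setT F -> (forall x, 0 <= F x) ->
    \int[gam]_x F (x *m H) = c * gK (fun x => F x * q x).
  move=> mF F0; rewrite -cE; [|by mfun|by move=> x; rewrite mule_ge0].
  rewrite integral_gK; last by mfun.
  apply: eq_gK => x; congr (_ * (expR (- (_ / 2)))%:E).
  rewrite dotp_mulmxl symH; congr (dotp _ _).
  by rewrite -2!mulmxA HGH mulmx1.
have us : (s%:M : 'M[R]_d) \in unitmx by rewrite unitmxE det_scalar unitrX// unitfE gt_eqF.
have [b b0 bE] := gK_mulmx us.
(* Given x = yP + sw, the vector y is Gaussian with mean xJ and precision matrix [N]. The identity
   [quad] below completes the square accordingly, leaving the quadratic form of the marginal density
   of x. *)
pose J := G *m P^T.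
pose N := (1%:M + (s ^- 2) *: (P *m P^T))%R.
have sn0 : s != 0%R by rewrite gt_eqF.
have JN : J *m N = (s ^- 2 *: P^T)%R.
  have -> : P^T = G *m (H *m H) *m P^T by rewrite mulVmx// mul1mx.
  rewrite HH /N /J mulmxDr mulmx1 mulmxDr mulmxDl mul_mx_scalar scalerDr.
  by rewrite -scalemxAl scalerA mulVf ?expf_neq0// scale1r addrC -scalemxAr !mulmxA.
have quad (x y : 'rV[R]_d) :
    (dotp (x - y *m P) (x - y *m P) / s ^+ 2 + dotp y y =
     dotp (y - x *m J) ((y - x *m J) *m N) + dotp x (x *m G))%R.
  have aN : x *m J *m N = (s ^- 2 *: (x *m P^T))%R by rewrite -mulmxA JN -scalemxAr.
  have yN : y *m N = (y + s ^- 2 *: (y *m P *m P^T))%R.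
    by rewrite /N mulmxDr mulmx1 -scalemxAr mulmxA.
  have e : x = (x *m J *m P + s ^+ 2 *: (x *m G))%R.
    rewrite -[LHS]mulmx1 -[1%:M](mulVmx uHH) -/G HH !mulmxDr mul_mx_scalar.
    by rewrite -scalemxAr /J !mulmxA.
  have xx : (dotp x x = dotp x (x *m J *m P) + s ^+ 2 * dotp x (x *m G))%R.
    by have := congr1 (dotp x) e; rewrite dotpDr dotpZr.
  have yx : (dotp (y *m P) x =
      dotp (x *m J *m P) (y *m P) + s ^+ 2 * dotp y (x *m J))%R.
    have := congr1 (dotp (y *m P)) e; rewrite dotpDr dotpZr => ->.
    by rewrite [in LHS]dotpC (dotp_mulmxl y) /J !mulmxA.
  rewrite mulmxBl aN yN !(dotpDl, dotpDr, dotpNl, dotpNr, dotpZr).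
  rewrite -!dotp_mulmxl (dotpC _ (y *m P)) (dotpC (x *m J) y).
  rewrite (dotpC (x *m J *m P) x) xx yx.
  by field.
have [c' c'0 L'] : exists2 c' : \bar R, 0 <= c' & forall F, measurable_fun setT F ->
    (forall x, 0 <= F x) ->
    \int[gam]_y \int[gam]_w F (y *m P + s *: w)%R = c' * gK (fun x => F x * q x).
  pose E (x y : 'rV[R]_d) := (expR (- (dotp (x - y *m P) (x - y *m P) / s ^+ 2 / 2)))%:E
    : \bar R.
  have E0 x y : 0 <= E x y by rewrite lee_fin expR_ge0.
  pose n0 := gK (fun y => (expR (- (dotp y (y *m N) / 2)))%:E).
  have n00 : 0 <= n0 by apply: gK_ge0 => x; rewrite lee_fin expR_ge0.
  exists (b * n0); first by rewrite mule_ge0.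
  move=> F mF F0.
  have step1 y : \int[gam]_w F (y *m P + s *: w)%R = b * gK (fun x => F x * E x y).
    rewrite integral_gK; last by mfun.
    pose Phi x := F (y *m P + x)%R * (expR (- (dotp x x / s ^+ 2 / 2)))%:E.
    transitivity (gK (fun w => Phi (w *m s%:M))).
      apply: eq_gK => w; rewrite /Phi mul_mx_scalar dotpZl dotpZr.
      congr (_ * (expR (- (_ / 2)))%:E); by field.
    rewrite (bE Phi); last 2 first.
    - by rewrite /Phi; mfun.
    - by move=> x; rewrite mule_ge0// lee_fin expR_ge0.
    apply: (congr1 (mule b)).
    have mFE : measurable_fun setT (fun x => F x * E x y) by rewrite /E; mfun.
    have FE0 x : 0 <= F x * E x y by rewrite mule_ge0.
    rewrite -(gK_shift (y *m P) mFE FE0).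
    by apply: eq_gK => x; rewrite /Phi /E addrK addrC.
  under eq_integral do rewrite step1.
  have mE2 : measurable_fun setT (fun z : 'rV[R]_d * 'rV[R]_d =>
      F z.1 * E z.1 z.2 * (expR (- (dotp z.2 z.2 / 2)))%:E).
    by rewrite /E; mfun.
  have E20 (z : 'rV[R]_d * 'rV[R]_d) :
      0 <= F z.1 * E z.1 z.2 * (expR (- (dotp z.2 z.2 / 2)))%:E.
    by rewrite !mule_ge0// lee_fin expR_ge0.
  have mgK : measurable_fun setT (fun y => gK (fun x => F x * E x y)).
    apply: (measurable_gK (F := fun z => F z.2 * E z.2 z.1)); first by rewrite /E; mfun.
    by move=> z; rewrite mule_ge0.
  rewrite integral_gK; last by mfun.
  pose G1 y := gK (fun x => F x * E x y * (expR (- (dotp y y / 2)))%:E).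
  have mG1 : measurable_fun setT G1.
    apply: (measurable_gK (F := fun z => F z.2 * E z.2 z.1 *
      (expR (- (dotp z.1 z.1 / 2)))%:E)); first by rewrite /E; mfun.
    by move=> z; exact: (E20 (z.2, z.1)).
  have G10 y : 0 <= G1 y by apply: gK_ge0 => x; exact: (E20 (x, y)).
  transitivity (b * gK G1).
    rewrite -(gKZl mG1 G10 b0); apply: eq_gK => y; rewrite -muleA; congr (_ * _).
    rewrite -[LHS](gKZr (F := fun x => F x * E x y))//.
    - by rewrite /E; mfun.
    - by move=> x; rewrite mule_ge0.
  have mFq : measurable_fun setT (fun x => F x * q x) by mfun.
  have Fq0 x : 0 <= F x * q x by rewrite mule_ge0.
  rewrite -muleA -(gKZl mFq Fq0 n00).
  rewrite /G1 -(gK_swap mE2 E20).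
  congr (_ * _); apply: eq_gK => x /=.
  under eq_gK => y do rewrite -muleA.
  rewrite (gKZl (F := fun y => E x y * (expR (- (dotp y y / 2)))%:E))//; last 2 first.
  - by rewrite /E; mfun.
  - by move=> y; rewrite mule_ge0// lee_fin expR_ge0.
  rewrite muleCA; congr (_ * _).
  have -> : n0 = gK (fun y => (expR (- (dotp (y - x *m J)
      ((y - x *m J) *m N) / 2)))%:E).
    rewrite /n0 -(gK_shift (- (x *m J))
      (F := fun y => (expR (- (dotp y (y *m N) / 2)))%:E))//.
    by mfun.
  pose g1 y : \bar R := (expR (- (dotp (y - x *m J) ((y - x *m J) *m N) / 2)))%:E.
  have mg1 : measurable_fun setT g1 by rewrite /g1; mfun.
  have g10 y : 0 <= g1 y by rewrite lee_fin expR_ge0.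
  rewrite -/g1 -(gKZr mg1 g10 (q0 x)).
  apply: eq_gK => y; rewrite /g1 /E /q -!EFinM -!expRD; congr (expR _)%:E.
  by have := quad x y; lra.
move=> F mF F0.
rewrite L// L'//.
have k0 : 0 <= gK (fun x => cst 1 x * q x) by apply: gK_ge0 => x; rewrite mule_ge0.
have c1 : c * gK (fun x => cst 1 x * q x) = 1.
  by rewrite -L//; exact: (integral_cst_prob gam 1).
have c'1 : c' * gK (fun x => cst 1 x * q x) = 1.
  rewrite -L'//=; under eq_integral do rewrite integral_cst_prob.
  exact: (integral_cst_prob gam 1).
(* It remains that c = c'. Both have product 1 with the same integral; that integral is not +oo,
   since then the product would be 0 or +oo, so it can be inverted. *)
congr (_ * _).
case: (gK _) k0 c1 c'1 => [r _ c1 c'1|_ c1 _|//].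
  have r0 : r != 0%R.
    by apply/eqP => r0; move: c1; rewrite r0 mule0 => /esym/eqP; rewrite onee_eq0.
  have inv_r (e : \bar R) : e * r%:E = 1 -> e = (r^-1)%:E.
    by move=> er; rewrite -[LHS]mule1 -[1](_ : r%:E * r^-1%:E = 1) ?muleA ?er ?mul1e// -EFinM divff.
  by rewrite (inv_r c)// (inv_r c').
exfalso; move: c1; move: c0; rewrite le_eqVlt => /predU1P[<-|c0].
  by rewrite mul0e => /esym/eqP; rewrite onee_eq0.
by rewrite gt0_muley.
Qed.

End gaussian_covariance.

(** Joins completeness to the normed structure of matrices, for use by [banach_fixed_point]. *)
HB.instance Definition _ (R : realType) (m n : nat) := Complete.on 'M[R]_(m, n).

(** * Square roots of perturbations of a scalar matrix *)

Section small_matrices.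
Context {R : realType}.

(** An entrywise substitute for spectral norm at most t: it implies the bounds on bilinear forms
    needed below, is multiplicative under products, and can be enforced by clamping entries. *)
Definition small d (t : R) (A : 'M[R]_d) : Prop :=
  forall i j, `|A i j| <= t / d%:R.

(** Each |y_j w_k| is at most (y_j^2 + w_k^2)/2, and in the double sum every square occurs d times,
    which cancels the 1/d of [small]. *)
Lemma bilin_small d t (A : 'M[R]_d) y w : small t A ->
  `|dotp (y *m A) w| <= t / 2 * (dotp y y + dotp w w).
Proof.
case: d A y w => [|d] A y w sA; first by rewrite /dotp !big_ord0 normr0 addr0 mulr0.
rewrite /dotp; under eq_bigr do rewrite mxE mulr_suml.
apply: le_trans (ler_norm_sum _ _ _) _.
apply: (@le_trans _ _ (\sum_k \sum_j (t / d.+1%:R) * ((y 0 j * y 0 j + w 0 k * w 0 k) / 2))).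
  apply: ler_sum => k _; apply: le_trans (ler_norm_sum _ _ _) _.
  apply: ler_sum => j _; rewrite mulrAC normrM mulrC.
  apply: ler_pM => //.
  have := sqr_ge0 (`|y 0 j| - `|w 0 k|).
  have := real_normK (num_real (y 0 j)); have := real_normK (num_real (w 0 k)).
  by rewrite normrM; nra.
rewrite le_eqVlt; apply/orP; left; apply/eqP.
have cst (c : R) : \sum_(k < d.+1) c = d.+1%:R * c.
  by rewrite sumr_const card_ord mulr_natl.
under eq_bigr do rewrite -mulr_sumr -mulr_suml big_split/= cst.
rewrite -mulr_sumr -mulr_suml big_split/= cst -mulr_sumr.
by field.
Qed.

Lemma quad_small d t (A : 'M[R]_d) x : small t A ->
  `|dotp (x *m A) x| <= t * dotp x x.
Proof. by move=> /(bilin_small x x)/le_trans; apply; rewrite -mulr2n -[_ *+ 2]mulr_natr; lra. Qed.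

Lemma small_mulmx d s t (A B : 'M[R]_d) : small s A -> small t B ->
  small (s * t) (A *m B).
Proof.
move=> sA sB i j; rewrite mxE; apply: le_trans (ler_norm_sum _ _ _) _.
case: d A B sA sB i j => [|d] A B sA sB i j; first by case: i.
apply: (@le_trans _ _ (\sum_(k < d.+1) (s / d.+1%:R) * (t / d.+1%:R))).
  by apply: ler_sum => k _; rewrite normrM; apply: ler_pM.
rewrite sumr_const card_ord -mulr_natr le_eqVlt; apply/orP; left; apply/eqP.
by field.
Qed.

Lemma smallW d s t (A : 'M[R]_d) : s <= t -> small s A -> small t A.
Proof.
by move=> st sA i j; apply: le_trans (sA i j) _; rewrite ler_wpM2r// invr_ge0.
Qed.

Lemma smallD d s t (A B : 'M[R]_d) : small s A -> small t B ->
  small (s + t) (A + B).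
Proof.
move=> sA sB i j; rewrite mxE mulrDl; apply: le_trans (ler_normD _ _) _.
exact: lerD.
Qed.

Lemma smallZ d s t (A : 'M[R]_d) : small s A -> small (`|t| * s) (t *: A).
Proof. by move=> sA i j; rewrite mxE normrM -mulrA ler_wpM2l. Qed.

Lemma smallT d s (A : 'M[R]_d) : small s A -> small s A^T.
Proof. by move=> sA i j; rewrite mxE. Qed.

(** The equation says that (I - B)^2 = I - E. The map B |-> (E + B^2)/2 sends the box [small 2^-1]
    into itself, as (1/2)(1/2 + 1/4) <= 1/2, and contracts the max norm by 1/2, since A^2 - B^2 =
    A(A - B) + (A - B)B. The transpose of the fixed point is again a fixed point in the box, so
    uniqueness makes B symmetric. *)
Lemma small_fixpoint d (E : 'M[R]_d) : small 2^-1 E -> E^T = E ->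
  exists B : 'M[R]_d, [/\ B^T = B, small 2^-1 B & 2 *: B = E + B *m B].
Proof.
case: d E => [|d] E sE symE.
  by exists 0; split=> [|[]//|]; apply/matrixP => -[].
pose r : R := 2^-1 / d.+1%:R.
have r0 : 0 <= r by rewrite divr_ge0.
pose U : set 'M[R]_d.+1 := [set B | `|B| <= r].
have nE (B : 'M[R]_d.+1) : `|B| = \big[Num.max/0]_ij `|B ij.1 ij.2| := mx_normrE B.
have nle (B : 'M[R]_d.+1) i j : `|B i j| <= `|B|.
  rewrite nE; exact: (le_bigmax _ (fun ij : 'I_d.+1 * 'I_d.+1 => `|B ij.1 ij.2|) (i, j)).
have UP B : U B <-> small 2^-1 B.
  split=> [UB i j|sB].
    exact: le_trans (nle _ _ _) UB.
  by rewrite /U/= nE; apply/bigmax_leP; split=> // -[i j] _; exact: sB.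
pose f (B : 'M[R]_d.+1) := 2^-1 *: (E + B *m B).
have fU : set_fun U U f.
  move=> B /UP sB; apply/UP.
  apply: (@smallW _ (`|2^-1| * (2^-1 + 2^-1 * 2^-1))); first by rewrite ger0_norm; lra.
  by apply: smallZ; apply: smallD => //; exact: small_mulmx.
have ctr : is_contraction (mkfun_fun fU).
  have h0 : 0 <= (2^-1 : R) by lra.
  exists (NngNum h0); split => /=; first lra.
  move=> [A B] [/= /UP sA /UP sB].
  rewrite /f -scalerBr opprD addrACA subrr add0r.
  have -> : A *m A - B *m B = A *m (A - B) + (A - B) *m B.
    by rewrite mulmxBr mulmxBl addrA subrK.
  have sD : small (`|A - B| * d.+1%:R) (A - B).
    move=> i j; rewrite mulfK ?pnatr_eq0//; exact: nle.
  have n0 := normr_ge0 (A - B).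
  rewrite [leLHS]nE; apply/bigmax_leP; split; first by rewrite mulr_ge0.
  move=> [i j] _ /=.
  have := smallZ (2^-1) (smallD (small_mulmx sA sD) (small_mulmx sD sB)) i j.
  move=> /le_trans; apply; rewrite ger0_norm//.
  rewrite le_eqVlt; apply/orP; left; apply/eqP.
  by field.
have clU : closed U.
  apply: (@preimage_closed _ _ (fun B : 'M[R]_d.+1 => `|B|) [set x | x <= r]).
    by move=> B _; exact: norm_continuous.
  exact: closed_le.
have U0 : U !=set0 by exists 0; rewrite /U/= normr0.
have [B UB fB] := banach_fixed_point ctr clU U0.
have fBE : B = 2^-1 *: (E + B *m B) := fB.
exists B; split.
- apply: (contraction_fixpoint_unique ctr) => //.
    by apply/UP/smallT/UP.
  rewrite /= /f [in LHS]fBE linearZ/= linearD/= trmx_mul symE//.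
- exact/UP.
- by rewrite [in LHS]fBE scalerA divff ?scale1r// pnatr_eq0.
Qed.

End small_matrices.

Section square_root.
Context {R : realType} {d : nat}.
Implicit Types A B H S : 'M[R]_d.

Definition fro2 A : R := \sum_i \sum_j A i j ^+ 2.

Lemma fro2_ge0 A : 0 <= fro2 A.
Proof. by apply: sumr_ge0 => i _; apply: sumr_ge0 => j _; exact: sqr_ge0. Qed.

Lemma fro2_row A : fro2 A = \sum_i dotp (row i A) (row i A).
Proof.
by apply: eq_bigr => i _; apply: eq_bigr => j _; rewrite mxE expr2.
Qed.

Lemma fro2_tr A : fro2 A^T = fro2 A.
Proof.
by rewrite /fro2 exchange_big; do 2 apply: eq_bigr => ? _; rewrite mxE.
Qed.

Lemma fro2_mulmx A H c : (forall x, dotp (x *m H) (x *m H) <= c * dotp x x) ->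
  fro2 (A *m H) <= c * fro2 A.
Proof.
move=> cH; rewrite !fro2_row mulr_sumr; apply: ler_sum => i _.
by rewrite row_mul.
Qed.

Lemma fro2_mul_sym A H c : H^T = H ->
  (forall x, dotp (x *m H) (x *m H) <= c * dotp x x) ->
  fro2 (H *m A) <= c * fro2 A.
Proof.
move=> symH cH; rewrite -fro2_tr trmx_mul symH -(fro2_tr A).
exact: fro2_mulmx.
Qed.

Lemma quadE A (x : 'rV[R]_d) : (x *m A *m x^T) 0 0 = dotp (x *m A) x.
Proof. by rewrite dotpE. Qed.

Lemma mxtrace_quad A B : B^T = B -> \tr (B *m A *m B) = \sum_i dotp (row i B *m A) (row i B).
Proof.
move=> symB; apply: eq_bigr => i _; rewrite dotpE -{2}symB -row_mul mxE.
rewrite [in RHS]mxE; apply: eq_bigr => j _.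
by rewrite !mxE.
Qed.

Lemma coercive_unitmx H c : 0 < c ->
  (forall x, c * dotp x x <= dotp (x *m H) x) -> H \in unitmx.
Proof.
move=> c0 cH; rewrite -row_free_unit; apply: inj_row_free => v vH0.
have := cH v; rewrite vH0 [leRHS]dotpE mul0mx mxE pmulr_rle0// => v0.
have /eqP : dotp v v = 0 by apply: le_anti; rewrite v0 dotp_ge0.
rewrite psumr_eq0 => [/allP vv|i _]; last by rewrite -expr2 sqr_ge0.
apply/rowP => j; have := vv j (mem_index_enum _).
by rewrite -expr2 sqrf_eq0 mxE => /eqP.
Qed.

(** [sqrtmx] is a choice, so its value needs uniqueness. For another root B the difference D = B - H
    satisfies BD + DH = 0, hence tr(DBD) + tr(DHD) = 0. Both traces are nonnegative, and coercivity
    of H forces D = 0. *)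
Lemma sqrtmx_sqr H c : 0 < c -> H^T = H ->
  (forall x, c * dotp x x <= dotp (x *m H) x) -> sqrtmx (H *m H) = H.
Proof.
move=> c0 symH cH; rewrite /sqrtmx; apply: xget_unique.
  split=> //; split=> // x; rewrite quadE; apply: le_trans (cH x).
  by rewrite mulr_ge0 ?dotp_ge0// ltW.
move=> B [[symB Bge0] BB].
set D := B - H.
have symD : D^T = D by rewrite /D linearB/= symB symH.
have D0 : B *m D + D *m H = 0.
  by rewrite /D mulmxBr mulmxBl BB addrA subrK subrr.
have : \tr (D *m B *m D) + \tr (D *m H *m D) = 0.
  rewrite (mxtrace_mulC (D *m H)) -mxtraceD -mulmxA -mulmxDr D0 mulmx0.
  exact: mxtrace0.
rewrite !mxtrace_quad// => tr0.
have DH : \sum_i dotp (row i D) (row i D) = 0.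
  apply: le_anti; apply/andP; split; last by apply: sumr_ge0 => i _; exact: dotp_ge0.
  rewrite -(pmulr_rle0 _ c0) mulr_sumr.
  apply: (@le_trans _ _ (\sum_i dotp (row i D *m H) (row i D))).
    by apply: ler_sum => i _; exact: cH.
  rewrite -[leRHS]tr0 lerDr; apply: sumr_ge0 => i _.
  by rewrite -quadE; exact: Bge0.
apply/eqP; rewrite -subr_eq0 -/D; apply/eqP/matrixP => i j; rewrite [RHS]mxE.
move: DH; rewrite -fro2_row => /eqP; rewrite psumr_eq0; last first.
  by move=> k _; apply: sumr_ge0 => l _; exact: sqr_ge0.
move=> /allP/(_ i (mem_index_enum _))/=; rewrite psumr_eq0; last first.
  by move=> k _; exact: sqr_ge0.
by move=> /allP/(_ j (mem_index_enum _))/=; rewrite sqrf_eq0 => /eqP.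
Qed.

(** With N = H^-1 A H^-1 one has A = H N H, and each multiplication by H costs at most a factor 2
    because H^2 <= 2I. *)
Lemma fro2_mahalanobis H A : H^T = H -> H \in unitmx ->
  sqrtmx (H *m H) = H ->
  (forall x, dotp (x *m (H *m H)) x <= 2 * dotp x x) ->
  fro2 A <= 4 * mahalanobis (H *m H) A ^+ 2.
Proof.
move=> symH uH sH cH; rewrite /mahalanobis sH /frobenius sqr_sqrtr ?fro2_ge0//.
set N := invmx H *m A *m invmx H.
have cH' x : dotp (x *m H) (x *m H) <= 2 * dotp x x.
  by rewrite dotp_mulmxl symH -mulmxA dotpC; exact: cH.
have -> : A = H *m (N *m H) by rewrite /N mulmxKV// mulmxA mulmxV// mul1mx.
apply: le_trans (fro2_mul_sym _ symH cH') _.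
rewrite -/(fro2 N) (_ : 4 = 2 * 2 :> R)//; last by rewrite -natrM.
by rewrite -mulrA ler_wpM2l// fro2_mulmx.
Qed.

Lemma loewner_small (a t : R) A : A^T = A -> small t A -> t <= a ->
  psdmx (a%:M + A).
Proof.
move=> symA sA ta; split; first by rewrite linearD/= tr_scalar_mx symA.
move=> x; rewrite quadE mulmxDr mul_mx_scalar dotpDl dotpZl.
have := quad_small x sA; rewrite ler_norml => /andP[+ _].
by have := dotp_ge0 x; nra.
Qed.

(** Since (5/4)I + A = (5/4)(I - E) with E = -(4/5)A, the root is sqrt(5/4) (I - B) for the B of
    [small_fixpoint]. It is coercive with constant 1/2, as sqrt(5/4) >= 1 and B is bounded by
    1/2. *)
Lemma small_sqrt A : A^T = A -> small 4^-1 A ->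
  exists H, [/\ H^T = H, H \in unitmx, sqrtmx (H *m H) = H &
    H *m H = (5 / 4)%:M + A].
Proof.
move=> symA sA.
pose E := - (4 / 5) *: A.
have sE : small 2^-1 E.
  apply: smallW (smallZ (- (4 / 5)) sA); rewrite normrN ger0_norm; lra.
have symE : E^T = E by rewrite linearZ/= symA.
have [B [symB sB BE]] := small_fixpoint sE symE.
pose k : R := Num.sqrt (5 / 4).
have kk : k * k = 5 / 4 by rewrite -expr2 sqr_sqrtr.
have k1 : 1 <= k by rewrite -sqrtr1 ler_sqrt; lra.
pose H := k *: (1%:M - B).
have symH : H^T = H by rewrite linearZ/= linearB/= trmx1 symB.
have HH : H *m H = (5 / 4)%:M + A.
  rewrite -scalemxAl -scalemxAr scalerA kk mulmxBr mulmx1 mulmxBl mul1mx.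
  have -> : 1%:M - B - (B - B *m B) = 1%:M - E.
    have -> : E = 2 *: B - B *m B by rewrite BE addrK.
    by rewrite scaler_nat mulr2n !opprD !opprK !addrA.
  rewrite scalerBr /E scaleNr scalerN opprK scalerA scalemx1.
  have -> : 5 / 4 * (4 / 5) = 1 :> R by field.
  by rewrite scale1r.
have cH x : 2^-1 * dotp x x <= dotp (x *m H) x.
  rewrite -scalemxAr mulmxBr mulmx1 dotpZl dotpDl dotpNl.
  have := quad_small x sB; rewrite ler_norml => /andP[_].
  have := dotp_ge0 x; nra.
have h0 : 0 < (2^-1 : R) by lra.
exists H; split=> //; first exact: coercive_unitmx cH.
exact: sqrtmx_sqr cH.
Qed.

End square_root.

(** * Moments of the scores *)

Section gaussian_moments.
Context {R : realType} {d : nat}.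
Local Open Scope ereal_scope.
Notation gam := (@std_gaussian R d).

(** Shifting the constant function 1 shows that exp(<v, x> - |v|^2 / 2) has mean 1. *)
Lemma gauss_mgf (v : 'rV[R]_d) :
  \int[gam]_x (expR (dotp v x))%:E = (expR (dotp v v / 2))%:E.
Proof.
have H := @gauss_shift R d v (cst 1) (@measurable_cst _ _ _ _ _ _) (fun=> lee01).
rewrite -[RHS]mule1 -[X in _ = _ * X](integral_cst_prob gam 1) H -ge0_integralZl//.
- apply: eq_integral => x _; rewrite mul1e -EFinM -expRD; congr (expR _)%:E.
  by rewrite addrC subrK.
- by mfun.
- by move=> x _; rewrite mule_ge0// lee_fin expR_ge0.
Qed.

Lemma sqr_le_expR (a : R) : (a ^+ 2 <= 4 * (expR a + expR (- a)))%R.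
Proof.
wlog a0 : a / (0 <= a)%R => [H|].
  have [a0|a0] := leP 0%R a; first exact: H.
  by have := H (- a)%R; rewrite sqrrN opprK addrC; apply; rewrite oppr_ge0 ltW.
have h : (1 + a / 2 <= expR (a / 2))%R by exact: expR_ge1Dx.
have -> : expR a = (expR (a / 2) ^+ 2)%R by rewrite -expRM_natl; congr expR; field.
have := expR_ge0 (- a); nra.
Qed.

(** A crude constant suffices (the exact value is |v|^2). After scaling v to unit length, a^2 <=
    4(e^a + e^-a) and the moment generating function give 4 (2 e^(1/2)) <= 16. *)
Lemma gauss_second_moment (v : 'rV[R]_d) :
  \int[gam]_x ((dotp v x) ^+ 2)%:E <= (16 * dotp v v)%:E.
Proof.
have [v0|v0] := eqVneq (dotp v v) 0%R.
  have -> : v = 0%R.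
    apply/rowP => j; move: v0 => /eqP; rewrite psumr_eq0 => [/allP vv|i _]; last first.
      by rewrite -expr2 sqr_ge0.
    by have := vv j (mem_index_enum _); rewrite -expr2 sqrf_eq0 mxE => /eqP.
  rewrite /dotp; under eq_integral do under eq_bigr do rewrite mxE mul0r.
  under eq_integral do rewrite big1_eq expr0n/=.
  rewrite integral0 lee_fin mulr_ge0//; exact: dotp_ge0.
have vp : (0 < dotp v v)%R by rewrite lt0r v0 dotp_ge0.
pose t : R := Num.sqrt (dotp v v)^-1.
have tt : (t * t * dotp v v = 1)%R by rewrite -expr2 sqr_sqrtr ?invr_ge0 ?dotp_ge0// mulVf.
apply: (@le_trans _ _ (\int[gam]_x ((dotp v v)%:E * (4%:E * ((expR (dotp (t *: v) x))%:E + (expR (dotp (- (t *: v)) x))%:E))))).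
  apply: ge0_le_integral => //.
  - by move=> x _; rewrite lee_fin sqr_ge0.
  - by mfun.
  - apply: measurable_funeM; apply: measurable_funeM; apply: emeasurable_funD; by mfun.
  - move=> x _; rewrite -EFinD -!EFinM lee_fin.
    have := sqr_le_expR (dotp (t *: v) x); rewrite dotpNl dotpZl exprMn => h.
    have -> : (dotp v x ^+ 2 = dotp v v * (t ^+ 2 * dotp v x ^+ 2))%R.
      by rewrite expr2 [X in (_ * (X * _))%R]expr2 mulrA (mulrC (dotp v v)) tt mul1r.
    by rewrite ler_wpM2l// ltW.
rewrite ge0_integralZl//; last 3 first.
- apply: measurable_funeM; apply: emeasurable_funD; by mfun.
- by move=> x _; rewrite -EFinD -EFinM lee_fin mulr_ge0// addr_ge0// expR_ge0.
- by rewrite lee_fin ltW.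
rewrite ge0_integralZl//; last 2 first.
- apply: emeasurable_funD; by mfun.
- by move=> x _; rewrite -EFinD lee_fin addr_ge0// expR_ge0.
rewrite ge0_integralD//; last 2 first.
- by mfun.
- by mfun.
rewrite !gauss_mgf dotpNl dotpNr opprK dotpZl dotpZr mulrA tt -EFinD -!EFinM lee_fin.
have e2 : (expR (1 / 2) <= 2 :> R)%R.
  have := expR_ge1Dx (- (1 / 2) : R)%R; rewrite expRN.
  have := expR_gt0 (1 / 2 : R)%R => e0.
  rewrite -(ler_pM2r e0) mulVf ?gt_eqF//; lra.
nra.
Qed.

(** [gK_mulmx] for -I gives the equality up to a constant, because |x|^2 is even; F = 1 shows that
    the constant is 1. *)
Lemma gauss_opp (F : 'rV[R]_d -> \bar R) :
  measurable_fun setT F -> (forall x, 0 <= F x) ->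
  \int[gam]_x F (- x)%R = \int[gam]_x F x.
Proof.
have uN : ((-1)%:M : 'M[R]_d) \in unitmx.
  by rewrite unitmxE det_scalar unitrX// unitrN1.
have [c c0 cE] := gK_mulmx uN.
have H G : measurable_fun setT G -> (forall x, 0 <= G x) ->
    \int[gam]_x G (- x)%R = c * \int[gam]_x G x.
  move=> mG G0; rewrite [in LHS]integral_gK; last by mfun.
  rewrite (integral_gK mG).
  pose G1 x := G x * (expR (- (dotp x x / 2)))%:E.
  have mG1 : measurable_fun setT G1 by rewrite /G1; mfun.
  have G10 x : 0 <= G1 x by rewrite mule_ge0// lee_fin expR_ge0.
  rewrite -(cE G1 mG1 G10).
  by apply: eq_gK => x; rewrite /G1 mul_mx_scalar scaleN1r dotpNl dotpNr opprK.
move=> mF F0; rewrite H//.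
have := H (cst 1) (@measurable_cst _ _ _ _ _ _) (fun=> lee01).
by rewrite /= integral_cst_prob mule1 => <-; rewrite mul1e.
Qed.

Lemma gauss_sqnorm : \int[gam]_x (dotp x x)%:E <= (16 * d%:R)%:E.
Proof.
have dE (x : 'rV[R]_d) : dotp x x = (\sum_j dotp (delta_mx 0 j) x ^+ 2)%R.
  apply: eq_bigr => j _; rewrite expr2.
  by rewrite dotpC dotpE trmx_delta -colE mxE.
under eq_integral => x _ do rewrite dE -sumEFin.
rewrite ge0_integral_sum//; last 2 first.
- by move=> j; mfun.
- by move=> j x _; rewrite lee_fin sqr_ge0.
apply: (@le_trans _ _ (\sum_(j < d) 16%:E)).
  apply: lee_sum => j _; apply: le_trans (gauss_second_moment _) _.
  by rewrite dotpE trmx_delta mul_delta_mx mxE !eqxx mulr1.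
by rewrite sumEFin sumr_const card_ord mulr_natr.
Qed.

Definition gauss_pair : probability ('rV[R]_d * 'rV[R]_d)%type R := (gam \x gam).

Lemma integral_gauss_pair (F : 'rV[R]_d * 'rV[R]_d -> \bar R) :
  measurable_fun setT F -> (forall x, 0 <= F x) ->
  \int[gauss_pair]_z F z = \int[gam]_y \int[gam]_w F (y, w).
Proof. by move=> mF F0; rewrite /gauss_pair fubini_tonelli1. Qed.

Lemma gauss_pair_oppl (F : 'rV[R]_d * 'rV[R]_d -> \bar R) :
  measurable_fun setT F -> (forall x, 0 <= F x) ->
  \int[gauss_pair]_z F (- z.1, z.2)%R = \int[gauss_pair]_z F z.
Proof.
move=> mF F0.
have mF' : measurable_fun setT (fun z : 'rV[R]_d * 'rV[R]_d => F (- z.1, z.2)%R).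
  by mfun.
rewrite (integral_gauss_pair mF F0) (integral_gauss_pair mF' (fun=> F0 _)).
rewrite -[RHS](gauss_opp (measurable_fun_fubini_tonelli_F _ mF F0))//.
by move=> x; exact: integral_ge0.
Qed.

Lemma gauss_pair_sqnorm :
  \int[gauss_pair]_z (dotp z.1 z.1 + dotp z.2 z.2)%:E <= (32 * d%:R)%:E.
Proof.
under eq_integral do rewrite EFinD.
rewrite ge0_integralD//; last 4 first.
- by move=> x _; rewrite lee_fin dotp_ge0.
- by mfun.
- by move=> x _; rewrite lee_fin dotp_ge0.
- by mfun.
have dp x : (0 <= (dotp x x)%:E :> \bar R) by rewrite lee_fin dotp_ge0.
rewrite !integral_gauss_pair//; last 2 first.
- by mfun.
- by mfun.
rewrite /= integral_cst_prob; under eq_integral do rewrite integral_cst_prob.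
have -> : (32 * d%:R)%:E = (16 * d%:R)%:E + (16 * d%:R)%:E :> \bar R.
  by rewrite -EFinD; congr _%:E; lra.
by apply: leeD; exact: gauss_sqnorm.
Qed.

(** The second-moment bound is used for w with y fixed, then for y against each column of G, whence
    16^2. Independence of y and w yields the Frobenius norm without a dimension factor, which is
    what makes one record contribute only O(alpha). *)
Lemma gauss_pair_bilin_sqr (G : 'M[R]_d) :
  \int[gauss_pair]_z ((dotp (z.1 *m G) z.2) ^+ 2)%:E <= (256 * fro2 G)%:E.
Proof.
rewrite integral_gauss_pair; last 2 first.
- by mfun.
- by move=> x; rewrite lee_fin sqr_ge0.
apply: (@le_trans _ _ (\int[gam]_y (\sum_j (16%:E * (dotp (col j G)^T y ^+ 2)%:E)))).
  apply: ge0_le_integral => //.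
  - by move=> x _; apply: integral_ge0 => y _; rewrite lee_fin sqr_ge0.
  - apply: (measurable_fun_fubini_tonelli_F (fun z : 'rV[R]_d * 'rV[R]_d => ((dotp (z.1 *m G) z.2) ^+ 2)%:E)); first by mfun.
    by move=> z; rewrite lee_fin sqr_ge0.
  - by apply: emeasurable_sum => j; apply: measurable_funeM; mfun.
  - move=> y _ /=; apply: le_trans (gauss_second_moment _) _.
    rewrite -ge0_sume_distrr; last by move=> j _; rewrite lee_fin sqr_ge0.
    rewrite sumEFin -EFinM lee_fin ler_wpM2l//.
    rewrite [leLHS]/dotp; apply: ler_sum => j _; rewrite -expr2.
    rewrite (_ : (y *m G) ord0 j = dotp (col j G)^T y)//.
    by rewrite mxE; apply: eq_bigr => k _; rewrite !mxE mulrC.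
rewrite ge0_integral_sum//; last 2 first.
- by move=> j; apply: measurable_funeM; mfun.
- by move=> j x _; rewrite -EFinM lee_fin mulr_ge0// sqr_ge0.
apply: (@le_trans _ _ (\sum_j (16 * (16 * dotp (col j G)^T (col j G)^T))%:E)).
  apply: lee_sum => j _; rewrite ge0_integralZl//; last 2 first.
  - by mfun.
  - by move=> x _; rewrite lee_fin sqr_ge0.
  by rewrite EFinM lee_wpmul2l ?lee_fin//; exact: gauss_second_moment.
rewrite sumEFin lee_fin -mulr_sumr -mulr_sumr mulrA -natrM.
rewrite (_ : \sum_j _ = fro2 G)%R// -fro2_tr fro2_row.
by apply: eq_bigr => j _; rewrite tr_col.
Qed.

(** For fixed y this is the Gaussian shift by yC in the second variable; the factor is the density
    of (y, yC + w) with respect to the law of (y, w). *)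
Lemma gauss_pair_shear (C : 'M[R]_d) (F : 'rV[R]_d * 'rV[R]_d -> \bar R) :
  measurable_fun setT F -> (forall x, 0 <= F x) ->
  \int[gauss_pair]_z F (z.1, z.1 *m C + z.2)%R =
  \int[gauss_pair]_z
    (F z * (expR (dotp (z.1 *m C) z.2 - dotp (z.1 *m C) (z.1 *m C) / 2))%:E).
Proof.
move=> mF F0.
have mF' : measurable_fun setT (fun z : 'rV[R]_d * 'rV[R]_d =>
    F (z.1, z.1 *m C + z.2)%R) by mfun.
rewrite (integral_gauss_pair mF' (fun=> F0 _)).
rewrite integral_gauss_pair; last 2 first.
- by mfun.
- by move=> x; rewrite mule_ge0// lee_fin expR_ge0.
apply: eq_integral => y _ /=.
rewrite -(@gauss_shift _ _ _ (fun w => F (y, w)))//; last by mfun.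
by under eq_integral do rewrite addrC.
Qed.

(** The right-hand vector is yP + w/2 with P = I + C/2, and P^T P + I/4 = S: this is [gauss_mulmx]
    with s = 1/2 and H the root supplied by [small_sqrt]. *)
Lemma integral_gaussian (C S : 'M[R]_d) : S = ((5 / 4)%:M + 2^-1 *: (C + C^T) + 4^-1 *: (C^T *m C))%R ->
  small 4^-1 (2^-1 *: (C + C^T) + 4^-1 *: (C^T *m C))%R ->
  forall F : 'rV[R]_d -> \bar R, measurable_fun setT F -> (forall x, 0 <= F x) ->
  \int[gaussian S]_x F x =
  \int[gauss_pair]_z F (z.1 + 2^-1 *: (z.1 *m C + z.2))%R.
Proof.
move=> SE sS F mF F0.
pose A : 'M[R]_d := (2^-1 *: (C + C^T) + 4^-1 *: (C^T *m C))%R.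
have symA : A^T = A.
  rewrite /A linearD/= !linearZ/= linearD/= trmxK trmx_mul trmxK.
  by rewrite (addrC C^T).
have [H [symH uH sH HH]] := small_sqrt symA sS.
have SHH : S = H *m H by rewrite HH SE addrA.
have PE : H *m H = ((1%:M + 2^-1 *: C)^T *m (1%:M + 2^-1 *: C) + (2^-1 ^+ 2)%:M)%R.
  rewrite HH /A [(1%:M + _)^T]linearD/= trmx1 [(_ *: C)^T]linearZ/= mulmxDl mul1mx.
  rewrite mulmxDr mulmx1 -scalemxAl -scalemxAr scalerA.
  move: (C^T *m C) => X; apply/matrixP => i j; rewrite !mxE.
  by case: (i == j) => /=; rewrite ?mulr1n ?mulr0n; field.
have s0 : (0 < 2^-1 :> R)%R by rewrite invr_gt0.
transitivity (\int[gam]_x F (x *m H)).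
  rewrite /gaussian ge0_integral_pushforward// preimage_setT.
  by apply: eq_integral => x _; rewrite /= /mulmx_right SHH sH.
have mF' : measurable_fun setT (fun z : 'rV[R]_d * 'rV[R]_d =>
    F (z.1 + 2^-1 *: (z.1 *m C + z.2))%R) by mfun.
rewrite (integral_gauss_pair mF' (fun=> F0 _)) (gauss_mulmx s0 symH uH PE mF F0).
apply: eq_integral => y _; apply: eq_integral => w _ /=.
by rewrite mulmxDr mulmx1 -scalemxAr scalerDr addrA.
Qed.

End gaussian_moments.

(** * The family of covariances and the fingerprinting identity *)

Section clamp.
Context {R : realType}.

Definition clamp (k v : R) : R := Num.max (- k) (Num.min v k).

Lemma clamp_le k v : 0 <= k -> `|clamp k v| <= k.
Proof.
move=> k0; rewrite /clamp ler_norml; apply/andP; split.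
  by rewrite le_max lexx.
by rewrite ge_max ge_min lexx orbT andbT; lra.
Qed.

Lemma clamp_id k v : `|v| <= k -> clamp k v = v.
Proof.
by rewrite ler_norml => /andP[kv vk]; rewrite /clamp (min_l vk) (max_r kv).
Qed.

Lemma clamp_dist k v w : `|w| <= k -> `|clamp k v - w| <= `|v - w|.
Proof.
rewrite ler_norml => /andP[kw wk]; rewrite /clamp.
have [vk|kv] := leP v k.
  have [kv|vk'] := leP (- k) v; first by [].
  by rewrite !ler0_norm; lra.
by rewrite max_r ?ger0_norm; lra.
Qed.

Lemma measurable_clamp (d : measure_display) (T : measurableType d) k (f : T -> R) :
  measurable_fun setT f -> measurable_fun setT (fun x => clamp k (f x)).
Proof.
move=> mf; apply: measurable_maxr; first exact: measurable_cst.
by apply: measurable_minr => //; exact: measurable_cst.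
Qed.

End clamp.

Section by_parts.
Context {R : realType}.
Local Open Scope ereal_scope.
Notation mu := (@lebesgue_measure R).

(** The integrand is the derivative of -(1 - v^2)/2 exp(a0 + a1 v + a2 v^2), which vanishes at -1
    and 1. *)
Lemma integral_by_parts_weight (a0 a1 a2 : R) :
  \int[mu]_(v in `[(-1)%R, 1%R])
    ((v - (1 - v ^+ 2) / 2 * (a1 + 2 * a2 * v)) *
      expR (a0 + a1 * v + a2 * v ^+ 2))%:E = 0.
Proof.
pose F (v : R) := (- ((1 - v ^+ 2) / 2) * expR (a0 + a1 * v + a2 * v ^+ 2))%R.
pose f (v : R) := ((v - (1 - v ^+ 2) / 2 * (a1 + 2 * a2 * v)) *
      expR (a0 + a1 * v + a2 * v ^+ 2))%R.
have dF (v : R) : is_derive v 1%R F (f v).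
  rewrite /F /f; apply: is_derive_eq.
  by move: (expR _) => e; rewrite /GRing.scale/=; field.
have cf : continuous f.
  move=> v; apply: differentiable_continuous; apply/derivable1_diffP.
  by rewrite /f; apply: ex_derive.
have := @continuous_FTC2 R f F (-1)%R 1%R.
move=> ->.
- by rewrite /F sqrrN !expr1n subrr mul0r oppr0 !mul0r subee.
- by lra.
- exact: continuous_subspaceT.
- split.
  + by move=> x _; exact: ex_derive.
  + apply: cvg_at_right_filter; apply: differentiable_continuous.
    by apply/derivable1_diffP; exact: ex_derive.
  + apply: cvg_at_left_filter; apply: differentiable_continuous.
    by apply/derivable1_diffP; exact: ex_derive.
- by move=> x _; rewrite derive1E; exact: derive_val.
Qed.

End by_parts.

Section bounded_integral.
Context {R : realType} {d : measure_display} {T : measurableType d}.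
Local Open Scope ereal_scope.

Lemma bounded_integrable (P : probability T R) (f : T -> R) (K : R) :
  measurable_fun setT f -> (forall x, (`|f x| <= K)%R) ->
  P.-integrable setT (EFin \o f).
Proof.
move=> mf fK; apply: (@le_integrable _ _ _ _ _ _ _ (EFin \o cst K)) => //.
- exact/measurable_EFinP.
- by move=> x _ /=; rewrite lee_fin (le_trans (fK x))// ler_norm.
- exact: finite_measure_integrable_cst.
Qed.

(** Adding a bound K of |f| makes the integrand nonnegative, so that Tonelli and its consequences
    apply; the constant is cancelled afterwards. *)
Lemma integralDcst (P : probability T R) (f : T -> R) (K : R) :
  measurable_fun setT f -> (forall x, (`|f x| <= K)%R) ->
  \int[P]_x (f x + K)%:E = \int[P]_x (f x)%:E + K%:E.
Proof.
move=> mf fK; under eq_integral do rewrite EFinD.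
rewrite integralD//; last 2 first.
- exact: bounded_integrable fK.
- exact: (@finite_measure_integrable_cst _ _ _ P setT K).
by rewrite integral_cst_prob.
Qed.

End bounded_integral.

Section zero_integral.
Context {R : realType} {d : measure_display} {T : measurableType d}.
Local Open Scope ereal_scope.

Lemma iid_integral_eq0 (P : probability T R) n (i : 'I_n) (f : n.-tuple T -> R) (K : R) :
  measurable_fun setT f -> (forall t, (`|f t| <= K)%R) ->
  (forall t, \int[P]_x (f (tset t i x))%:E = 0) ->
  \int[iid P n]_t (f t)%:E = 0.
Proof.
move=> mf fK f0.
have fK0 t : (0 <= f t + K)%R by have := fK t; rewrite ler_norml => /andP[+ _]; lra.
have h : \int[iid P n]_t (f t + K)%:E = K%:E.
  rewrite (integral_iid_resample _ i); last 2 first.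
  - by mfun.
  - by move=> t; rewrite lee_fin.
  under eq_integral => t _.
    rewrite (@integralDcst _ _ _ P (fun x => f (tset t i x)) K); last 2 first.
    - apply: measurableT_comp => //.
      exact: (measurableT_comp (measurable_tset i) (pair1_measurable _)).
    - by move=> x; exact: fK.
    rewrite f0 add0e; over.
  by rewrite integral_cst_prob.
move: h; rewrite integralDcst// => h.
by rewrite -[LHS](addeK _ (_ : K%:E \is a fin_num))// h subee.
Qed.

End zero_integral.

Section uniform.
Context {R : realType}.
Local Open Scope ereal_scope.
Notation mu := (@lebesgue_measure R).

Lemma ltN11 : (-1 < 1 :> R)%R. Proof. by lra. Qed.

Definition unif : probability (measurableTypeR R) R := uniform_prob ltN11.

Lemma unif_integral (f : measurableTypeR R -> R) (K : R) :
  measurable_fun setT f -> (forall x, (`|f x| <= K)%R) ->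
  \int[unif]_x (f x)%:E = (2^-1)%:E * \int[mu]_(x in `[(-1)%R, 1%R]) (f x)%:E.
Proof.
move=> mf fK.
have fK0 t : (0 <= f t + K)%R by have := fK t; rewrite ler_norml => /andP[+ _]; lra.
have mI : mu `[(-1)%R, 1%R] = 2%:E.
  by rewrite lebesgue_measure_itv/= lte_fin ltN11 -EFinB; congr _%:E; lra.
have imf : mu.-integrable `[(-1)%R, 1%R] (EFin \o f).
  apply: measurable_bounded_integrable => //.
  - by rewrite [ltLHS]mI ltry.
  - exact: measurable_funTS.
  - by exists K; split; [exact: num_real|move=> x Kx y _; exact: le_trans (fK _) (ltW Kx)].
have : \int[unif]_x (f x + K)%:E = (2^-1)%:E * \int[mu]_(x in `[(-1)%R, 1%R]) (f x)%:E + K%:E.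
  have mfK : measurable_fun setT (fun x : measurableTypeR R => (f x + K)%:E).
    by apply/measurable_EFinP; apply: measurable_funD => //; exact: measurable_cst.
  rewrite (integral_uniform _ mfK (fun x => fK0 x : 0 <= (f x + K)%:E)).
  under eq_integral do rewrite EFinD.
  rewrite integralD//; last first.
    apply/integrableP; split; first exact: measurable_cst.
    by rewrite integral_cst//= [X in _ * X]mI -EFinM ltry.
  rewrite integral_cst// [X in _ + _ * X]mI opprK -[(1 + 1)%R]/(2%:R) muleDr//; last first.
    by rewrite fin_num_adde_defl// -EFinM.
  by congr (_ + _); rewrite -!EFinM; congr _%:E; field.
rewrite integralDcst// => h.
by rewrite -[LHS](addeK _ (_ : K%:E \is a fin_num))// h addeK.
Qed.

End uniform.

Lemma mxvec_index_inj m n (j j' : 'I_m) (k k' : 'I_n) :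
  (mxvec_index j k == mxvec_index j' k') = ((j, k) == (j', k')).
Proof. by rewrite (inj_eq (@cast_ord_inj _ _ _)) (inj_eq enum_rank_inj). Qed.

Lemma measurable_tnth_comp (d1 d2 : measure_display) (A : measurableType d1)
    (B : measurableType d2) n (f : A -> n.-tuple B) (i : 'I_n) :
  measurable_fun setT f -> measurable_fun setT (fun x => tnth (f x) i).
Proof. by move=> mf; exact: (measurableT_comp (measurable_tnth i) mf). Qed.

Section family.
Context {R : realType} {d : nat}.
Notation W := ('rV[R]_d * 'rV[R]_d)%type.
Notation U := ((d * d).-tuple (measurableTypeR R)).

Definition prior : probability U R := iid unif (d * d).

(** The coordinates of u lie in [-1, 1] only almost surely; clamping makes every bound below hold
    for all u. *)
Definition cu (u : U) (j k : 'I_d) : R := clamp 1 (tnth u (mxvec_index j k)).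

(** With entries of C at most 1/(8d), [theta C] is [small] with constant 1/8 + 1/256 <= 1/4, which
    keeps the covariances between I and (3/2)I. *)
Definition stp : R := 8^-1 / d%:R.

Definition Cmx (u : U) : 'M[R]_d := \matrix_(j, k) (stp * cu u j k).

(** The deviation from (5/4)I of the covariance of y + (yC + w)/2. *)
Definition theta (C : 'M[R]_d) : 'M[R]_d :=
  2^-1 *: (C + C^T) + 4^-1 *: (C^T *m C).

Lemma cu_le1 u j k : `|cu u j k| <= 1.
Proof. exact: clamp_le. Qed.

Lemma stp_ge0 : 0 <= stp.
Proof. by rewrite divr_ge0. Qed.

Lemma small_Cmx u : small 8^-1 (Cmx u).
Proof.
move=> i j; rewrite mxE normrM (ger0_norm stp_ge0) -[leRHS]mulr1.
by rewrite ler_wpM2l ?cu_le1 ?stp_ge0.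
Qed.

Lemma small_theta C : small 8^-1 C -> small 4^-1 (theta C).
Proof.
move=> sC.
apply: smallW (smallD (smallZ 2^-1 (smallD sC (smallT sC)))
  (smallZ 4^-1 (small_mulmx (smallT sC) sC))).
by rewrite !ger0_norm; lra.
Qed.

Lemma theta_sym C : (theta C)^T = theta C.
Proof.
rewrite /theta linearD/= !linearZ/= linearD/= trmxK trmx_mul trmxK.
by rewrite (addrC C^T).
Qed.

Lemma cu_tset u j k v : `|v| <= 1 -> cu (tset u (mxvec_index j k) v) j k = v.
Proof. by move=> v1; rewrite /cu tnth_tset eqxx clamp_id. Qed.

Lemma Cmx_tset u j k v : `|v| <= 1 ->
  Cmx (tset u (mxvec_index j k) v) =
  Cmx (tset u (mxvec_index j k) 0) + (stp * v) *: delta_mx j k.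
Proof.
move=> v1; apply/matrixP => j' k'; rewrite !mxE /cu !tnth_tset mxvec_index_inj.
rewrite xpair_eqE; case: ifP => _ /=; last by rewrite mulr0 addr0.
by rewrite !clamp_id ?normr0// mulr1 mulr0 add0r.
Qed.

Lemma measurable_cu j k : measurable_fun setT (fun u => cu u j k).
Proof. by apply: measurable_clamp; exact: measurable_tnth. Qed.

Lemma measurable_Cmx : measurable_fun setT Cmx.
Proof.
apply: measurable_fun_mxP => j k; under eq_fun do rewrite mxE.
by apply: measurable_funM; [exact: measurable_cst|exact: measurable_cu].
Qed.

Variable n : nat.
Notation Wn := (n.-tuple W).

(** The derivative in C_jk of the logarithm of [lik C t]; the entries of t are pairs (y, z), and z -
    yC recovers w. *)
Definition score (C : 'M[R]_d) (t : Wn) j k : R :=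
  \sum_(i < n) (tnth t i).1 0 j * ((tnth t i).2 - (tnth t i).1 *m C) 0 k.

Definition llh (C : 'M[R]_d) (w : W) : R :=
  dotp (w.1 *m C) w.2 - dotp (w.1 *m C) (w.1 *m C) / 2.

Definition lik (C : 'M[R]_d) (t : Wn) : R := \prod_(i < n) expR (llh C (tnth t i)).

Lemma lik_ge0 C t : 0 <= lik C t.
Proof. by apply: prodr_ge0 => i _; exact: expR_ge0. Qed.

(** For u_jk in [-1, 1], [fpw] times the likelihood is the derivative in u_jk of -(1 - u_jk^2)/2
    times the likelihood; the factor [stp] is the chain rule for C = stp u. *)
Definition fpw (u : U) (t : Wn) j k : R :=
  cu u j k - (1 - cu u j k ^+ 2) / 2 * (stp * score (Cmx u) t j k).

(** Only row j of C^T-side products moves with C_jk: yC changes by a multiple of y_j in coordinate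
    k, so the log-likelihood is a quadratic polynomial in v. Its coefficients are the value and the
    derivative at v = 0 and -stp^2 times half the sum of the y_j^2. *)
Lemma fpw_tset u t j k : exists a0 a1 a2 : R, forall v, `|v| <= 1 ->
  fpw (tset u (mxvec_index j k) v) t j k * lik (Cmx (tset u (mxvec_index j k) v)) t =
  (v - (1 - v ^+ 2) / 2 * (a1 + 2 * a2 * v)) * expR (a0 + a1 * v + a2 * v ^+ 2).
Proof.
set C0 := Cmx (tset u (mxvec_index j k) 0).
exists (\sum_(i < n) llh C0 (tnth t i)), (stp * score C0 t j k),
  (\sum_(i < n) - (stp ^+ 2 * (tnth t i).1 0 j ^+ 2 / 2)) => v v1.
rewrite /fpw cu_tset// Cmx_tset// -/C0 /lik -expR_sum.
have yC (y : 'rV[R]_d) : y *m (C0 + (stp * v) *: delta_mx j k) =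
    y *m C0 + (stp * v * y 0 j) *: delta_mx 0 k.
  rewrite mulmxDr -scalemxAr -scalerA; congr (_ + _ *: _); apply/rowP => l.
  rewrite !mxE (bigD1 j)//= big1 => [|i ij]; last by rewrite mxE (negbTE ij) mulr0.
  by rewrite mxE !eqxx addr0.
have de (z : 'rV[R]_d) : dotp (delta_mx 0 k) z = z 0 k.
  by rewrite dotpC dotpE trmx_delta -colE mxE.
congr (_ * expR _).
- congr (_ - _ * _); rewrite /score [2 * _ * v]mulrAC !mulr_sumr -big_split/=.
  apply: eq_bigr => i _.
  rewrite yC !mxE !eqxx/=. by field.
- rewrite /score mulr_sumr !mulr_suml -!big_split/=; apply: eq_bigr => i _.
  rewrite /llh yC !(dotpDl, dotpDr, dotpZl, dotpZr) (dotpC _ (delta_mx 0 k)) !de !mxE !eqxx/=.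
  by field.
Qed.

Definition latsq (w : W) : R := dotp w.1 w.1 + dotp w.2 w.2.

Lemma lik_bounded t : exists K : R, forall u, `|lik (Cmx u) t| <= K.
Proof.
exists (\prod_(i < n) expR (latsq (tnth t i))) => u.
rewrite ger0_norm ?lik_ge0//; apply: ler_prod => i _; rewrite expR_ge0/= ler_expR.
have := bilin_small (tnth t i).1 (tnth t i).2 (small_Cmx u).
rewrite ler_norml => /andP[_]; rewrite /llh /latsq.
have := dotp_ge0 ((tnth t i).1 *m Cmx u).
have := dotp_ge0 (tnth t i).1; have := dotp_ge0 (tnth t i).2.
by lra.
Qed.

Lemma score_bounded t j k : exists K : R, forall u, `|stp * score (Cmx u) t j k| <= K.
Proof.
exists (stp * \sum_(i < n) `|(tnth t i).1 0 j| *
  (`|(tnth t i).2 0 k| + \sum_l `|(tnth t i).1 0 l| * (8^-1 / d%:R))) => u.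
rewrite normrM (ger0_norm stp_ge0) ler_wpM2l ?stp_ge0//.
apply: le_trans (ler_norm_sum _ _ _) _; apply: ler_sum => i _.
rewrite normrM ler_wpM2l// !mxE; apply: le_trans (ler_normB _ _) _.
rewrite lerD2l; apply: le_trans (ler_norm_sum _ _ _) _; apply: ler_sum => l _.
by rewrite normrM ler_wpM2l//; exact: small_Cmx.
Qed.

Lemma fpw_bounded t j k : exists K : R, forall u,
  `|fpw u t j k * lik (Cmx u) t| <= K.
Proof.
have [K1 h1] := score_bounded t j k; have [K2 h2] := lik_bounded t.
exists ((1 + K1) * K2) => u; rewrite normrM; apply: ler_pM => //.
apply: le_trans (ler_normB _ _) _; apply: lerD; first exact: cu_le1.
rewrite normrM -[leRHS]mul1r; apply: ler_pM => //.
have := cu_le1 u j k; rewrite !ler_norml => /andP[c1 c2].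
by apply/andP; split; nra.
Qed.

Lemma measurable_score (dT : measure_display) (T : measurableType dT)
    (f : T -> 'M[R]_d) (g : T -> Wn) j k :
  measurable_fun setT f -> measurable_fun setT g ->
  measurable_fun setT (fun x => score (f x) (g x) j k).
Proof.
move=> mf mg; apply: measurable_sum => i.
have mgi := measurable_tnth_comp i mg.
have m1 : measurable_fun setT (fun x => (tnth (g x) i).1) by mfun.
have m2 : measurable_fun setT (fun x => (tnth (g x) i).2) by mfun.
by mfun.
Qed.

Lemma measurable_lik (dT : measure_display) (T : measurableType dT)
    (f : T -> 'M[R]_d) (g : T -> Wn) :
  measurable_fun setT f -> measurable_fun setT g ->
  measurable_fun setT (fun x => lik (f x) (g x)).
Proof.
move=> mf mg; apply: measurable_prod => i _.
have mgi := measurable_tnth_comp i mg.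
have m1 : measurable_fun setT (fun x => (tnth (g x) i).1) by mfun.
have m2 : measurable_fun setT (fun x => (tnth (g x) i).2) by mfun.
by rewrite /llh; mfun.
Qed.

Lemma measurable_fpw (dT : measure_display) (T : measurableType dT)
    (f : T -> U) (g : T -> Wn) j k :
  measurable_fun setT f -> measurable_fun setT g ->
  measurable_fun setT (fun x => fpw (f x) (g x) j k).
Proof.
move=> mf mg; rewrite /fpw.
have mc : measurable_fun setT (fun x => cu (f x) j k).
  exact: (measurableT_comp (measurable_cu j k) mf).
have mC : measurable_fun setT (fun x => Cmx (f x)).
  exact: (measurableT_comp measurable_Cmx mf).
have ms := measurable_score j k mC mg.
apply: measurable_funB => //; apply: measurable_funM; by mfun.
Qed.

(** The latent data are fixed, so u enters only through the explicit likelihood: integrating the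
    single coordinate (j, k) by parts already gives 0. *)
Lemma prior_fpw0 t j k :
  (\int[prior]_u (fpw u t j k * lik (Cmx u) t)%:E = 0)%E.
Proof.
have [K hK] := fpw_bounded t j k.
have mf : measurable_fun setT (fun u : U => fpw u t j k * lik (Cmx u) t).
  apply: measurable_funM.
    by apply: (measurable_fpw j k (f := id) (g := fun=> t)) => //; exact: measurable_cst.
  apply: (measurable_lik (f := Cmx) (g := fun=> t)); first exact: measurable_Cmx.
  exact: measurable_cst.
apply: (iid_integral_eq0 (i := mxvec_index j k) mf hK) => u.
have [a0 [a1 [a2 e]]] := fpw_tset u t j k.
rewrite (unif_integral (K := K)); last 2 first.
- exact: (measurableT_comp mf (measurableT_comp (measurable_tset _)
    (pair1_measurable u))).
- by move=> x; exact: hK.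
rewrite -[RHS](mule0 (2^-1)%:E); congr (_ * _)%E.
rewrite -[RHS](integral_by_parts_weight a0 a1 a2).
apply: eq_integral => v; rewrite inE/= in_itv/= => v1; rewrite e//.
by rewrite ler_norml.
Qed.

End family.

Section fingerprint_identity.
Context {R : realType} {d : nat} (n : nat).
Notation W := ('rV[R]_d * 'rV[R]_d)%type.
Notation U := ((d * d).-tuple (measurableTypeR R)).
Notation Wn := (n.-tuple W).
Local Open Scope ereal_scope.

Definition lat : probability Wn R := iid gauss_pair n.

Definition shear1 (C : 'M[R]_d) (w : W) : W := (w.1, w.1 *m C + w.2)%R.

Definition shear (C : 'M[R]_d) (t : Wn) : Wn := [tuple shear1 C (tnth t i) | i < n].

Lemma measurable_shear1 C : measurable_fun setT (shear1 C).
Proof. by apply: measurable_fun_pair; mfun. Qed.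

Lemma measurable_shear C : measurable_fun setT (shear C).
Proof. by apply: (measurable_mktuple (S := fun=> shear1 C)) => _; exact: measurable_shear1. Qed.

Lemma ge0_lat_shear C (F : Wn -> \bar R) :
  measurable_fun setT F -> (forall t, 0 <= F t) ->
  \int[lat]_t F (shear C t) = \int[lat]_t (F t * (lik C t)%:E).
Proof.
move=> mF F0.
have := @iid_transfer R _ _ _ W W W gauss_pair gauss_pair n (fun=> shear1 C) (fun=> id)
  (fun _ w => expR (llh C w)).
move=> /(_ _ _ _ _ _ F mF F0) h; rewrite /shear h//.
- apply: eq_integral => t _; congr (F _ * _).
  by apply: eq_from_tnth => i; rewrite tnth_mktuple.
- by move=> _; exact: measurable_shear1.
- by move=> _; rewrite /llh; mfun.
- by move=> _ G mG G0; exact: gauss_pair_shear.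
Qed.

Lemma lat_shear C (f : Wn -> R) : measurable_fun setT f ->
  \int[lat]_t (f (shear C t))%:E = \int[lat]_t (f t * lik C t)%:E.
Proof.
move=> mf; rewrite [LHS]integralE [RHS]integralE.
have mp : measurable_fun setT (fun t => maxe (f t)%:E 0).
  by apply: measurable_maxe; [exact/measurable_EFinP|exact: measurable_cst].
have mn : measurable_fun setT (fun t => maxe (- (f t)%:E) 0).
  apply: measurable_maxe; last exact: measurable_cst.
  by apply: measurableT_comp => //; exact/measurable_EFinP.
congr (_ - _).
- transitivity (\int[lat]_t (maxe (f (shear C t))%:E 0)).
    by apply: eq_integral => t _; rewrite ?funeposE ?funenegE.
  rewrite (ge0_lat_shear C mp); last by move=> t; rewrite le_max lexx orbT.
  apply: eq_integral => t _; rewrite funeposE EFinM.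
  by rewrite maxe_pMl ?lee_fin ?lik_ge0// mul0e.
- transitivity (\int[lat]_t (maxe (- (f (shear C t))%:E) 0)).
    by apply: eq_integral => t _; rewrite ?funeposE ?funenegE.
  rewrite (ge0_lat_shear C mn); last by move=> t; rewrite le_max lexx orbT.
  apply: eq_integral => t _; rewrite funenegE EFinM -mulNe.
  by rewrite maxe_pMl ?lee_fin ?lik_ge0// mul0e.
Qed.

Definition sc (t : Wn) j k : R := (\sum_(i < n) (tnth t i).1 0 j * (tnth t i).2 0 k)%R.

Lemma score_shear C t j k : score C (shear C t) j k = sc t j k.
Proof.
by apply: eq_bigr => i _; rewrite tnth_mktuple /= addrC addKr.
Qed.

Lemma latsq_ge0 (w : W) : (0 <= latsq w)%R.
Proof. by rewrite addr_ge0// dotp_ge0. Qed.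

Lemma coord_latsq (w : W) j k : (`|w.1 ord0 j * w.2 ord0 k| <= latsq w)%R.
Proof.
have h (x : 'rV[R]_d) l : (x ord0 l ^+ 2 <= dotp x x)%R.
  rewrite /dotp (bigD1 l)//= expr2 lerDl; apply: sumr_ge0 => i _.
  by rewrite -expr2 sqr_ge0.
have h1 := h w.1 j; have h2 := h w.2 k.
have := sqr_ge0 (`|w.1 ord0 j| - `|w.2 ord0 k|)%R.
have := real_normK (num_real (w.1 ord0 j)); have := real_normK (num_real (w.2 ord0 k)).
rewrite normrM /latsq; have := dotp_ge0 w.1; have := dotp_ge0 w.2.
by nra.
Qed.

Lemma measurable_latsq : measurable_fun setT (@latsq R d).
Proof. by rewrite /latsq; mfun. Qed.

(** An integrable majorant, up to constants, of the statistics below; the 1 absorbs their bounded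
    terms. *)
Definition lattot (t : Wn) : R := (1 + \sum_(i < n) latsq (tnth t i))%R.

Lemma lattot_ge0 t : (0 <= lattot t)%R.
Proof. by rewrite addr_ge0// sumr_ge0// => i _; exact: latsq_ge0. Qed.

Lemma measurable_lattot : measurable_fun setT lattot.
Proof.
apply: measurable_funD; first exact: measurable_cst.
apply: measurable_sum => i.
exact: (measurableT_comp measurable_latsq (measurable_tnth i)).
Qed.

Lemma integral_lattot : \int[lat]_t (lattot t)%:E < +oo.
Proof.
rewrite /lattot; under eq_integral do rewrite EFinD -sumEFin.
have mi i : measurable_fun setT (fun t : Wn => (latsq (tnth t i))%:E : \bar R).
  by apply/measurable_EFinP; exact: (measurableT_comp measurable_latsq (measurable_tnth i)).
rewrite ge0_integralD//; last 2 first.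
- by move=> t _; apply: sume_ge0 => i _; rewrite lee_fin latsq_ge0.
- exact: emeasurable_sum.
rewrite integral_cst_prob ge0_integral_sum//; last first.
  by move=> i t _; rewrite lee_fin latsq_ge0.
rewrite lte_add_pinfty ?ltry//; apply/lte_sum_pinfty => i _.
rewrite (integral_iid_tnth _ i (f := fun w => (latsq w)%:E)); last 2 first.
- by apply/measurable_EFinP; exact: measurable_latsq.
- by move=> w; rewrite lee_fin latsq_ge0.
exact: le_lt_trans (gauss_pair_sqnorm) (ltry _).
Qed.

Lemma lattot_integrable (f : Wn -> R) (K : R) : measurable_fun setT f ->
  (forall t, (`|f t| <= K * lattot t)%R) -> lat.-integrable setT (EFin \o f).
Proof.
move=> mf fK; apply: (@le_integrable _ _ _ _ _ _ _ (fun t => K%:E * (lattot t)%:E)) => //.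
- exact/measurable_EFinP.
- by move=> t _ /=; rewrite lee_fin (le_trans (fK t))// ler_norm.
- apply: integrableZl => //; apply/integrableP; split.
    by apply/measurable_EFinP; exact: measurable_lattot.
  apply: le_lt_trans integral_lattot; apply: ge0_le_integral => //.
  - apply: measurableT_comp => //; apply/measurable_EFinP; exact: measurable_lattot.
  - by apply/measurable_EFinP; exact: measurable_lattot.
  - by move=> t _; rewrite gee0_abs// lee_fin lattot_ge0.
Qed.

Lemma sc_lattot t j k : (`|sc t j k| <= lattot t)%R.
Proof.
apply: le_trans (ler_norm_sum _ _ _) _; rewrite /lattot -[leLHS]add0r.
by apply: lerD => //; apply: ler_sum => i _; exact: coord_latsq.
Qed.

Lemma stp_le1 : (@stp R d <= 1)%R.
Proof.
rewrite /stp; case: d => [|k]; first by rewrite invr0 mulr0.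
rewrite ler_pdivrMr ?ltr0n// mul1r.
have : (1 <= k.+1%:R :> R)%R by rewrite ler1n.
by lra.
Qed.

(** A bounded statistic of the pairs (y, z). It becomes the mean clamped output of the mechanism,
    which sees the pairs only through y + z/2. *)
Variable nu : 'I_d -> 'I_d -> Wn -> R.
Hypothesis mnu : forall j k, measurable_fun setT (nu j k).
Hypothesis nu1 : forall j k t, (`|nu j k t| <= 1)%R.

Definition fpsum (u : U) (t : Wn) : R := (\sum_j \sum_k fpw u t j k * nu j k t)%R.

Lemma fpsum_shear u t : fpsum u (shear (Cmx u) t) =
  (\sum_j \sum_k (cu u j k - (1 - cu u j k ^+ 2) / 2 * (@stp R d * sc t j k)) *
    nu j k (shear (Cmx u) t))%R.
Proof. by do 2 apply: eq_bigr => ? _; rewrite /fpw score_shear. Qed.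

Lemma fpsum_le u t : (`|fpsum u (shear (Cmx u) t)| <= (2 * d%:R ^+ 2) * lattot t)%R.
Proof.
have h j k : (`|fpw u (shear (Cmx u) t) j k * nu j k (shear (Cmx u) t)| <= 2 * lattot t)%R.
  rewrite normrM -[leRHS]mulr1; apply: ler_pM => //.
  rewrite /fpw score_shear; apply: le_trans (ler_normB _ _) _.
  have c1 := cu_le1 u j k; have := sc_lattot t j k.
  have p0 := @stp_ge0 R d; have p1 := stp_le1.
  move: (@stp R d) p0 p1 => p p0 p1; rewrite !normrM (ger0_norm p0) => s1.
  have t1 : (1 <= lattot t)%R.
    by rewrite lerDl sumr_ge0// => i _; exact: latsq_ge0.
  have c2 : (`|1 - cu u j k ^+ 2| * `|2^-1| <= 1)%R.
    move: c1; rewrite -normrM !ler_norml => /andP[c1 c2].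
    by apply/andP; split; nra.
  have c20 : (0 <= `|1 - cu u j k ^+ 2| * `|2^-1|)%R by rewrite mulr_ge0.
  have s2 : (p * `|sc t j k| <= lattot t)%R.
    by rewrite -[leRHS]mul1r; apply: ler_pM.
  have s20 : (0 <= p * `|sc t j k|)%R by exact: mulr_ge0.
  by nra.
apply: le_trans (ler_norm_sum _ _ _) _.
apply: (@le_trans _ _ (\sum_(j < d) \sum_(k < d) 2 * lattot t)%R).
  apply: ler_sum => j _; apply: le_trans (ler_norm_sum _ _ _) _.
  by apply: ler_sum => k _.
rewrite !sumr_const !card_ord -mulrnA -[leLHS]mulr_natr natrM.
by rewrite le_eqVlt; apply/orP; left; apply/eqP; ring.
Qed.

Lemma measurable_fpsum (dT : measure_display) (T : measurableType dT)
    (f : T -> U) (g : T -> Wn) :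
  measurable_fun setT f -> measurable_fun setT g ->
  measurable_fun setT (fun x => fpsum (f x) (g x)).
Proof.
move=> mf mg; apply: measurable_sum => j; apply: measurable_sum => k.
apply: measurable_funM; first exact: measurable_fpw.
exact: (measurableT_comp (mnu j k) mg).
Qed.

Definition fpexp (u : U) : \bar R := \int[lat]_t (fpsum u (shear (Cmx u) t))%:E.

(** Justifies Fubini below. For fixed u the likelihood is absorbed by returning to the sheared
    variables, where [lattot] dominates uniformly in u. *)
Lemma fp_integrable : (prior \x lat).-integrable setT
  (fun z => (fpsum z.1 z.2 * lik (Cmx z.1) z.2)%:E).
Proof.
have mC : measurable_fun setT (fun z : U * Wn => Cmx z.1).
  exact: (measurableT_comp measurable_Cmx measurable_fst).
have mG : measurable_fun setT (fun z : U * Wn => (fpsum z.1 z.2 * lik (Cmx z.1) z.2)%R).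
  apply: measurable_funM; last exact: measurable_lik.
  exact: measurable_fpsum.
apply/integrable12ltyP; first exact/measurable_EFinP.
pose B := \int[lat]_t ((2 * d%:R ^+ 2) * lattot t)%:E.
apply: (@le_lt_trans _ _ (\int[@prior R d]_u B)).
  apply: ge0_le_integral => //.
  - by move=> u _; exact: integral_ge0.
  - apply: (measurable_fun_fubini_tonelli_F
      (fun z : U * Wn => `|(fpsum z.1 z.2 * lik (Cmx z.1) z.2)%:E|)) => //.
    by apply: measurableT_comp => //; exact/measurable_EFinP.
  - move=> u _ /=.
    have mu_ : measurable_fun setT (fun t => (`|fpsum u t|%R)%:E : \bar R).
      apply/measurable_EFinP; apply: measurableT_comp => //.
      by apply: (measurable_fpsum (f := fun=> u) (g := id)) => //; exact: measurable_cst.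
    rewrite [leLHS](_ : _ = \int[lat]_t ((`|fpsum u t|%R)%:E * (lik (Cmx u) t)%:E)); last first.
      by apply: eq_integral => t _; rewrite normrM (ger0_norm (lik_ge0 _ _)) EFinM.
    rewrite -ge0_lat_shear//.
    apply: ge0_le_integral => //.
    + by apply: (measurableT_comp mu_); exact: measurable_shear.
    + apply/measurable_EFinP; apply: measurable_funM => //; exact: measurable_lattot.
    + by move=> t _; rewrite lee_fin fpsum_le.
rewrite integral_cst_prob /B; under eq_integral do rewrite EFinM.
have mL : measurable_fun setT (fun t => (lattot t)%:E : \bar R).
  by apply/measurable_EFinP; exact: measurable_lattot.
have L0 t : setT t -> 0 <= (lattot t)%:E by move=> _; rewrite lee_fin lattot_ge0.
have k0 : 0 <= (2 * d%:R ^+ 2)%:E :> \bar R by rewrite lee_fin mulr_ge0// sqr_ge0.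
rewrite ge0_integralZl//.
have := integral_lattot.
have : 0 <= \int[lat]_t (lattot t)%:E.
  by apply: integral_ge0 => t _; rewrite lee_fin lattot_ge0.
by case: (\int[lat]_t _) => // r _ _; rewrite -EFinM ltry.
Qed.

Lemma fpexpE u : fpexp u = \int[lat]_t (fpsum u t * lik (Cmx u) t)%:E.
Proof.
rewrite /fpexp lat_shear//.
by apply: (measurable_fpsum (f := fun=> u) (g := id)) => //; exact: measurable_cst.
Qed.

Lemma fpexp_integrable : prior.-integrable setT fpexp.
Proof.
apply: eq_integrable (integrable_fubini_F fp_integrable) => //.
by move=> u _; rewrite fpexpE.
Qed.

(** The change of measure moves u out of the argument of [nu] and into the likelihood. Fubini then
    integrates over u first, where [nu] is a constant factor and [prior_fpw0] applies. *)
Lemma integral_fpexp : \int[prior]_u fpexp u = 0.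
Proof.
under eq_integral do rewrite fpexpE.
rewrite (Fubini fp_integrable)/=.
rewrite [LHS](eq_integral (cst 0)) ?integral0// => t _ /=.
rewrite /fpsum.
have mt j k : measurable_fun setT (fun u : U => (fpw u t j k * lik (Cmx u) t)%R).
  apply: measurable_funM.
    by apply: (measurable_fpw j k (f := id) (g := fun=> t)) => //; exact: measurable_cst.
  apply: (measurable_lik (f := Cmx) (g := fun=> t)); first exact: measurable_Cmx.
  exact: measurable_cst.
have it j k : prior.-integrable setT (fun u : U => (nu j k t)%:E * (fpw u t j k * lik (Cmx u) t)%:E).
  apply: integrableZl => //; have [K hK] := fpw_bounded t j k.
  exact: (bounded_integrable _ (mt j k) hK).
transitivity (\int[@prior R d]_u \sum_j \sum_k ((nu j k t)%:E * (fpw u t j k * lik (Cmx u) t)%:E)).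
  apply: eq_integral => u _; rewrite mulr_suml -sumEFin; apply: eq_bigr => j _.
  rewrite mulr_suml -sumEFin; apply: eq_bigr => k _; rewrite -EFinM; congr _%:E; ring.
rewrite integral_sum//; last by move=> j; exact: integrable_sum.
rewrite big1// => j _; rewrite integral_sum// big1// => k _.
rewrite integralZl//; first by rewrite prior_fpw0 mule0.
have [K hK] := fpw_bounded t j k; exact: (bounded_integrable _ (mt j k) hK).
Qed.

End fingerprint_identity.

(** * Consequences of privacy *)

Section probability_kernel_at.
Context {R : realType} {dX dY : measure_display}.
Context {X : measurableType dX} {Y : measurableType dY}.
Variables (M : R.-pker X ~> Y) (x : X).
Local Open Scope ereal_scope.

(** Repackages [M x] as a probability, so that the lemmas on probability measures apply to the
    output law. *)
Definition pker_fun : set Y -> \bar R := fun A => M x A.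

Let pker_fun0 : pker_fun set0 = 0.
Proof. exact: measure0. Qed.

Let pker_fun_ge0 A : 0 <= pker_fun A.
Proof. exact: measure_ge0. Qed.

Let pker_fun_additive : semi_sigma_additive pker_fun.
Proof. exact: measure_semi_sigma_additive. Qed.

HB.instance Definition _ := isMeasure.Build _ _ _ pker_fun
  pker_fun0 pker_fun_ge0 pker_fun_additive.

Let pker_funT : pker_fun setT = 1.
Proof. exact: prob_kernel. Qed.

HB.instance Definition _ := Measure_isProbability.Build _ _ _ pker_fun pker_funT.

Definition pker_at : probability Y R := pker_fun.

Lemma integral_pker_at (f : Y -> \bar R) :
  \int[M x]_y f y = \int[pker_at]_y f y.
Proof. exact: eq_measure_integral. Qed.

End probability_kernel_at.

Section dp_integral.
Context {R : realType} {dY : measure_display} {Y : measurableType dY}.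
Local Open Scope ereal_scope.
Notation mu := (@lebesgue_measure R).

(* By the layer-cake formula. *)
Lemma approx_le_integral (P P' : probability Y R) (a delta K : R) (h : Y -> R) :
  (0 <= a)%R -> (0 <= delta)%R -> (0 <= K)%R ->
  (forall A, measurable A -> P A <= a%:E * P' A + delta%:E) ->
  measurable_fun setT h -> (forall y, (0 <= h y <= K)%R) ->
  \int[P]_y (h y)%:E <= a%:E * \int[P']_y (h y)%:E + (delta * K)%:E.
Proof.
move=> a0 d0 K0 PP' mh hK.
have mhY B : measurable B -> measurable (setT `&` h @^-1` B) by exact: mh.
pose X : {mfun Y >-> R} := HB.pack_for {mfun Y >-> R} h (isMeasurableFun.Build _ _ _ _ h mh).
pose D : set (measurableTypeR R) := `[0%R, +oo[%classic.
have mD : measurable D by exact: measurable_itv.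
have X0 y : (0 <= X y)%R by have /andP[] := hK y.
have EP (Q : probability Y R) :
    \int[Q]_y (h y)%:E = \int[mu]_(r in D) (ccdf (X : {RV Q >-> R}) r).
  by rewrite -ge0_expectation_ccdf// expectation_def.
rewrite (EP P) (EP P').
have m1 : measurable_fun D (ccdf (X : {RV P' >-> R})).
  by apply: measurable_funTS; exact: ccdf_measurable.
have ccdf0 (Q : probability Y R) r : 0 <= ccdf (X : {RV Q >-> R}) r by exact: measure_ge0.
have mi : measurable_fun D (fun r => (delta * \1_(`[0%R, K]) r)%:E : \bar R).
  by apply: measurable_funTS; apply/measurable_EFinP; apply: measurable_funM.
(* The hypothesis is applied to the events {h > r}. These are empty for r > K, so delta is paid only
   on [0, K]. *)
apply: (@le_trans _ _ (\int[mu]_(r in D)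
    (a%:E * ccdf (X : {RV P' >-> R}) r + (delta * \1_(`[0%R, K]) r)%:E))).
  apply: ge0_le_integral => //.
  - by apply: measurable_funTS; exact: ccdf_measurable.
  - by apply: emeasurable_funD => //; exact: measurable_funeM.
  - move=> r; rewrite /D/= in_itv/= andbT => r0.
    have [rK|Kr] := leP r K.
      rewrite indicE mem_set ?mulr1; last by rewrite /= in_itv/= r0 rK.
      by apply: PP'; rewrite -[_ @^-1` _]setTI; exact: mhY.
    rewrite (_ : ccdf _ _ = 0); last first.
      rewrite /ccdf /distribution /pushforward (_ : _ @^-1` _ = set0) ?measure0//.
      apply/seteqP; split=> y //=; rewrite in_itv/= andbT => rh.
      by have /andP[_] := hK y; rewrite leNgt (lt_trans Kr rh).
    rewrite adde_ge0// ?mule_ge0 ?lee_fin ?mulr_ge0//.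
rewrite ge0_integralD//; last 3 first.
- by move=> r _; rewrite mule_ge0// lee_fin.
- exact: measurable_funeM.
- by move=> r _; rewrite lee_fin mulr_ge0.
rewrite ge0_integralZl// leeD2l//.
under eq_integral do rewrite EFinM.
rewrite ge0_integralZl//; last first.
  by apply: measurable_funTS; apply/measurable_EFinP; exact: measurable_indic.
rewrite EFinM lee_wpmul2l ?lee_fin//.
rewrite integral_indic//; apply: (@le_trans _ _ (mu `[0%R, K])).
  by apply: le_measure; rewrite ?inE//; exact: measurableI.
rewrite lebesgue_measure_itv/= lte_fin; case: ifP => _; last by rewrite lee_fin.
by rewrite -EFinB subr0.
Qed.

End dp_integral.

(** * The clamped output of the mechanism *)

Section mechanism.
Context {R : realType} {d n : nat}.
Notation W := ('rV[R]_d * 'rV[R]_d)%type.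
Notation Wn := (n.-tuple W).
Notation Xn := (n.-tuple 'rV[R]_d).
Variable M : R.-pker Xn ~> 'M[R]_d.
Local Open Scope ereal_scope.

(** The output read as an estimate of [theta] and projected entrywise onto a box that contains every
    [theta (Cmx u)], so that clamping cannot increase the error. *)
Definition psi (A : 'M[R]_d) : 'M[R]_d :=
  \matrix_(j, k) clamp (4^-1 / d%:R) (A j k - ((5 / 4)%:M : 'M[R]_d) j k).

Lemma quarter_ge0 : (0 <= 4^-1 / d%:R :> R)%R.
Proof. by rewrite divr_ge0. Qed.

Lemma small_psi A : small 4^-1 (psi A).
Proof. by move=> j k; rewrite mxE; apply: clamp_le; exact: quarter_ge0. Qed.

Lemma measurable_psi : measurable_fun setT psi.
Proof.
apply: measurable_fun_mxP => j k; under eq_fun do rewrite mxE.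
apply: measurable_clamp; apply: measurable_funB; last exact: measurable_cst.
exact: measurable_entry.
Qed.

Lemma psi_le1 A j k : (`|psi A j k| <= 1)%R.
Proof.
apply: le_trans (small_psi A j k) _.
case: d A j k => [|e] A j k; first by case: j.
rewrite ler_pdivrMr ?ltr0n// mul1r.
have : (1 <= e.+1%:R :> R)%R by rewrite ler1n.
by lra.
Qed.

Definition dat (t : Wn) : Xn :=
  [tuple ((tnth t i).1 + 2^-1 *: (tnth t i).2)%R | i < n].

Lemma measurable_dat : measurable_fun setT dat.
Proof.
apply: (measurable_mktuple (S := fun _ (w : W) => (w.1 + 2^-1 *: w.2)%R)) => _.
by mfun.
Qed.

(** The mean of [psi]; the shift by 1 makes the integrand nonnegative, from which measurability in x
    follows. *)
Definition nuM (x : Xn) j k : R := (fine (\int[M x]_A (psi A j k + 1)%:E) - 1)%R.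

Lemma measurable_psi_entry j k : measurable_fun setT (fun A => psi A j k).
Proof. by have mp := measurable_psi; mfun. Qed.

Lemma psi_integral x j k : \int[M x]_A (psi A j k)%:E = (nuM x j k)%:E.
Proof.
rewrite /nuM !integral_pker_at.
have h := @integralDcst R _ _ (pker_at M x) (fun A => psi A j k) 1 (measurable_psi_entry j k)
  (fun A => psi_le1 A j k).
have i := bounded_integrable (pker_at M x) (measurable_psi_entry j k)
  (fun A => psi_le1 A j k).
have f := integrable_fin_num measurableT i.
rewrite h fineD// EFinB EFinD fineK//=.
by rewrite -addeA -EFinD subrr adde0.
Qed.

Lemma measurable_nuM j k : measurable_fun setT (fun x => nuM x j k).
Proof.
apply: measurable_funB; last exact: measurable_cst.
apply: measurableT_comp; first exact: fine_measurable.
apply: measurable_fun_integral_kernel.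
- by move=> V mV; exact: measurable_kernel.
- by move=> A; rewrite lee_fin; have := psi_le1 A j k; rewrite ler_norml => /andP[]; lra.
- by have := measurable_psi_entry j k => mp; mfun.
Qed.

Lemma nuM_le1 x j k : (`|nuM x j k| <= 1)%R.
Proof.
rewrite -lee_fin -abse_EFin -psi_integral integral_pker_at.
apply: le_trans (le_abse_integral _ _ _) _ => //.
  by apply/measurable_EFinP; exact: measurable_psi_entry.
rewrite -[leRHS](integral_cst_prob (pker_at M x)); apply: ge0_le_integral => //.
- by apply: measurableT_comp => //; apply/measurable_EFinP; exact: measurable_psi_entry.
- by move=> A _; rewrite abse_EFin lee_fin psi_le1.
Qed.

End mechanism.

Section kernel_snd.
Context {R : realType} {d1 d2 d3 : measure_display}.
Context {A : measurableType d1} {X : measurableType d2} {Y : measurableType d3}.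
Variable M : R.-pker X ~> Y.

(** The mechanism as a kernel with an idle parameter, giving joint measurability of integrals whose
    integrand depends on a record as well as on the data set. *)
Definition ker_snd (z : A * X) : {measure set Y -> \bar R} := M z.2.

Let measurable_ker_snd V : measurable V -> measurable_fun setT (ker_snd ^~ V).
Proof. by move=> mV; exact: (measurableT_comp (measurable_kernel M V mV) measurable_snd). Qed.

HB.instance Definition _ := isKernel.Build _ _ _ _ _ ker_snd measurable_ker_snd.

Let ker_snd_prob z : ker_snd z setT = 1%E.
Proof. exact: prob_kernel. Qed.

HB.instance Definition _ := Kernel_isProbability.Build _ _ _ _ _ ker_snd ker_snd_prob.

Lemma measurable_integral_ker_snd (k : (A * X) * Y -> \bar R) :
  (forall z, (0 <= k z)%E) -> measurable_fun setT k ->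
  measurable_fun setT (fun z : A * X => (\int[M z.2]_y k (z, y))%E).
Proof. exact: (measurable_fun_integral_finite_kernel k ker_snd). Qed.

End kernel_snd.

(** * Privacy bounds the correlation of the output with one record *)

Section privacy_bound.
Context {R : realType} {d n : nat}.
Notation W := ('rV[R]_d * 'rV[R]_d)%type.
Notation U := ((d * d).-tuple (measurableTypeR R)).
Notation Wn := (n.-tuple W).
Notation Xn := (n.-tuple 'rV[R]_d).
Variables (M : R.-pker Xn ~> 'M[R]_d) (u : U).
Local Open Scope ereal_scope.
Notation C := (Cmx u).
Notation th := (theta (Cmx u)).
Notation latn := (@lat R d n).
Notation gp := (@gauss_pair R d).

Definition obs (t : Wn) : Xn := dat (shear C t).

Definition obs1 (w : W) : 'rV[R]_d := ((shear1 C w).1 + 2^-1 *: (shear1 C w).2)%R.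

Lemma tnth_obs t i : tnth (obs t) i = obs1 (tnth t i).
Proof. by rewrite !tnth_mktuple. Qed.

Lemma measurable_obs : measurable_fun setT obs.
Proof. exact: (measurableT_comp measurable_dat (measurable_shear C)). Qed.

Definition Gm (A : 'M[R]_d) : 'M[R]_d :=
  \matrix_(j, k) ((1 - cu u j k ^+ 2) * (psi A j k - th j k))%R.

Lemma cu_weight j k : (0 <= 1 - cu u j k ^+ 2 <= 1)%R.
Proof.
have := cu_le1 u j k; rewrite ler_norml => /andP[c1 c2].
by apply/andP; split; nra.
Qed.

Lemma small_Gm A : small 2^-1 (Gm A).
Proof.
move=> j k; rewrite mxE normrM.
have /andP[g0 g1] := cu_weight j k; rewrite (ger0_norm g0) -[leRHS]mul1r.
apply: ler_pM => //; apply: le_trans (ler_normB _ _) _.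
have := small_psi A j k; have := small_theta (small_Cmx u) j k.
have -> : (2^-1 / d%:R = 4^-1 / d%:R + 4^-1 / d%:R :> R)%R by rewrite -mulrDl; congr (_ / _)%R; lra.
by move=> h1 h2; rewrite addrC; exact: lerD.
Qed.

Lemma fro2_Gm A : (fro2 (Gm A) <= fro2 (psi A - th))%R.
Proof.
apply: ler_sum => j _; apply: ler_sum => k _; rewrite (_ : Gm A j k = (1 - cu u j k ^+ 2) * (psi A j k - th j k))%R ?[LHS]mxE//.
rewrite (_ : (psi A - th)%R j k = psi A j k - th j k)%R; last first.
  by rewrite [LHS]mxE [X in (_ + X)%R]mxE.
rewrite exprMn -[leRHS]mul1r; apply: ler_wpM2r; first exact: sqr_ge0.
by have /andP[] := cu_weight j k; nra.
Qed.

Lemma measurable_Gm : measurable_fun setT Gm.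
Proof.
apply: measurable_fun_mxP => j k; under eq_fun do rewrite mxE.
have mp := measurable_psi_entry (R := R) (d := d) j k.
apply: measurable_funM; first exact: measurable_cst.
by apply: measurable_funB => //; exact: measurable_cst.
Qed.

(** The contribution of one latent record to the weighted scores, paired with the estimation
    error. *)
Definition Tst (w : W) (A : 'M[R]_d) : R := dotp (w.1 *m Gm A) w.2.

(** A symmetry of the law of the pair that changes the sign of [Tst]; the negative part of [Tst] is
    thus its positive part at the reflected record. *)
Definition negl (w : W) : W := (- w.1, w.2)%R.

Lemma Tst_neg w A : Tst (negl w) A = (- Tst w A)%R.
Proof. by rewrite /Tst /= mulNmx dotpNl. Qed.

Lemma latsq_neg w : latsq (negl w) = latsq w.
Proof. by rewrite /latsq /= dotpNl dotpNr opprK. Qed.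

Lemma measurable_negl : measurable_fun setT negl.
Proof. by apply: measurable_fun_pair; mfun. Qed.

Lemma Tst_le w A : (`|Tst w A| <= latsq w / 4)%R.
Proof.
apply: le_trans (bilin_small w.1 w.2 (small_Gm A)) _.
by rewrite /latsq; lra.
Qed.

Lemma measurable_Tst (dT : measure_display) (T : measurableType dT)
    (f : T -> W) (g : T -> 'M[R]_d) :
  measurable_fun setT f -> measurable_fun setT g ->
  measurable_fun setT (fun x => Tst (f x) (g x)).
Proof.
move=> mf mg; have mG := measurableT_comp measurable_Gm mg.
have m1 : measurable_fun setT (fun x => (f x).1) by exact: (measurableT_comp measurable_fst mf).
have m2 : measurable_fun setT (fun x => (f x).2) by exact: (measurableT_comp measurable_snd mf).
apply: measurable_dotp => //; exact: measurable_mulmx.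
Qed.

(** Approximate domination of measures passes only to integrals of nonnegative functions, hence the
    positive part. *)
Definition Tpos w A : R := Num.max (Tst w A) 0%R.

Lemma Tpos_bound w A : (0 <= Tpos w A <= latsq w / 4)%R.
Proof.
have := Tst_le w A; rewrite ler_norml => /andP[_ h].
by rewrite /Tpos le_max lexx orbT/= ge_max h divr_ge0// latsq_ge0.
Qed.

Lemma measurable_Tpos (dT : measure_display) (T : measurableType dT)
    (f : T -> W) (g : T -> 'M[R]_d) :
  measurable_fun setT f -> measurable_fun setT g ->
  measurable_fun setT (fun x => Tpos (f x) (g x)).
Proof.
by move=> mf mg; apply: measurable_maxr; [exact: measurable_Tst|exact: measurable_cst].
Qed.

Lemma measurable_Tpos2 w : measurable_fun setT (Tpos w).
Proof. by apply: (measurable_Tpos (f := fun=> w) (g := id)) => //; exact: measurable_cst. Qed.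

Definition Fp (w : W) (x : Xn) : \bar R := \int[M x]_A (Tpos w A)%:E.

Lemma Fp_ge0 w x : 0 <= Fp w x.
Proof. by apply: integral_ge0 => A _; rewrite lee_fin; have /andP[] := Tpos_bound w A. Qed.

Lemma Fp_le w x : Fp w x <= (latsq w / 4)%:E.
Proof.
rewrite /Fp integral_pker_at -[leRHS](integral_cst_prob (pker_at M x)).
apply: ge0_le_integral => //.
- by move=> A _; rewrite lee_fin; have /andP[] := Tpos_bound w A.
- by apply/measurable_EFinP; exact: measurable_Tpos2.
- by move=> A _; rewrite lee_fin; have /andP[] := Tpos_bound w A.
Qed.

Lemma measurable_Fp : measurable_fun setT (fun z : W * Xn => Fp z.1 z.2).
Proof.
apply: (measurable_integral_ker_snd M (k := fun z => (Tpos z.1.1 z.2)%:E)).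
  by move=> z; rewrite lee_fin; have /andP[] := Tpos_bound z.1.1 z.2.
apply/measurable_EFinP; apply: (measurable_Tpos (f := fun z : (W * Xn) * 'M[R]_d => z.1.1) (g := snd)) => //.
exact: (measurableT_comp measurable_fst measurable_fst).
Qed.

Lemma measurable_Fp_comp (dT : measure_display) (T : measurableType dT)
    (f : T -> W) (g : T -> Xn) :
  measurable_fun setT f -> measurable_fun setT g ->
  measurable_fun setT (fun x => Fp (f x) (g x)).
Proof. by move=> mf mg; exact: (measurableT_comp measurable_Fp (measurable_fun_pair mf mg)). Qed.

Lemma integral_latsq4 : \int[gp]_w (latsq w / 4)%:E <= (8 * d%:R)%:E.
Proof.
under eq_integral do rewrite mulrC EFinM.
rewrite ge0_integralZl//; last 2 first.
- by apply/measurable_EFinP; exact: measurable_latsq.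
- by move=> w _; rewrite lee_fin latsq_ge0.
have -> : (8 * d%:R)%:E = (4^-1)%:E * (32 * d%:R)%:E :> \bar R.
  by rewrite -EFinM; congr _%:E; field.
by apply: lee_wpmul2l; [rewrite lee_fin|exact: gauss_pair_sqnorm].
Qed.

Variables (eps delta : R).
Hypothesis eps01 : (0 <= eps <= 1)%R.
Hypothesis delta0 : (0 <= delta)%R.
Hypothesis hdp : differentially_private eps delta M.

(** [neighbors] demands that the changed rows differ, whereas a replaced latent pair may yield the
    same row; this is the extra case. *)
Lemma obs_near t i w : obs t = obs (tset t i w) \/
  (neighbors (obs t) (obs (tset t i w)) /\ neighbors (obs (tset t i w)) (obs t)).
Proof.
have eqj (j : 'I_n) : j != i -> tnth (obs t) j = tnth (obs (tset t i w)) j.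
  by move=> ji; rewrite !tnth_obs tnth_tset (negbTE ji).
have [e|ne] := eqVneq (tnth (obs t) i) (tnth (obs (tset t i w)) i).
  by left; apply: eq_from_tnth => j; have [->//|] := eqVneq j i; exact: eqj.
right; split; exists i; split.
- exact/eqP.
- exact: eqj.
- by apply/eqP; rewrite eq_sym.
- by move=> j ji; rewrite eqj.
Qed.

Lemma Fp_near w x x' : x = x' \/ neighbors x x' ->
  Fp w x <= (expR eps)%:E * Fp w x' + (delta * (latsq w / 4))%:E.
Proof.
move=> xx'; rewrite /Fp !integral_pker_at; apply: approx_le_integral => //.
- by rewrite divr_ge0// latsq_ge0.
- move=> A mA; case: xx' => [->|nb]; last exact: hdp.
  apply: (@le_trans _ _ ((expR eps)%:E * pker_at M x' A)); last by rewrite leeDl// lee_fin.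
  rewrite -[leLHS]mul1e; apply: lee_wpmul2r => //.
  by rewrite lee_fin -expR0 ler_expR; case/andP: eps01.
- exact: measurable_Tpos2.
- by move=> A; exact: Tpos_bound.
Qed.

Section symmetrised.
(** Instantiated by the identity and by [negl], for the positive and the negative part of [Tst]. *)
Variable sg : W -> W.
Hypothesis msg : measurable_fun setT sg.
Hypothesis lsg : forall w, latsq (sg w) = latsq w.

Let H (z : W * Wn) : \bar R := Fp (sg z.1) (obs z.2).

Let H0 z : 0 <= H z. Proof. exact: Fp_ge0. Qed.

Let mH : measurable_fun setT H.
Proof.
apply: measurable_Fp_comp; first exact: (measurableT_comp msg measurable_fst).
exact: (measurableT_comp measurable_obs measurable_snd).
Qed.

Let mHi (i : 'I_n) : measurable_fun setT (fun t : Wn => H (tnth t i, t)).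
Proof.
by apply: (measurableT_comp mH); apply: measurable_fun_pair => //; exact: measurable_tnth.
Qed.

Let mHc (i : 'I_n) : measurable_fun setT (fun z : Wn * W => H (tnth z.1 i, tset z.1 i z.2)).
Proof.
apply: (measurableT_comp mH); apply: measurable_fun_pair; last exact: measurable_tset.
exact: (measurableT_comp (measurable_tnth i) measurable_fst).
Qed.

Let mL (i : 'I_n) : measurable_fun setT (fun t : Wn => (delta * (latsq (tnth t i) / 4))%:E : \bar R).
Proof.
apply/measurable_EFinP; apply: measurable_funM => //; apply: measurable_funM => //.
exact: (measurableT_comp measurable_latsq (measurable_tnth i)).
Qed.

Let L0 (w : W) : 0 <= (delta * (latsq w / 4))%:E.
Proof. by rewrite lee_fin mulr_ge0// divr_ge0// latsq_ge0. Qed.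

Let intL (i : 'I_n) : \int[latn]_t (delta * (latsq (tnth t i) / 4))%:E <= (delta * (8 * d%:R))%:E.
Proof.
have ml4 : measurable_fun setT (fun w : W => (latsq w / 4)%:E : \bar R).
  by apply/measurable_EFinP; apply: measurable_funM => //; exact: measurable_latsq.
rewrite (integral_iid_tnth _ i (f := fun w => (delta * (latsq w / 4))%:E))//; last first.
  by under eq_fun do rewrite EFinM; exact: measurable_funeM.
under eq_integral do rewrite EFinM.
rewrite ge0_integralZl//; last by move=> w _; rewrite lee_fin divr_ge0// latsq_ge0.
by rewrite EFinM; apply: lee_wpmul2l; [rewrite lee_fin|exact: integral_latsq4].
Qed.

Let e0 : 0 <= (expR eps)%:E :> \bar R. Proof. by rewrite lee_fin expR_ge0. Qed.

Let mInt (i : 'I_n) : measurable_fun setT (fun t : Wn => \int[gp]_w H (tnth t i, tset t i w)).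
Proof. exact: (measurable_fun_fubini_tonelli_F _ (mHc i) (fun=> H0 _)). Qed.

(** Replacing record i in the data set by a fresh one alters the output law by the privacy factor
    only, and makes the tested record independent of the data. The additive cost is delta times the
    mean of [latsq / 4], at most 8 d delta. *)
Lemma correlated_le_indep (i : 'I_n) :
  \int[latn]_t Fp (sg (tnth t i)) (obs t) <=
  (expR eps)%:E * \int[gp]_w \int[latn]_t Fp (sg w) (obs t) + (delta * (8 * d%:R))%:E.
Proof.
have -> : \int[gp]_w \int[latn]_t Fp (sg w) (obs t) =
   \int[latn]_t \int[gp]_w H (tnth t i, tset t i w).
  by rewrite integral_iid_indep_copy.
apply: (@le_trans _ _ (\int[latn]_t ((expR eps)%:E * \int[gp]_w H (tnth t i, tset t i w)
   + (delta * (latsq (tnth t i) / 4))%:E))).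
  apply: ge0_le_integral => //.
  - by move=> t _; exact: Fp_ge0.
  - exact: (mHi i).
  - by apply: emeasurable_funD => //; exact: measurable_funeM.
  - move=> t _; rewrite -[leLHS](integral_cst_prob gp).
    rewrite -[X in _ <= _ + X](integral_cst_prob gp).
    have mt : measurable_fun setT (fun w => H (tnth t i, tset t i w)).
      exact: (measurableT_comp (mHc i) (pair1_measurable t)).
    rewrite -ge0_integralZl// -ge0_integralD//; last 2 first.
    + by move=> w _; rewrite mule_ge0.
    + exact: measurable_funeM.
    apply: ge0_le_integral => //.
    + by move=> w _; exact: Fp_ge0.
    + by apply: emeasurable_funD => //; exact: measurable_funeM.
    + move=> w _; rewrite -lsg; apply: Fp_near.
      by case: (obs_near t i w) => [|[]]; [left|right].
rewrite ge0_integralD//; last 2 first.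
- by move=> t _; rewrite mule_ge0// integral_ge0.
- exact: measurable_funeM.
rewrite ge0_integralZl//; last by move=> t _; exact: integral_ge0.
by rewrite leeD2l// intL.
Qed.

Lemma indep_le_correlated (i : 'I_n) :
  \int[gp]_w \int[latn]_t Fp (sg w) (obs t) <=
  (expR eps)%:E * \int[latn]_t Fp (sg (tnth t i)) (obs t) + (delta * (8 * d%:R))%:E.
Proof.
have -> : \int[gp]_w \int[latn]_t Fp (sg w) (obs t) =
   \int[latn]_t \int[gp]_w H (tnth t i, tset t i w).
  by rewrite integral_iid_indep_copy.
apply: (@le_trans _ _ (\int[latn]_t ((expR eps)%:E * H (tnth t i, t)
   + (delta * (latsq (tnth t i) / 4))%:E))).
  apply: ge0_le_integral => //.
  - by move=> t _; exact: integral_ge0.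
  - by apply: emeasurable_funD => //; exact: measurable_funeM.
  - move=> t _; rewrite -[leRHS](integral_cst_prob gp).
    have mt : measurable_fun setT (fun w => H (tnth t i, tset t i w)).
      exact: (measurableT_comp (mHc i) (pair1_measurable t)).
    apply: ge0_le_integral => //.
    move=> w _; rewrite -lsg; apply: Fp_near.
    by case: (obs_near t i w) => [|[]]; [left|right].
rewrite ge0_integralD//; last 2 first.
- by move=> t _; rewrite mule_ge0.
- exact: measurable_funeM.
rewrite ge0_integralZl//.
by rewrite leeD2l// intL.
Qed.

End symmetrised.

Lemma indep_neg : \int[gp]_w \int[latn]_t Fp (negl w) (obs t) =
  \int[gp]_w \int[latn]_t Fp w (obs t).
Proof.
have mH : measurable_fun setT (fun z : W * Wn => Fp z.1 (obs z.2)).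
  apply: measurable_Fp_comp => //.
  exact: (measurableT_comp measurable_obs measurable_snd).
have mI : measurable_fun setT (fun w : W => \int[latn]_t Fp w (obs t)).
  exact: (measurable_fun_fubini_tonelli_F _ mH (fun=> Fp_ge0 _ _)).
rewrite -[RHS](gauss_pair_oppl mI)// => w.
by apply: integral_ge0 => t _; exact: Fp_ge0.
Qed.

Lemma fro2_measurable (f : 'M[R]_d -> 'M[R]_d) : measurable_fun setT f ->
  measurable_fun setT (fun A => fro2 (f A)).
Proof.
move=> mf; apply: measurable_sum => i; apply: measurable_sum => j.
by apply: measurable_funX; exact: measurable_mx_entry.
Qed.

Definition Qx (x : Xn) : \bar R := \int[M x]_A (fro2 (psi A - th))%:E.

Lemma Qx_ge0 x : 0 <= Qx x.
Proof. by apply: integral_ge0 => A _; rewrite lee_fin fro2_ge0. Qed.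

Lemma measurable_psith : measurable_fun setT (fun A : 'M[R]_d => psi A - th)%R.
Proof.
apply: measurable_addmx; first exact: measurable_psi.
exact: measurable_cst.
Qed.

Lemma measurable_Qx : measurable_fun setT Qx.
Proof.
apply: measurable_fun_integral_kernel.
- by move=> V mV; exact: measurable_kernel.
- by move=> A; rewrite lee_fin fro2_ge0.
- by apply/measurable_EFinP; apply: fro2_measurable; exact: measurable_psith.
Qed.

(** For a record independent of the output the order of integration can be exchanged, and
    [gauss_pair_bilin_sqr] applies for each fixed A. *)
Lemma integral_Tst_sqr x :
  \int[gp]_w \int[M x]_A ((Tst w A) ^+ 2)%:E <= 256%:E * Qx x.
Proof.
have mT : measurable_fun setT (fun z : W * 'M[R]_d => ((Tst z.1 z.2) ^+ 2)%:E : \bar R).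
  apply/measurable_EFinP; apply: measurable_funX.
  exact: (measurable_Tst measurable_fst measurable_snd).
have T0 (z : W * 'M[R]_d) : 0 <= ((Tst z.1 z.2) ^+ 2)%:E :> \bar R by rewrite lee_fin sqr_ge0.
under eq_integral do rewrite integral_pker_at.
rewrite (fubini_tonelli (m1 := gp) (m2 := pker_at M x) _ mT T0).
rewrite /Qx integral_pker_at -ge0_integralZl//; last 2 first.
- by apply/measurable_EFinP; apply: fro2_measurable; exact: measurable_psith.
- by move=> A _; rewrite lee_fin fro2_ge0.
apply: ge0_le_integral => //.
- by move=> A _; exact: integral_ge0.
- exact: (measurable_fun_fubini_tonelli_G _ mT T0).
- apply: measurable_funeM; apply/measurable_EFinP; apply: fro2_measurable; exact: measurable_psith.
- move=> A _; apply: le_trans (gauss_pair_bilin_sqr (Gm A)) _.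
  by rewrite -EFinM lee_fin ler_wpM2l// fro2_Gm.
Qed.

(** Cauchy-Schwarz in linearised form: T <= T^2/(32 s) + 8 s. With second moment at most 256 times
    the squared error this gives (8/s) s^2 + 8 s. *)
Lemma indep_bound (s : R) : (0 < s)%R -> \int[latn]_t Qx (obs t) <= (s ^+ 2)%:E ->
  \int[gp]_w \int[latn]_t Fp w (obs t) <= (16 * s)%:E.
Proof.
move=> s0 hQ.
have mH : measurable_fun setT (fun z : W * Wn => Fp z.1 (obs z.2)).
  apply: measurable_Fp_comp => //.
  exact: (measurableT_comp measurable_obs measurable_snd).
have mH0 (z : W * Wn) : 0 <= Fp z.1 (obs z.2) by exact: Fp_ge0.
have eH : \int[gp]_w \int[latn]_t Fp w (obs t) = \int[latn]_t \int[gp]_w Fp w (obs t).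
  exact: (fubini_tonelli (m1 := gp) (m2 := latn) _ mH mH0).
have mHG : measurable_fun setT (fun t => \int[gp]_w Fp w (obs t)).
  exact: (measurable_fun_fubini_tonelli_G (m1 := gp) _ mH mH0).
rewrite eH.
have mQ : measurable_fun setT (fun t => Qx (obs t)).
  exact: (measurableT_comp measurable_Qx measurable_obs).
apply: (@le_trans _ _ (\int[latn]_t ((8 / s)%:E * Qx (obs t) + (8 * s)%:E))).
  apply: ge0_le_integral => //.
  - by move=> t _; apply: integral_ge0 => w _; exact: Fp_ge0.
  - by apply: emeasurable_funD => //; exact: measurable_funeM.
  - move=> t _; set x := obs t.
    have mw : measurable_fun setT (fun w : W => \int[M x]_A ((Tst w A) ^+ 2)%:E).
      under eq_fun do rewrite integral_pker_at.
      apply: (measurable_fun_fubini_tonelli_F (m2 := pker_at M x)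
        (fun z : W * 'M[R]_d => ((Tst z.1 z.2) ^+ 2)%:E)).
        apply/measurable_EFinP; apply: measurable_funX.
        exact: (measurable_Tst measurable_fst measurable_snd).
      by move=> z; rewrite lee_fin sqr_ge0.
    have w0 w : 0 <= \int[M x]_A ((Tst w A) ^+ 2)%:E.
      by apply: integral_ge0 => A _; rewrite lee_fin sqr_ge0.
    have k0 : (0 <= (32 * s)^-1)%R by rewrite invr_ge0 mulr_ge0// ltW.
    apply: (@le_trans _ _ (\int[gp]_w
        (((32 * s)^-1)%:E * \int[M x]_A ((Tst w A) ^+ 2)%:E + (8 * s)%:E))).
      apply: ge0_le_integral => //.
      + by move=> w _; exact: Fp_ge0.
      + by apply: measurable_Fp_comp => //; exact: measurable_cst.
      + by apply: emeasurable_funD => //; exact: measurable_funeM.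
      + move=> w _; rewrite /Fp !integral_pker_at.
        rewrite -[X in _ <= _ + X](integral_cst_prob (pker_at M x)).
        have mTw : measurable_fun setT (fun A => ((Tst w A) ^+ 2)%:E : \bar R).
          apply/measurable_EFinP; apply: measurable_funX.
          by apply: (measurable_Tst (f := fun=> w) (g := id)) => //; exact: measurable_cst.
        have T20 A : 0 <= ((Tst w A) ^+ 2)%:E :> \bar R by rewrite lee_fin sqr_ge0.
        rewrite -ge0_integralZl// -ge0_integralD//; last 3 first.
        * by move=> A _; rewrite mule_ge0// lee_fin.
        * exact: measurable_funeM.
        * by move=> A _; rewrite lee_fin mulr_ge0// ltW.
        apply: ge0_le_integral => //.
        * by move=> A _; rewrite lee_fin; have /andP[] := Tpos_bound w A.
        * by apply/measurable_EFinP; exact: measurable_Tpos2.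
        * by apply: emeasurable_funD => //; exact: measurable_funeM.
        * move=> A _; rewrite -EFinM -EFinD lee_fin /Tpos.
          have s32 : (0 < 32 * s)%R by rewrite mulr_gt0.
          have h : (0 <= (Tst w A - 16 * s) ^+ 2)%R by exact: sqr_ge0.
          rewrite ge_max; apply/andP; split; last first.
            by rewrite addr_ge0// mulr_ge0// ?sqr_ge0// ltW.
          rewrite -(ler_pM2l s32) mulrDr mulrA divff ?gt_eqF// mul1r.
          by nra.
    rewrite ge0_integralD//; last 3 first.
    + by move=> w _; rewrite mule_ge0// lee_fin.
    + exact: measurable_funeM.
    + by move=> w _; rewrite lee_fin mulr_ge0// ltW.
    rewrite integral_cst_prob leeD2r// ge0_integralZl//.
    apply: le_trans (lee_wpmul2l _ (integral_Tst_sqr x)) _; first by rewrite lee_fin.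
    rewrite muleA -EFinM; apply: lee_wpmul2r; first exact: Qx_ge0.
    by rewrite lee_fin le_eqVlt; apply/orP; left; apply/eqP; field; rewrite gt_eqF.
have s8 : (0 <= 8 / s)%R by rewrite divr_ge0// ltW.
rewrite ge0_integralD//; last 3 first.
- by move=> t _; rewrite mule_ge0// ?lee_fin// Qx_ge0.
- exact: measurable_funeM.
- by move=> t _; rewrite lee_fin mulr_ge0// ltW.
rewrite integral_cst_prob ge0_integralZl//; last by move=> t _; exact: Qx_ge0.
apply: (@le_trans _ _ ((8 / s)%:E * (s ^+ 2)%:E + (8 * s)%:E)).
  by rewrite leeD2r// lee_wpmul2l// lee_fin.
rewrite -EFinM -EFinD lee_fin le_eqVlt; apply/orP; left; apply/eqP.
by field; rewrite gt_eqF.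
Qed.

Lemma expR_le13 : (expR eps <= 1 + 3 * eps)%R.
Proof.
have /andP[e0 e1] := eps01.
have h : (1 - eps / 2 <= expR (- (eps / 2)))%R by exact: expR_ge1Dx.
have a0 : (0 < expR (eps / 2))%R := expR_gt0 _.
have ab : (expR (eps / 2) * expR (- (eps / 2)) = 1)%R by rewrite -expRD subrr expR0.
have -> : expR eps = (expR (eps / 2) * expR (eps / 2))%R by rewrite -expRD; congr expR; field.
have b1 : (expR (eps / 2) * (1 - eps / 2) <= 1)%R by rewrite -[leRHS]ab ler_pM2l.
set a := expR (eps / 2) in a0 b1 *.
have c0 : (0 < 1 - eps / 2)%R by lra.
have aa : (a * a * (1 - eps / 2) ^+ 2 <= 1)%R.
  have -> : (a * a * (1 - eps / 2) ^+ 2 = (a * (1 - eps / 2)) ^+ 2)%R by ring.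
  by apply: exprn_ile1 => //; rewrite mulr_ge0// ltW.
rewrite -(ler_pM2r (exprn_gt0 2 c0)); apply: le_trans aa _.
(* This product is four times the excess of (1 + 3 eps)(1 - eps/2)^2 over 1. *)
have : (0 <= eps * (1 - eps) * (8 - 3 * eps))%R by rewrite !mulr_ge0//; lra.
by nra.
Qed.

(** Positive and negative parts are both compared with the same independent value p0 <= 16 s, which
    [negl] leaves unchanged. Their difference is at most (e^eps - e^-eps) p0 <= 4 eps p0 plus two
    terms 8 d delta. *)
Lemma privacy_gap (s : R) (i : 'I_n) : (0 < s)%R ->
  \int[latn]_t Qx (obs t) <= (s ^+ 2)%:E ->
  \int[latn]_t Fp (tnth t i) (obs t) <=
  \int[latn]_t Fp (negl (tnth t i)) (obs t) + (64 * eps * s + 16 * (d%:R * delta))%:E.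
Proof.
move=> s0 hQ; have hb := indep_bound s0 hQ.
have hp := correlated_le_indep (sg := id) (@measurable_id _ _ _) (fun=> erefl) i.
have hq := indep_le_correlated measurable_negl latsq_neg i.
rewrite indep_neg in hq.
have p00 : 0 <= \int[gp]_w \int[latn]_t Fp w (obs t).
  by apply: integral_ge0 => w _; apply: integral_ge0 => t _; exact: Fp_ge0.
have q00 : 0 <= \int[latn]_t Fp (negl (tnth t i)) (obs t).
  by apply: integral_ge0 => t _; exact: Fp_ge0.
have p0' : 0 <= \int[latn]_t Fp (tnth t i) (obs t).
  by apply: integral_ge0 => t _; exact: Fp_ge0.
move: hb hp hq p00 q00 p0'.
rewrite /id.
set p0 := \int[gp]_w _; set p := \int[latn]_t Fp (tnth t i) _.
set q := \int[latn]_t Fp (negl _) _.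
move: p0 p q => [p0||] [p||] [q||]//=; rewrite ?leey//.
rewrite -!EFinM -!EFinD !lee_fin => hb hp hq p00 q00 _.
have /andP[e0' e1] := eps01.
have a1 := expR_le13.
have b1 : (1 - eps <= expR (- eps))%R by exact: expR_ge1Dx.
have b2 : (expR (- eps) <= 1)%R by rewrite -expR0 ler_expR oppr_le0.
have ab : (expR (- eps) * expR eps = 1)%R by rewrite -expRD addNr expR0.
have b0 : (0 < expR (- eps))%R := expR_gt0 _.
have hq' : (expR (- eps) * p0 <= q + expR (- eps) * (delta * (8 * d%:R)))%R.
  by have := ler_wpM2l (ltW b0) hq; rewrite mulrDr mulrA ab mul1r.
have D0 : (0 <= delta * (8 * d%:R))%R by rewrite !mulr_ge0.
have h1 : (expR eps * p0 <= (1 + 3 * eps) * p0)%R by rewrite ler_wpM2r.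
have h2 : ((1 - eps) * p0 <= expR (- eps) * p0)%R by rewrite ler_wpM2r.
have h3 : (expR (- eps) * (delta * (8 * d%:R)) <= delta * (8 * d%:R))%R by rewrite ler_piMl.
have h4 : (eps * p0 <= eps * (16 * s))%R by rewrite ler_wpM2l.
by nra.
Qed.

End privacy_bound.

(** * Lower bound on the fingerprint expectation for a fixed covariance *)

Section lower_bound.
Context {R : realType} {d n : nat}.
Notation W := ('rV[R]_d * 'rV[R]_d)%type.
Notation U := ((d * d).-tuple (measurableTypeR R)).
Notation Wn := (n.-tuple W).
Notation Xn := (n.-tuple 'rV[R]_d).
Variables (M : R.-pker Xn ~> 'M[R]_d) (u : U).
Local Open Scope ereal_scope.
Notation C := (Cmx u).
Notation th := (theta (Cmx u)).
Notation latn := (@lat R d n).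
Notation gp := (@gauss_pair R d).

Lemma integral_lin_psi (a : 'I_d -> 'I_d -> R) x :
  \int[M x]_A (\sum_j \sum_k a j k * (psi A j k - th j k))%:E =
  (\sum_j \sum_k a j k * (nuM M x j k - th j k))%:E.
Proof.
have ip j k : (pker_at M x).-integrable setT (fun A => (psi A j k)%:E : \bar R).
  exact: (bounded_integrable (pker_at M x) (measurable_psi_entry j k) (fun A => psi_le1 A j k)).
have ic j k : (pker_at M x).-integrable setT (fun A : 'M[R]_d => (th j k)%:E : \bar R).
  exact: finite_measure_integrable_cst.
have ia j k : (pker_at M x).-integrable setT
    (fun A => (a j k)%:E * ((psi A j k)%:E - (th j k)%:E)).
  by apply: integrableZl => //; exact: integrableB.
rewrite integral_pker_at.
transitivity (\int[pker_at M x]_A \sum_j \sum_k ((a j k)%:E * ((psi A j k)%:E - (th j k)%:E))).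
  apply: eq_integral => A _; rewrite -sumEFin; apply: eq_bigr => j _.
  by rewrite -sumEFin; apply: eq_bigr => k _; rewrite EFinM EFinB.
rewrite integral_sum//; last by move=> j; exact: integrable_sum.
rewrite -sumEFin; apply: eq_bigr => j _; rewrite integral_sum// -sumEFin.
apply: eq_bigr => k _; rewrite integralZl//; last exact: integrableB.
by rewrite integralB// integral_cst_prob -integral_pker_at psi_integral EFinM EFinB.
Qed.

Definition Tbar (w : W) (x : Xn) : R :=
  (\sum_j \sum_k (w.1 0 j * w.2 0 k * (1 - cu u j k ^+ 2)) * (nuM M x j k - th j k))%R.

Lemma Tst_sum w A : Tst u w A =
  (\sum_j \sum_k (w.1 0 j * w.2 0 k * (1 - cu u j k ^+ 2)) * (psi A j k - th j k))%R.
Proof.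
rewrite /Tst /dotp exchange_big/=; apply: eq_bigr => k _.
rewrite mxE mulr_suml; apply: eq_bigr => j _; rewrite [Gm u A j k]mxE; ring.
Qed.

Lemma Tbar_Fp w x : (Tbar w x)%:E = Fp M u w x - Fp M u (negl w) x.
Proof.
rewrite /Tbar -integral_lin_psi integralE; congr (_ - _).
- by apply: eq_integral => A _; rewrite funeposE /Tpos EFin_max Tst_sum.
- by apply: eq_integral => A _; rewrite funenegE /Tpos EFin_max Tst_neg Tst_sum EFinN.
Qed.

Lemma Fp_fin w x : Fp M u w x \is a fin_num.
Proof. by rewrite ge0_fin_numE ?Fp_ge0// (le_lt_trans (Fp_le M u w x)) ?ltry. Qed.

Lemma latsq_lattot (t : Wn) i : (latsq (tnth t i) <= lattot t)%R.
Proof.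
rewrite /lattot (bigD1 i)//=.
have h : (0 <= \sum_(j < n | j != i) latsq (tnth t j))%R.
  by apply: sumr_ge0 => j _; exact: latsq_ge0.
lra.
Qed.

Lemma Fp_integrable (sg : W -> W) i : measurable_fun setT sg ->
  (forall w, latsq (sg w) = latsq w) ->
  latn.-integrable setT (fun t => Fp M u (sg (tnth t i)) (obs u t)).
Proof.
move=> msg lsg.
have mt : measurable_fun setT (fun t : Wn => sg (tnth t i)).
  exact: (measurableT_comp msg (measurable_tnth i)).
have mF := measurable_Fp_comp M u mt (measurable_obs u).
apply/integrableP; split=> //; apply: le_lt_trans (integral_lattot n (R := R) (d := d)).
apply: ge0_le_integral => //.
- exact: measurableT_comp.
- by apply/measurable_EFinP; exact: measurable_lattot.
- move=> t _; rewrite gee0_abs ?Fp_ge0//; apply: le_trans (Fp_le _ _ _ _) _.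
  rewrite lee_fin lsg; apply: le_trans (latsq_lattot t i).
  by have := latsq_ge0 (tnth t i); lra.
Qed.

Lemma measurable_nuM_obs j k : measurable_fun setT (fun t => nuM M (obs u t) j k).
Proof. exact: (measurableT_comp (measurable_nuM M j k) (measurable_obs u)). Qed.

Lemma measurable_Tbar i : measurable_fun setT (fun t => Tbar (tnth t i) (obs u t)).
Proof.
apply: measurable_sum => j; apply: measurable_sum => k.
have mt := measurable_tnth_comp i (@measurable_id _ Wn setT).
have m1 : measurable_fun setT (fun t : Wn => (tnth t i).1) by exact: (measurableT_comp measurable_fst mt).
have m2 : measurable_fun setT (fun t : Wn => (tnth t i).2) by exact: (measurableT_comp measurable_snd mt).
have mn := measurable_nuM_obs j k.
apply: measurable_funM; last by apply: measurable_funB => //; exact: measurable_cst.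
apply: measurable_funM; last exact: measurable_cst.
by apply: measurable_funM; exact: measurable_mx_entry.
Qed.

Lemma Tbar_le (t : Wn) i : (`|Tbar (tnth t i) (obs u t)| <= lattot t)%R.
Proof.
have f1 := Fp_le M u (tnth t i) (obs u t).
have f2 := Fp_le M u (negl (tnth t i)) (obs u t).
have g1 := Fp_ge0 M u (tnth t i) (obs u t).
have g2 := Fp_ge0 M u (negl (tnth t i)) (obs u t).
have := Tbar_Fp (tnth t i) (obs u t); move: f1 f2 g1 g2.
rewrite latsq_neg -(fineK (Fp_fin (tnth t i) (obs u t))).
rewrite -(fineK (Fp_fin (negl (tnth t i)) (obs u t))) -EFinB !lee_fin.
move=> f1 f2 g1 g2 [->]; have := latsq_lattot t i; have := latsq_ge0 (tnth t i).
by rewrite ler_norml => h1 h2; apply/andP; split; lra.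
Qed.

Lemma Tbar_integrable i : latn.-integrable setT (fun t => (Tbar (tnth t i) (obs u t))%:E).
Proof.
apply: (@lattot_integrable _ _ _ (fun t => Tbar (tnth t i) (obs u t)) 1%R).
- exact: measurable_Tbar.
- by move=> t; rewrite mul1r; exact: Tbar_le.
Qed.

Variables (eps delta : R).
Hypothesis eps01 : (0 <= eps <= 1)%R.
Hypothesis delta0 : (0 <= delta)%R.
Hypothesis hdp : differentially_private eps delta M.
Variable s : R.
Hypothesis s0 : (0 < s)%R.
Hypothesis hQ : \int[latn]_t Qx M u (obs u t) <= (s ^+ 2)%:E.

Notation gap := (64 * eps * s + 16 * (d%:R * delta))%R.

Lemma integral_Tbar_le i : \int[latn]_t (Tbar (tnth t i) (obs u t))%:E <= gap%:E.
Proof.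
have h := privacy_gap eps01 delta0 hdp i s0 hQ.
have ip := Fp_integrable i (@measurable_id _ W setT) (fun=> erefl).
have iq := Fp_integrable i (@measurable_negl R d) (@latsq_neg R d).
rewrite [leLHS](_ : _ = \int[latn]_t (Fp M u (tnth t i) (obs u t)) -
   \int[latn]_t (Fp M u (negl (tnth t i)) (obs u t))); last first.
  rewrite -integralB//; apply: eq_integral => t _; exact: Tbar_Fp.
by rewrite leeBlDl// (integrable_fin_num measurableT iq).
Qed.

(** [Tbar] centres the estimate at [theta], and this is the correction that restores the uncentred
    score term. It does not depend on the output and is odd under [negl], so its mean is 0. *)
Definition Tth (w : W) : R :=
  (\sum_j \sum_k (w.1 0 j * w.2 0 k * (1 - cu u j k ^+ 2)) * th j k)%R.

Lemma measurable_Tth : measurable_fun setT Tth.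
Proof.
apply: measurable_sum => j; apply: measurable_sum => k.
have m1 : measurable_fun setT (fun w : W => w.1) by exact: measurable_fst.
have m2 : measurable_fun setT (fun w : W => w.2) by exact: measurable_snd.
apply: measurable_funM; last exact: measurable_cst.
apply: measurable_funM; last exact: measurable_cst.
by apply: measurable_funM; exact: measurable_mx_entry.
Qed.

Lemma Tth_neg w : Tth (negl w) = (- Tth w)%R.
Proof.
rewrite /Tth -sumrN; apply: eq_bigr => j _; rewrite -sumrN; apply: eq_bigr => k _.
by rewrite /= mxE !mulNr.
Qed.

Lemma Tth_le w : (`|Tth w| <= (d%:R ^+ 2) * latsq w)%R.
Proof.
have h j k : (`|(w.1 0 j * w.2 0 k * (1 - cu u j k ^+ 2)) * th j k| <= latsq w)%R.
  rewrite normrM -[leRHS]mulr1; apply: ler_pM => //.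
    rewrite normrM -[leRHS]mulr1; apply: ler_pM => //; first exact: coord_latsq.
    by have /andP[g0 g1] := cu_weight u j k; rewrite ger0_norm.
  apply: le_trans (small_theta (small_Cmx u) j k) _.
  case: (d) j k => [|e] j k; first by case: j.
  rewrite ler_pdivrMr ?ltr0n// mul1r.
  have : (1 <= e.+1%:R :> R)%R by rewrite ler1n.
  by lra.
apply: le_trans (ler_norm_sum _ _ _) _.
apply: (@le_trans _ _ (\sum_(j < d) \sum_(k < d) latsq w)%R).
  apply: ler_sum => j _; apply: le_trans (ler_norm_sum _ _ _) _.
  by apply: ler_sum => k _.
rewrite !sumr_const !card_ord -mulrnA -[leLHS]mulr_natr natrM.
by rewrite le_eqVlt; apply/orP; left; apply/eqP; ring.
Qed.

Lemma Tth_integrable i : latn.-integrable setT (fun t => (Tth (tnth t i))%:E).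
Proof.
apply: (@lattot_integrable _ _ _ (fun t => Tth (tnth t i)) (d%:R ^+ 2)%R).
- exact: (measurableT_comp measurable_Tth (measurable_tnth i)).
- move=> t; apply: le_trans (Tth_le _) _; apply: ler_wpM2l; first exact: sqr_ge0.
  exact: latsq_lattot.
Qed.

Lemma integral_Tth i : \int[latn]_t (Tth (tnth t i))%:E = 0.
Proof.
have mp : measurable_fun setT (fun w : W => maxe (Tth w)%:E 0).
  apply: measurable_maxe; last exact: measurable_cst.
  by apply/measurable_EFinP; exact: measurable_Tth.
have mp0 w : 0 <= maxe (Tth w)%:E 0 by rewrite le_max lexx orbT.
have ifp := integrable_pos_fin_num measurableT (Tth_integrable i).
rewrite integralE.
have -> : \int[latn]_t ((fun t : Wn => (Tth (tnth t i))%:E)^\- t) =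
   \int[latn]_t ((fun t : Wn => (Tth (tnth t i))%:E)^\+ t).
  transitivity (\int[gp]_w (maxe (Tth (negl w))%:E 0)).
    rewrite -(integral_iid_tnth gp i (f := fun w => maxe (Tth (negl w))%:E 0))//; last first.
      exact: (measurableT_comp mp (@measurable_negl R d)).
    by apply: eq_integral => t _; rewrite funenegE Tth_neg EFinN.
  transitivity (\int[gp]_w (maxe (Tth w)%:E 0)).
    exact: (gauss_pair_oppl mp mp0).
  rewrite -(integral_iid_tnth gp i (f := fun w => maxe (Tth w)%:E 0))//.
  by apply: eq_integral => t _; rewrite funeposE.
by rewrite subee.
Qed.

Definition corr (t : Wn) : R := (\sum_j \sum_k cu u j k * (nuM M (obs u t) j k - th j k))%R.

Lemma measurable_corr : measurable_fun setT corr.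
Proof.
apply: measurable_sum => j; apply: measurable_sum => k.
have mn := measurable_nuM_obs j k.
apply: measurable_funM; first exact: measurable_cst.
by apply: measurable_funB => //; exact: measurable_cst.
Qed.

Lemma corr_bounded t : (`|corr t| <= \sum_j \sum_k (1 + `|th j k|))%R.
Proof.
apply: le_trans (ler_norm_sum _ _ _) _; apply: ler_sum => j _.
apply: le_trans (ler_norm_sum _ _ _) _; apply: ler_sum => k _.
rewrite normrM -[leRHS]mul1r; apply: ler_pM => //; first exact: cu_le1.
apply: le_trans (ler_normB _ _) _; rewrite lerD2r; exact: nuM_le1.
Qed.

Lemma corr_integrable : latn.-integrable setT (fun t => (corr t)%:E).
Proof. exact: (bounded_integrable latn measurable_corr corr_bounded). Qed.

(** Entrywise, -u e <= d e^2/(2s) + s/(2d) for |u| <= 1. The weights are chosen so that, when the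
    squared error is s^2, both terms sum to s d/2 over the d^2 entries. *)
Lemma corr_pointwise x :
  0 <= (\sum_j \sum_k cu u j k * (nuM M x j k - th j k))%:E +
    ((d%:R / (2 * s))%:E * Qx M u x + (s * d%:R / 2)%:E).
Proof.
have k0 : (0 <= d%:R / (2 * s))%R by rewrite divr_ge0// mulr_ge0// ltW.
have sd0 : (0 <= s * d%:R / 2)%R by rewrite divr_ge0// mulr_ge0// ltW.
have mfr : measurable_fun setT (fun A : 'M[R]_d => (fro2 (psi A - th))%:E : \bar R).
  by apply/measurable_EFinP; apply: fro2_measurable; exact: measurable_psith.
have fr0 A : 0 <= (fro2 (psi A - th))%:E :> \bar R by rewrite lee_fin fro2_ge0.
pose f (A : 'M[R]_d) := (\sum_j \sum_k cu u j k * (psi A j k - th j k))%R.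
pose g (A : 'M[R]_d) := (d%:R / (2 * s) * fro2 (psi A - th) + s * d%:R / 2)%R.
have g0 A : (0 <= g A)%R by rewrite addr_ge0// mulr_ge0// fro2_ge0.
have mf : measurable_fun setT f.
  apply: measurable_sum => j; apply: measurable_sum => k.
  have mn := measurable_psi_entry (R := R) (d := d) j k.
  apply: measurable_funM; first exact: measurable_cst.
  by apply: measurable_funB => //; exact: measurable_cst.
have mg : measurable_fun setT g.
  apply: measurable_funD; last exact: measurable_cst.
  apply: measurable_funM; first exact: measurable_cst.
  by apply: fro2_measurable; exact: measurable_psith.
have fg A : (0 <= f A + g A)%R.
  have [d0|dp] := posnP d.
    by rewrite addr_ge0// /f big1// => j; exfalso; move: (ltn_ord j); rewrite {2}d0.
  have dR : (0 < d%:R :> R)%R by rewrite ltr0n.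
  rewrite /f /g /fro2.
  have -> : (s * d%:R / 2 = \sum_(j < d) \sum_(k < d) s / (2 * d%:R) :> R)%R.
    rewrite !sumr_const !card_ord -mulrnA -[RHS]mulr_natr natrM; field.
    by rewrite gt_eqF.
  rewrite mulr_sumr -!big_split/=; apply: sumr_ge0 => j _.
  rewrite mulr_sumr -!big_split/=; apply: sumr_ge0 => k _.
  rewrite (_ : (psi A - th)%R j k = psi A j k - th j k)%R; last first.
    by rewrite [LHS]mxE [X in (_ + X)%R]mxE.
  move: (psi A j k - th j k)%R => e.
  have := cu_le1 u j k; rewrite ler_norml => /andP[c1 c2].
  move: (cu u j k) c1 c2 => c c1 c2.
  have ds : (0 < 2 * s * d%:R :> R)%R by rewrite !mulr_gt0.
  rewrite -(pmulr_rge0 _ ds).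
  have -> : (2 * s * d%:R * (c * e + (d%:R / (2 * s) * e ^+ 2 + s / (2 * d%:R))) =
     (d%:R * e + c * s) ^+ 2 + (1 - c ^+ 2) * s ^+ 2 :> R)%R.
    by field; rewrite !gt_eqF.
  by rewrite addr_ge0 ?sqr_ge0// mulr_ge0 ?sqr_ge0//; nra.
have If : \int[M x]_A (f A)%:E = (\sum_j \sum_k cu u j k * (nuM M x j k - th j k))%:E.
  exact: integral_lin_psi.
have Ig : \int[M x]_A (g A)%:E = (d%:R / (2 * s))%:E * Qx M u x + (s * d%:R / 2)%:E.
  rewrite /g integral_pker_at; under eq_integral do rewrite EFinD EFinM.
  rewrite ge0_integralD//; last 2 first.
  - by move=> A _; rewrite mule_ge0// lee_fin.
  - exact: measurable_funeM.
  by rewrite integral_cst_prob ge0_integralZl// -integral_pker_at.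
have bf A : (`|f A| <= \sum_j \sum_k (1 + `|th j k|))%R.
  apply: le_trans (ler_norm_sum _ _ _) _; apply: ler_sum => j _.
  apply: le_trans (ler_norm_sum _ _ _) _; apply: ler_sum => k _.
  rewrite normrM -[leRHS]mul1r; apply: ler_pM => //; first exact: cu_le1.
  apply: le_trans (ler_normB _ _) _; rewrite lerD2r; exact: psi_le1.
have if_ := bounded_integrable (pker_at M x) mf bf.
have : \int[M x]_A (- f A)%:E <= \int[M x]_A (g A)%:E.
  rewrite !integral_pker_at.
  (* Passing through the positive part of -f reduces the comparison with g to nonnegative functions,
     where integrability of g is not at issue. *)
  apply: (@le_trans _ _ (\int[pker_at M x]_A (Num.max (- f A) 0)%:E)).
    apply: le_integral => //.
    - apply: (bounded_integrable (pker_at M x) (f := fun A => (- f A)%R) (K := (\sum_j \sum_k (1 + `|th j k|))%R)).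
        exact: measurableT_comp.
      by move=> A; rewrite normrN.
    - apply: (bounded_integrable (pker_at M x) (f := fun A => (Num.max (- f A) 0)%R) (K := (\sum_j \sum_k (1 + `|th j k|))%R)).
        apply: measurable_maxr; last exact: measurable_cst.
        exact: measurableT_comp.
      move=> A; rewrite ger0_norm ?le_max ?lexx ?orbT// ge_max; apply/andP; split.
        by apply: le_trans (bf A); rewrite -normrN; exact: ler_norm.
      by apply: le_trans (bf A).
    - by move=> A _; rewrite lee_fin le_max lexx.
  apply: ge0_le_integral => //.
  - by move=> A _; rewrite lee_fin le_max lexx orbT.
  - apply/measurable_EFinP; apply: measurable_maxr; last exact: measurable_cst.
    exact: measurableT_comp.
  - exact/measurable_EFinP.
  - by move=> A _; rewrite lee_fin ge_max g0 andbT; have := fg A; lra.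
have -> : \int[M x]_A (- f A)%:E = - \int[M x]_A (f A)%:E.
  rewrite !integral_pker_at -integralN//; exact: integrable_add_def.
rewrite If Ig => /(leeD2l (\sum_j \sum_k cu u j k * (nuM M x j k - th j k))%:E).
by rewrite subee.
Qed.

Lemma integral_corr_ge : (- (s * d%:R))%:E <= \int[latn]_t (corr t)%:E.
Proof.
have k0 : (0 <= d%:R / (2 * s))%R by rewrite divr_ge0// mulr_ge0// ltW.
have mQ : measurable_fun setT (fun t => Qx M u (obs u t)).
  exact: (measurableT_comp (measurable_Qx M u) (measurable_obs u)).
have iQ : latn.-integrable setT (fun t => Qx M u (obs u t)).
  apply/integrableP; split=> //.
  under eq_integral do rewrite gee0_abs ?Qx_ge0//.
  exact: le_lt_trans hQ (ltry _).
have ik : latn.-integrable setT (fun t => (d%:R / (2 * s))%:E * Qx M u (obs u t)) by exact: integrableZl.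
have ic : latn.-integrable setT (fun t : Wn => (s * d%:R / 2)%:E : \bar R).
  exact: finite_measure_integrable_cst.
have ikc : latn.-integrable setT (fun t => (d%:R / (2 * s))%:E * Qx M u (obs u t) + (s * d%:R / 2)%:E).
  exact: integrableD.
have h : 0 <= \int[latn]_t ((corr t)%:E + ((d%:R / (2 * s))%:E * Qx M u (obs u t) + (s * d%:R / 2)%:E)).
  by apply: integral_ge0 => t _; exact: corr_pointwise.
move: h; rewrite integralD//; last exact: corr_integrable.
rewrite integralD// integral_cst_prob integralZl//.
have fc := integrable_fin_num measurableT corr_integrable.
have fQ := integrable_fin_num measurableT iQ.
move: hQ; rewrite -(fineK fc) -(fineK fQ) -!EFinM -!EFinD !lee_fin.
move: (fine _) (fine _) => c q hq h.
have h1 : (d%:R / (2 * s) * q <= d%:R / (2 * s) * s ^+ 2)%R by rewrite ler_wpM2l.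
have h2 : (d%:R / (2 * s) * s ^+ 2 = s * d%:R / 2 :> R)%R by field; rewrite gt_eqF.
by lra.
Qed.

Notation nuX := (fun j k (t : Wn) => nuM M (dat t) j k).

Lemma fpsum_decomp t : fpsum nuX u (shear C t) =
  ((\sum_j \sum_k cu u j k * th j k) + corr t -
    @stp R d / 2 * \sum_(i < n) (Tbar (tnth t i) (obs u t) + Tth (tnth t i)))%R.
Proof.
rewrite fpsum_shear /corr.
have -> : (\sum_(i < n) (Tbar (tnth t i) (obs u t) + Tth (tnth t i)) =
    \sum_j \sum_k (1 - cu u j k ^+ 2) * sc t j k * nuM M (obs u t) j k)%R.
  transitivity (\sum_(i < n) \sum_j \sum_k
     (tnth t i).1 0 j * (tnth t i).2 0 k * (1 - cu u j k ^+ 2) * nuM M (obs u t) j k)%R.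
    apply: eq_bigr => i _; rewrite /Tbar /Tth -big_split/=; apply: eq_bigr => j _.
    by rewrite -big_split/=; apply: eq_bigr => k _; ring.
  rewrite exchange_big/=; apply: eq_bigr => j _.
  rewrite exchange_big/=; apply: eq_bigr => k _.
  rewrite /sc mulr_sumr mulr_suml; apply: eq_bigr => i _; ring.
rewrite mulr_sumr -big_split/= -sumrB; apply: eq_bigr => j _.
rewrite mulr_sumr -big_split/= -sumrB; apply: eq_bigr => k _.
by rewrite -/(obs u t); field.
Qed.

(** In [fpsum_decomp] the first summand is the signal; accuracy bounds the second through
    [integral_corr_ge], and privacy bounds the score term by one gap per record. *)
Lemma fpexp_ge :
  ((\sum_j \sum_k cu u j k * th j k) - s * d%:R - @stp R d / 2 * (n%:R * gap))%:E
  <= fpexp nuX u.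
Proof.
have ih i : latn.-integrable setT (fun t => (Tbar (tnth t i) (obs u t))%:E + (Tth (tnth t i))%:E).
  by apply: integrableD => //; [exact: Tbar_integrable|exact: Tth_integrable].
have is_ : latn.-integrable setT (fun t => \sum_(i < n) ((Tbar (tnth t i) (obs u t))%:E + (Tth (tnth t i))%:E)).
  exact: integrable_sum.
have ic : latn.-integrable setT (fun t : Wn => (\sum_j \sum_k cu u j k * th j k)%:E : \bar R).
  exact: finite_measure_integrable_cst.
have icc : latn.-integrable setT (fun t : Wn => (\sum_j \sum_k cu u j k * th j k)%:E + (corr t)%:E).
  by apply: integrableD => //; exact: corr_integrable.
have -> : fpexp nuX u = (\sum_j \sum_k cu u j k * th j k)%:E + \int[latn]_t (corr t)%:E -
    (@stp R d / 2)%:E * \sum_(i < n) \int[latn]_t (Tbar (tnth t i) (obs u t))%:E.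
  rewrite /fpexp.
  transitivity (\int[latn]_t (((\sum_j \sum_k cu u j k * th j k)%:E + (corr t)%:E) -
     (@stp R d / 2)%:E * (\sum_(i < n) ((Tbar (tnth t i) (obs u t))%:E + (Tth (tnth t i))%:E)))).
    apply: eq_integral => t _; rewrite fpsum_decomp EFinB EFinD EFinM.
    suff -> : (\sum_(i < n) (Tbar (tnth t i) (obs u t) + Tth (tnth t i)))%:E =
      \sum_(i < n) ((Tbar (tnth t i) (obs u t))%:E + (Tth (tnth t i))%:E) by [].
    by rewrite -sumEFin; apply: eq_bigr => i _; rewrite EFinD.
  rewrite integralB//; last exact: integrableZl.
  rewrite integralD//; last exact: corr_integrable.
  rewrite integral_cst_prob integralZl// integral_sum//.
  congr (_ - _ * _); apply: eq_bigr => i _.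
  rewrite integralD//; [|exact: Tbar_integrable|exact: Tth_integrable].
  by rewrite integral_Tth adde0.
have hc := integral_corr_ge.
have hT : \sum_(i < n) \int[latn]_t (Tbar (tnth t i) (obs u t))%:E <= (n%:R * gap)%:E.
  apply: (@le_trans _ _ (\sum_(i < n) gap%:E)).
    by apply: lee_sum => i _; exact: integral_Tbar_le.
  by rewrite sumEFin sumr_const card_ord [(n%:R * _)%R]mulr_natl.
have fc := integrable_fin_num measurableT corr_integrable.
have fT : \sum_(i < n) \int[latn]_t (Tbar (tnth t i) (obs u t))%:E \is a fin_num.
  by apply/sum_fin_numP => i _ _; exact: (integrable_fin_num measurableT (Tbar_integrable i)).
move: hc hT; rewrite -(fineK fc) -(fineK fT).
set c := fine (\int[latn]_t (corr t)%:E); set q := fine (\sum_(i < n) _).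
rewrite [X in _ -> _ -> _ <= X](_ : _ =
  ((\sum_j \sum_k cu u j k * th j k) + c - @stp R d / 2 * q)%:E)//.
rewrite !lee_fin => hc hq.
have p0 : (0 <= @stp R d / 2)%R by rewrite divr_ge0// stp_ge0.
have h1 := ler_wpM2l p0 hq.
by lra.
Qed.

End lower_bound.

(** * From Mahalanobis accuracy to the clamped Frobenius error *)

Section accuracy.
Context {R : realType} {d n : nat}.
Notation W := ('rV[R]_d * 'rV[R]_d)%type.
Notation U := ((d * d).-tuple (measurableTypeR R)).
Notation Xn := (n.-tuple 'rV[R]_d).
Variables (M : R.-pker Xn ~> 'M[R]_d) (u : U).
Local Open Scope ereal_scope.
Notation th := (theta (Cmx u)).
Notation latn := (@lat R d n).

Definition Sig (v : U) : 'M[R]_d := ((5 / 4)%:M + theta (Cmx v))%R.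

Lemma fro2_psi_le A : (fro2 (psi A - th) <= fro2 (A - Sig u))%R.
Proof.
apply: ler_sum => j _; apply: ler_sum => k _.
have -> : (psi A - th)%R j k = (clamp (4^-1 / d%:R) (A j k - ((5 / 4)%:M : 'M[R]_d) j k) - th j k)%R.
  by rewrite [LHS]mxE [X in (_ + X)%R]mxE [psi A j k]mxE.
have -> : (A - Sig u)%R j k = (A j k - ((5 / 4)%:M : 'M[R]_d) j k - th j k)%R.
  by rewrite [LHS]mxE [X in (_ + X)%R]mxE [Sig u j k]mxE opprD addrA.
rewrite -[leLHS]real_normK ?num_real// -[leRHS]real_normK ?num_real//.
rewrite lerXn2r ?nnegrE// clamp_dist//.
exact: (small_theta (small_Cmx u) j k).
Qed.

Lemma fro2_maha A : (fro2 (psi A - th) <= 4 * mahalanobis (Sig u) (A - Sig u) ^+ 2)%R.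
Proof.
have [H [symH uH sH HH]] := small_sqrt (theta_sym (Cmx u)) (small_theta (small_Cmx u)).
apply: le_trans (fro2_psi_le A) _; rewrite /Sig -HH.
apply: fro2_mahalanobis => // x; rewrite HH mulmxDr mul_mx_scalar dotpDl dotpZl.
have := quad_small x (small_theta (small_Cmx u)); rewrite ler_norml => /andP[_].
by have := dotp_ge0 x; lra.
Qed.

(** [integral_gaussian] identifies the law of one row, and [iid_transfer] with density 1 extends
    this to the whole sample. *)
Lemma integral_Qx_obs : \int[iid (gaussian (Sig u)) n]_x Qx M u x = \int[latn]_t Qx M u (obs u t).
Proof.
have mo : measurable_fun setT (obs1 u).
  rewrite /obs1 /shear1/=; by mfun.
have mQ := measurable_Qx M u.
have := @iid_transfer R _ _ _ 'rV[R]_d W 'rV[R]_d (gaussian (Sig u)) gauss_pair n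
  (fun=> id) (fun=> obs1 u) (fun _ _ => 1%R).
move=> /(_ _ _ _ _ _ (Qx M u) mQ (Qx_ge0 M u)) h.
transitivity (\int[iid (gaussian (Sig u)) n]_t Qx M u [tuple id (tnth t i) | i < n]).
  apply: eq_integral => t _; congr (Qx M u _).
  by apply: eq_from_tnth => i; rewrite tnth_mktuple.
rewrite h//.
- apply: eq_integral => t _; rewrite big1_eq mule1; congr (Qx M u _).
  by apply: eq_from_tnth => i; rewrite tnth_obs tnth_mktuple.
- move=> _ F mF F0; under [RHS]eq_integral do rewrite mule1.
  apply: (integral_gaussian (C := Cmx u)) => //; last exact: (small_theta (small_Cmx u)).
  by rewrite /Sig /theta addrA.
Qed.

Lemma accuracy_Qx (alpha : R) :
  \int[iid (gaussian (Sig u)) n]_X \int[M X]_A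
     (mahalanobis (Sig u) (A - Sig u) ^+ 2)%:E <= (alpha ^+ 2)%:E ->
  \int[latn]_t Qx M u (obs u t) <= ((2 * alpha) ^+ 2)%:E.
Proof.
move=> acc; rewrite -integral_Qx_obs.
have mm : measurable_fun setT (fun A : 'M[R]_d => (mahalanobis (Sig u) (A - Sig u) ^+ 2)%:E : \bar R).
  have e A : (mahalanobis (Sig u) (A - Sig u) ^+ 2 =
      fro2 (invmx (sqrtmx (Sig u)) *m (A - Sig u) *m invmx (sqrtmx (Sig u))))%R.
    by rewrite /mahalanobis /frobenius sqr_sqrtr//; exact: fro2_ge0.
  under eq_fun do rewrite e.
  apply/measurable_EFinP.
  apply: (@fro2_measurable R d (fun A => invmx (sqrtmx (Sig u)) *m (A - Sig u) *m invmx (sqrtmx (Sig u)))).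
  by mfun.
have m0 A : 0 <= (mahalanobis (Sig u) (A - Sig u) ^+ 2)%:E :> \bar R by rewrite lee_fin sqr_ge0.
have mX : measurable_fun setT (fun X : Xn => \int[M X]_A (mahalanobis (Sig u) (A - Sig u) ^+ 2)%:E).
  apply: measurable_fun_integral_kernel => //.
  by move=> V mV; exact: measurable_kernel.
apply: (@le_trans _ _ (\int[iid (gaussian (Sig u)) n]_X (4%:E * \int[M X]_A
     (mahalanobis (Sig u) (A - Sig u) ^+ 2)%:E))).
  apply: ge0_le_integral => //.
  - by move=> X _; exact: Qx_ge0.
  - exact: measurable_Qx.
  - exact: measurable_funeM.
  - move=> X _; rewrite /Qx -ge0_integralZl//.
    apply: ge0_le_integral => //.
    + by move=> A _; rewrite lee_fin fro2_ge0.
    + by apply/measurable_EFinP; apply: fro2_measurable; exact: measurable_psith.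
    + exact: measurable_funeM.
    + by move=> A _; rewrite -EFinM lee_fin fro2_maha.
rewrite ge0_integralZl//; last by move=> X _; exact: integral_ge0.
have -> : ((2 * alpha) ^+ 2)%:E = 4%:E * (alpha ^+ 2)%:E :> \bar R.
  by rewrite -EFinM; congr _%:E; ring.
by apply: lee_wpmul2l; rewrite ?lee_fin.
Qed.

End accuracy.

(** * Moments of the uniform prior *)

Section prior_moments.
Context {R : realType} {d : nat}.
Notation U := ((d * d).-tuple (measurableTypeR R)).
Local Open Scope ereal_scope.
Notation mu := (@lebesgue_measure R).

Lemma mclamp : measurable_fun setT (fun v : measurableTypeR R => clamp 1 (v : R)).
Proof. by apply: measurable_clamp; exact: measurable_id. Qed.

Lemma unif_mean : \int[@unif R]_v (clamp 1 v)%:E = 0.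
Proof.
rewrite (unif_integral (K := 1) mclamp); last by move=> v; exact: clamp_le.
rewrite -[RHS](mule0 (2^-1)%:E) -[X in _ = _ * X](integral_by_parts_weight (0%R : R) 0%R 0%R).
rewrite (_ : \int[mu]_(x in `[(-1)%R, 1%R]) (clamp 1 x)%:E = \int[mu]_(v in `[(-1)%R, 1%R])
    ((v - (1 - v ^+ 2) / 2 * (0 + 2 * 0 * v)) * expR (0 + 0 * v + 0 * v ^+ 2))%:E)//.
apply: eq_integral => v; rewrite inE/= in_itv/= => v1.
rewrite clamp_id ?ler_norml// !(mulr0, mul0r, addr0) expR0 mulr1 subr0//.
Qed.

Lemma unif_sqr : \int[@unif R]_v ((clamp 1 v) ^+ 2)%:E = (3^-1)%:E.
Proof.
have mc2 : measurable_fun setT (fun v : measurableTypeR R => (clamp 1 (v : R) ^+ 2)%R).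
  by apply: measurable_funX; exact: mclamp.
rewrite (unif_integral (K := 1) mc2); last first.
  move=> v; have : (`|clamp 1 v| <= 1 :> R)%R by exact: clamp_le.
  rewrite ler_norml => /andP[c1 c2].
  by rewrite ger0_norm ?sqr_ge0//; nra.
pose F (v : R) := (v ^+ 3 / 3)%R.
have dF (v : R) : is_derive v 1%R F (v ^+ 2)%R.
  rewrite /F; apply: is_derive_eq.
  by rewrite /GRing.scale/=; field.
have -> : \int[mu]_(v in `[(-1)%R, 1%R]) ((clamp 1 v) ^+ 2)%:E = \int[mu]_(v in `[(-1)%R, 1%R]) (v ^+ 2)%:E.
  by apply: eq_integral => v; rewrite inE/= in_itv/= => v1; rewrite clamp_id ?ler_norml.
have -> := @continuous_FTC2 R (fun v => v ^+ 2)%R F (-1)%R 1%R.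
- by rewrite /F -EFinB -EFinM; congr _%:E; field.
- by lra.
- by apply: continuous_subspaceT => v; exact: exprn_continuous.
- split.
  + by move=> x _; exact: ex_derive.
  + apply: cvg_at_right_filter; apply: differentiable_continuous.
    by apply/derivable1_diffP; exact: ex_derive.
  + apply: cvg_at_left_filter; apply: differentiable_continuous.
    by apply/derivable1_diffP; exact: ex_derive.
- by move=> x _; rewrite derive1E; exact: derive_val.
Qed.

Lemma prior_sqr (j k : 'I_d) : \int[@prior R d]_u (cu u j k ^+ 2)%:E = (3^-1)%:E.
Proof.
rewrite (integral_iid_tnth _ (mxvec_index j k) 
  (f := fun v : measurableTypeR R => (clamp 1 (v : R) ^+ 2)%:E)).
- exact: unif_sqr.
- by apply/measurable_EFinP; apply: measurable_funX; exact: mclamp.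
- by move=> v; rewrite lee_fin sqr_ge0.
Qed.

(** A square on the diagonal; off it, u_jk and u_kj are distinct independent coordinates of mean
    0. *)
Lemma prior_cross (j k : 'I_d) : 0 <= \int[@prior R d]_u (cu u j k * cu u k j)%:E.
Proof.
have [->|jk] := eqVneq j k.
  by apply: integral_ge0 => u _; rewrite lee_fin -expr2 sqr_ge0.
have mcc : measurable_fun setT (fun u : U => (cu u j k * cu u k j)%R).
  by apply: measurable_funM; exact: measurable_cu.
rewrite (iid_integral_eq0 (i := mxvec_index j k) (K := 1) mcc)//.
  by move=> u; rewrite normrM -[leRHS]mulr1; apply: ler_pM => //; exact: cu_le1.
move=> u.
transitivity (\int[@unif R]_v ((cu u k j)%:E * (clamp 1 v)%:E)).
  apply: eq_integral => v _; rewrite -EFinM mulrC /cu !tnth_tset eqxx.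
  by rewrite mxvec_index_inj xpair_eqE eq_sym (negbTE jk).
rewrite integralZl//; first by rewrite unif_mean mule0.
apply: (bounded_integrable unif mclamp (K := 1)) => v; exact: clamp_le.
Qed.

End prior_moments.

(** * The fingerprinting inequality averaged over the prior *)

Section main_inequality.
Context {R : realType} {d n : nat}.
Notation U := ((d * d).-tuple (measurableTypeR R)).
Notation Xn := (n.-tuple 'rV[R]_d).
Local Open Scope ereal_scope.

Lemma measurable_Sig : measurable_fun setT (@Sig R d).
Proof.
have mC := @measurable_Cmx R d.
by rewrite /Sig /theta; mfun.
Qed.

(** The linear part (C + C^T)/2 of [theta] gives the quadratic form in u. The entries of C^T C / 4
    are at most 1/(256 d), which over d^2 entries costs d/256. *)
Lemma corr_theta_ge (u : U) :
  (stp (d := d) / 2 * (\sum_j \sum_k (cu u j k ^+ 2 + cu u j k * cu u k j)) - d%:R / 256 <=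
   \sum_j \sum_k cu u j k * theta (Cmx u) j k)%R.
Proof.
have h j k : (stp (d := d) / 2 * (cu u j k ^+ 2 + cu u j k * cu u k j) - 256^-1 / d%:R <=
   cu u j k * theta (Cmx u) j k)%R.
  have te : (theta (Cmx u) j k = 2^-1 * (@stp R d * cu u j k + @stp R d * cu u k j) +
      4^-1 * ((Cmx u)^T *m Cmx u) j k)%R.
    by rewrite /theta; move: ((Cmx u)^T *m Cmx u) => X; rewrite !mxE.
  have := small_mulmx (smallT (small_Cmx u)) (small_Cmx u) j k; rewrite te.
  rewrite [(256^-1 / _)%R](_ : _ = 4^-1 * (8^-1 * 8^-1 / d%:R))%R; last first.
    by rewrite !mulrA; congr (_ / _)%R; field.
  have := cu_le1 u j k; move: (((Cmx u)^T *m Cmx u) j k) => X.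
  move: (cu u j k) (cu u k j) (8^-1 * 8^-1 / d%:R)%R (@stp R d) => c c' q p hc hX.
  have cX : (`|c * X| <= q)%R by rewrite normrM -[leRHS]mul1r; exact: ler_pM.
  have {cX} := cX; rewrite ler_norml => /andP[cX _].
  have -> : (c * (2^-1 * (p * c + p * c') + 4^-1 * X) =
    p / 2 * (c ^+ 2 + c * c') + 4^-1 * (c * X))%R by field.
  by lra.
apply: (@le_trans _ _ (\sum_(j < d) \sum_(k < d) (stp (d := d) / 2 *
    (cu u j k ^+ 2 + cu u j k * cu u k j) - 256^-1 / d%:R))%R); last first.
  by apply: ler_sum => j _; apply: ler_sum.
under [leRHS]eq_bigr do rewrite sumrB -mulr_sumr sumr_const card_ord.
rewrite sumrB -mulr_sumr sumr_const card_ord lerB//.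
rewrite -mulrnA -[leLHS]mulr_natr natrM.
have [->|d0] := posnP d; first by rewrite !mulr0.
rewrite le_eqVlt; apply/orP; left; apply/eqP; field.
by rewrite pnatr_eq0 -lt0n.
Qed.

(** The fingerprint expectation averages to 0 over the prior and almost everywhere dominates signal
    minus errors, with s = 2 alpha. So the mean signal, at least stp/2 times d^2/3 by the moments of
    the prior, cannot exceed the errors. *)
Lemma fingerprinting_lower_bound (M : R.-pker Xn ~> 'M[R]_d) (alpha eps delta : R) :
  (0 < alpha)%R -> (0 <= eps <= 1)%R -> (0 <= delta)%R ->
  differentially_private eps delta M ->
  {ae (@prior R d), forall u : U,
     \int[iid (gaussian (Sig u)) n]_X \int[M X]_A
       (mahalanobis (Sig u) (A - Sig u) ^+ 2)%:E <= (alpha ^+ 2)%:E} ->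
  (stp (d := d) / 2 * (d%:R ^+ 2 / 3) <= d%:R / 256 + 2 * alpha * d%:R +
    stp (d := d) / 2 * (n%:R * (64 * eps * (2 * alpha) + 16 * (d%:R * delta))))%R.
Proof.
move=> a0 e01 d0 dp acc.
have s0 : (0 < 2 * alpha)%R by rewrite mulr_gt0.
pose nu j k (t : n.-tuple ('rV[R]_d * 'rV[R]_d)%type) := nuM M (dat t) j k.
have mnu j k : measurable_fun setT (nu j k).
  exact: (measurableT_comp (measurable_nuM M j k) measurable_dat).
have nu1 j k t : (`|nu j k t| <= 1)%R by exact: nuM_le1.
have ifp := fpexp_integrable mnu nu1.
have fp0 := integral_fpexp mnu nu1.
set K := (d%:R / 256 + 2 * alpha * d%:R +
    stp (d := d) / 2 * (n%:R * (64 * eps * (2 * alpha) + 16 * (d%:R * delta))))%R.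
pose q (u : U) := (\sum_j \sum_k (cu u j k ^+ 2 + cu u j k * cu u k j))%R.
pose l (u : U) := (stp (d := d) / 2 * q u - K)%R.
have mc j k := @measurable_cu R d j k.
have mq : measurable_fun setT q.
  apply: measurable_sum => j; apply: measurable_sum => k.
  by apply: measurable_funD; [exact: measurable_funX|exact: measurable_funM].
have bq u : (`|q u| <= \sum_(j < d) \sum_(k < d) 2)%R.
  apply: le_trans (ler_norm_sum _ _ _) _; apply: ler_sum => j _.
  apply: le_trans (ler_norm_sum _ _ _) _; apply: ler_sum => k _.
  apply: le_trans (ler_normD _ _) _; rewrite normrX normrM.
  have := cu_le1 u j k; have := cu_le1 u k j.
  by have := normr_ge0 (cu u j k); have := normr_ge0 (cu u k j); nra.
have iq : (@prior R d).-integrable setT (fun u => (q u)%:E).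
  exact: (bounded_integrable (@prior R d) mq bq).
have il : (@prior R d).-integrable setT (fun u => (l u)%:E).
  have h : (@prior R d).-integrable setT (fun u => (stp (d := d) / 2)%:E * (q u)%:E - K%:E).
    apply: integrableB => //; first exact: integrableZl.
    exact: finite_measure_integrable_cst.
  by apply: eq_integrable h => // u _; rewrite /l EFinB EFinM.
have lfp : {ae (@prior R d), forall u, (l u)%:E <= fpexp nu u}.
  apply: filterS acc => u accu.
  have := fpexp_ge e01 d0 dp s0 (accuracy_Qx accu); apply: le_trans.
  rewrite lee_fin; have := corr_theta_ge u; rewrite /l /K -/(q u).
  by lra.
have ig : (@prior R d).-integrable setT (fun u => fpexp nu u - (l u)%:E) by exact: integrableB.
have : 0 <= \int[@prior R d]_u (fpexp nu u - (l u)%:E).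
  rewrite integralE.
  have -> : \int[@prior R d]_u ((fun u => fpexp nu u - (l u)%:E)^\- u) = 0.
    rewrite -[RHS](integral0 (@prior R d) setT); apply: ae_eq_integral => //.
    - by apply: measurable_funeneg; exact: measurable_int ig.
    - apply: filterS lfp => u lu _; rewrite funenegE.
      by apply/max_idPr; rewrite oppe_le0 sube_ge0.
  by rewrite sube0; apply: integral_ge0.
rewrite integralB// fp0 sub0e.
have -> : \int[@prior R d]_u (l u)%:E = (stp (d := d) / 2)%:E * \int[@prior R d]_u (q u)%:E - K%:E.
  under eq_integral do rewrite /l EFinB EFinM.
  rewrite integralB//; last 2 first.
  - exact: integrableZl.
  - exact: finite_measure_integrable_cst.
  by rewrite integralZl// integral_cst_prob.
have hq : (d%:R ^+ 2 / 3)%:E <= \int[@prior R d]_u (q u)%:E.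
  have ij j k : (@prior R d).-integrable setT (fun u => (cu u j k ^+ 2)%:E + (cu u j k * cu u k j)%:E).
    apply: integrableD => //.
      apply: (bounded_integrable (@prior R d) (f := fun u => (cu u j k ^+ 2)%R) (K := 1)).
        exact: measurable_funX.
      by move=> u; rewrite normrX; have := cu_le1 u j k; have := normr_ge0 (cu u j k); nra.
    apply: (bounded_integrable (@prior R d) (f := fun u => (cu u j k * cu u k j)%R) (K := 1)).
      exact: measurable_funM.
    by move=> u; rewrite normrM -[leRHS]mulr1; apply: ler_pM => //; exact: cu_le1.
  have -> : \int[@prior R d]_u (q u)%:E = \sum_j \sum_k
      \int[@prior R d]_u ((cu u j k ^+ 2)%:E + (cu u j k * cu u k j)%:E).
    under eq_integral do rewrite /q -sumEFin.
    under eq_integral => u _ do under eq_bigr => j _ do (rewrite -sumEFin; under eq_bigr do rewrite EFinD).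
    rewrite integral_sum//; last by move=> j; exact: integrable_sum.
    by apply: eq_bigr => j _; rewrite integral_sum.
  apply: (@le_trans _ _ (\sum_(j < d) \sum_(k < d) (3^-1)%:E)).
    under [leRHS]eq_bigr do rewrite sumEFin.
    rewrite sumEFin lee_fin !sumr_const !card_ord -mulrnA -[leRHS]mulr_natr natrM.
    by rewrite le_eqVlt; apply/orP; left; apply/eqP; field.
  apply: lee_sum => j _; apply: lee_sum => k _.
  rewrite integralD//; last 2 first.
  - apply: (bounded_integrable (@prior R d) (f := fun u => (cu u j k ^+ 2)%R) (K := 1)).
      exact: measurable_funX.
    by move=> u; rewrite normrX; have := cu_le1 u j k; have := normr_ge0 (cu u j k); nra.
  - apply: (bounded_integrable (@prior R d) (f := fun u => (cu u j k * cu u k j)%R) (K := 1)).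
      exact: measurable_funM.
    by move=> u; rewrite normrM -[leRHS]mulr1; apply: ler_pM => //; exact: cu_le1.
  by rewrite prior_sqr leeDl// prior_cross.
have fq := integrable_fin_num measurableT iq.
move: hq; rewrite -(fineK fq) -EFinM -EFinB -EFinN !lee_fin.
move: (fine _) => z hz h.
have p0 : (0 <= stp (d := d) / 2 :> R)%R by rewrite divr_ge0// stp_ge0.
have h1 := ler_wpM2l p0 hz.
by rewrite -/K; lra.
Qed.

End main_inequality.

(** * The distribution over covariances and the final bound *)

Section covariance_prior.
Context {R : realType} {d : nat}.
Notation U := ((d * d).-tuple (measurableTypeR R)).

HB.instance Definition _ := isMeasurableFun.Build _ _ _ _ (@Sig R d) (@measurable_Sig R d).

Definition cov_prior : probability 'M[R]_d R := distribution (@prior R d) (@Sig R d).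

Lemma fro2_eq0 (A : 'M[R]_d) : fro2 A = 0 -> A = 0.
Proof.
move=> /eqP; rewrite psumr_eq0; last first.
  by move=> i _; apply: sumr_ge0 => j _; exact: sqr_ge0.
move=> /allP A0; apply/matrixP => i j; rewrite [RHS]mxE.
have := A0 i (mem_index_enum _); rewrite /= psumr_eq0; last by move=> k _; exact: sqr_ge0.
by move=> /allP/(_ j (mem_index_enum _))/=; rewrite sqrf_eq0 => /eqP.
Qed.

Lemma ae_cov_prior (P : 'M[R]_d -> Prop) :
  {ae cov_prior, forall S, P S} -> {ae (@prior R d), forall u, P (Sig u)}.
Proof.
case=> N [mN N0 subN]; exists (@Sig R d @^-1` N); split => //.
- by rewrite -[_ @^-1` _]setTI; exact: measurable_Sig.
- by move=> u nP; exact: subN.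
Qed.

(** An almost-everywhere statement needs a measurable exceptional set. The measurable function [phi]
    vanishes exactly when S is symmetric and S - (5/4)I lies in the box of [psi]; this holds at
    every [Sig u] and implies both bounds. *)
Lemma cov_prior_bounds : {ae cov_prior, forall S : 'M[R]_d,
  loewner_le 1%:M S /\ loewner_le S 2%:M}.
Proof.
pose phi (S : 'M[R]_d) : R := fro2 (psi S - (S - (5 / 4)%:M)) + fro2 (S - S^T).
have mphi : measurable_fun setT phi.
  have mp := @measurable_psi R d.
  apply: measurable_funD.
    by apply: (@fro2_measurable R d (fun S => psi S - (S - (5 / 4)%:M))); mfun.
  apply: (@fro2_measurable R d (fun S => S - S^T)).
  apply: measurable_addmx; first exact: measurable_id.
  by apply: measurable_oppmx; apply: measurable_trmx; exact: measurable_id.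
exists (~` (phi @^-1` [set 0])); split.
- by apply: measurableC; rewrite -[_ @^-1` _]setTI; exact: mphi.
- suff E : @Sig R d @^-1` (~` (phi @^-1` [set 0])) = set0.
    by apply: (eq_trans (congr1 (@prior R d) E)); exact: measure0.
  apply/seteqP; split=> u //= nphi; exfalso; apply: nphi.
  rewrite /phi.
  have -> : psi (Sig u) = Sig u - (5 / 4)%:M.
    rewrite /Sig [X in _ = X - _]addrC addrK; apply/matrixP => j k; rewrite mxE.
    rewrite [X in clamp _ (X - _)]mxE [X in clamp _ X]addrC addKr clamp_id//.
    exact: (small_theta (small_Cmx u) j k).
  have -> : (Sig u)^T = Sig u by rewrite /Sig linearD/= tr_scalar_mx theta_sym.
  have f0 : fro2 (0 : 'M[R]_d) = 0.
    by rewrite /fro2 big1// => i _; rewrite big1// => j _; rewrite mxE expr0n.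
  by rewrite !subrr f0 addr0.
- move=> S /= nP; apply/not_notP => /= phi0'; apply: nP.
  have phi0 : phi S = 0 by apply: contrapT => h; apply: phi0'.
  have f1 := fro2_ge0 (psi S - (S - (5 / 4)%:M)); have f2 := fro2_ge0 (S - S^T).
  have e1 : fro2 (psi S - (S - (5 / 4)%:M)) = 0 by move: phi0; rewrite /phi; lra.
  have e2 : fro2 (S - S^T) = 0 by move: phi0; rewrite /phi; lra.
  have psiE : psi S = S - (5 / 4)%:M by apply/eqP; rewrite -subr_eq0 (fro2_eq0 e1).
  have symS : S^T = S by apply/esym/eqP; rewrite -subr_eq0 (fro2_eq0 e2).
  have symp : (psi S)^T = psi S by rewrite psiE linearB/= tr_scalar_mx symS.
  have SE : S = (5 / 4)%:M + psi S by rewrite psiE addrC subrK.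
  split; rewrite /loewner_le.
  + have -> : S - 1%:M = (4^-1)%:M + psi S.
      rewrite {1}SE addrAC; congr (_ + _).
      by rewrite -raddfB/=; congr (_%:M); field.
    exact: (loewner_small symp (small_psi S)).
  + have -> : 2%:M - S = (3 / 4)%:M + (-1) *: psi S.
      rewrite {1}SE opprD addrA scaleN1r; congr (_ + _).
      by rewrite -raddfB/=; congr (_%:M); field.
    apply: (loewner_small _ (smallZ (-1) (small_psi S))).
      by rewrite linearZ/= symp.
    by rewrite normrN1; lra.
Qed.

End covariance_prior.

(** Multiplied by 16 d, the inequality reads d^2/3 <= d^2/16 + 32 alpha d^2 + 128 n eps alpha + 16 d
    n delta. The constants 1/256 bound the alpha term by d^2/8 and the delta term by d/16 <= d^2/16,
    leaving d^2/12 on the left. *)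
Lemma covariance_real_bound (R : realType) (d n : nat) (alpha eps delta : R)
    (M : R.-pker (n.-tuple 'rV[R]_d) ~> 'M[R]_d) :
  (0 < d)%N -> 0 < alpha <= 256^-1 -> 0 <= eps <= 1 -> 0 <= delta ->
  n%:R * delta <= 256^-1 ->
  differentially_private eps delta M ->
  {ae (@prior R d), forall u,
     (\int[iid (gaussian (Sig u)) n]_X \int[M X]_A
       (mahalanobis (Sig u) (A - Sig u) ^+ 2)%:E <= (alpha ^+ 2)%:E)%E} ->
  d%:R ^+ 2 / 16 <= 128 * (n%:R * eps * alpha).
Proof.
move=> d0 /andP[a0 a1] e01 de0 nde dp acc.
have := fingerprinting_lower_bound a0 e01 de0 dp acc.
have dR : 1 <= d%:R :> R by rewrite ler1n.
have dp0 : 0 < d%:R :> R by rewrite ltr0n.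
rewrite /stp => h.
have h16 : 0 < 16 * d%:R :> R by rewrite mulr_gt0.
move: (ler_wpM2l (ltW h16) h).
have -> : 16 * d%:R * (8^-1 / d%:R / 2 * (d%:R ^+ 2 / 3)) = d%:R ^+ 2 / 3 :> R.
  by field; rewrite gt_eqF.
have -> : 16 * d%:R * (d%:R / 256 + 2 * alpha * d%:R + 8^-1 / d%:R / 2 *
   (n%:R * (64 * eps * (2 * alpha) + 16 * (d%:R * delta)))) =
   d%:R ^+ 2 / 16 + 32 * (alpha * d%:R ^+ 2) + 128 * (n%:R * eps * alpha) +
   16 * (d%:R * (n%:R * delta)) :> R.
  by field; rewrite gt_eqF.
have h1 : alpha * d%:R ^+ 2 <= 256^-1 * d%:R ^+ 2 by rewrite ler_wpM2r// sqr_ge0.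
have h2 : d%:R * (n%:R * delta) <= d%:R * 256^-1 by rewrite ler_wpM2l.
have h3 : d%:R <= d%:R ^+ 2 :> R by rewrite expr2 ler_peMr// ltW.
by lra.
Qed.

Theorem theorem4p1 (R : realType) :
  exists c1 c2 c3 : R, [/\ 0 < c1, 0 < c2 & 0 < c3] /\
  forall d : nat, exists D : probability 'M[R]_d R,
    {ae D, forall S : 'M[R]_d,
       loewner_le 1%:M S /\ loewner_le S 2%:M} /\
    forall (n : nat) (alpha eps delta : R)
           (M : R.-pker (n.-tuple 'rV[R]_d) ~> 'M[R]_d),
      0 <= alpha <= c1 ->
      0 <= eps <= 1 ->
      0 <= delta <= 1 ->
      (delta%:E <= c2%:E * delta_bound n d)%E ->
      differentially_private eps delta M ->
      {ae D, forall S : 'M[R]_d,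
         (\int[iid (gaussian S) n]_X \int[M X]_A
            (mahalanobis S (A - S) ^+ 2)%:E <= (alpha ^+ 2)%:E)%E} ->
      ((c3 * d%:R ^+ 2)%:E / (alpha * eps)%:E <= n%:R%:E)%E.
Proof.
(* 2048 = 16 * 128, from d^2/16 <= 128 n eps alpha. *)
exists 256^-1, 256^-1, 2048^-1; split; first by split; rewrite invr_gt0 ltr0n.
move=> d; exists cov_prior; split; first exact: cov_prior_bounds.
move=> n alpha eps delta M /andP[a0 a1] e01 /andP[de0 _] deb dp acc.
(* For d = 0 the quotient is 0 even when alpha eps = 0, since 0 times +oo is 0. *)
have [->|d0] := posnP d; first by rewrite expr0n/= mulr0 mul0e lee_fin.
have acc' := ae_cov_prior acc.
have nde : n%:R * delta <= 256^-1.
  have [->|n0] := posnP n; first by rewrite mul0r invr_ge0 ler0n.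
  have nR : 0 < n%:R :> R by rewrite ltr0n.
  have : (delta%:E <= (256^-1)%:E * (n%:R%:E)^-1 :> \bar R)%E.
    apply: le_trans deb _; apply: lee_wpmul2l; first by rewrite lee_fin invr_ge0 ler0n.
    by rewrite /delta_bound ge_min lexx.
  by rewrite inver gt_eqF// -EFinM lee_fin -(ler_pM2l nR) mulrCA divff ?gt_eqF// mulr1.
(* Accuracy alpha implies accuracy b for every b >= alpha; this is what handles alpha = 0. *)
have key b : 0 < b <= 256^-1 -> alpha <= b ->
    d%:R ^+ 2 / 16 <= 128 * (n%:R * eps * b).
  move=> b01 ab; apply: (@covariance_real_bound R d n b eps delta M) => //.
  apply: filterS acc' => u /le_trans; apply; rewrite lee_fin.
  by rewrite lerXn2r// nnegrE; case/andP: b01 => /ltW.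
have dR : 1 <= d%:R ^+ 2 :> R by rewrite exprn_ege1// ler1n.
have /andP[e0 e1] := e01.
have [alpha0|alphap] := leP alpha 0.
  (* With alpha = 0, the choice b = 1/(4096 (n + 1)) gives 1/16 <= d^2/16 <= 128 n eps b <= 1/32, a
     contradiction. *)
  have n1 : 0 < 4096 * n.+1%:R :> R by rewrite mulr_gt0 ?ltr0n.
  have n2 : 1 <= n.+1%:R :> R by rewrite ler1n.
  have b0 : 0 < (4096 * n.+1%:R)^-1 :> R by rewrite invr_gt0.
  have b1 : (4096 * n.+1%:R)^-1 <= 256^-1 :> R by rewrite lef_pV2 ?posrE ?n1 ?ltr0n//; lra.
  have := key (4096 * n.+1%:R)^-1; rewrite b0 b1 (le_trans alpha0 (ltW b0)).
  move=> /(_ isT isT).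
  have nb : n%:R * (4096 * n.+1%:R)^-1 <= 4096^-1 :> R.
    by rewrite ler_pdivrMr ?n1// mulrA mulVf ?pnatr_eq0// mul1r ler_nat.
  have nb0 : 0 <= n%:R * (4096 * n.+1%:R)^-1 :> R.
    by apply: mulr_ge0; [exact: ler0n | exact: ltW b0].
  have : n%:R * eps * (4096 * n.+1%:R)^-1 <= 4096^-1.
    by apply: le_trans nb; rewrite mulrAC; exact: ler_piMr.
  by move: (n%:R * eps * _) => z h1 h2; exfalso; lra.
have K := key alpha; rewrite alphap a1 lexx in K; have {K} K := K isT isT.
(* For eps = 0 the bound would read d^2/16 <= 0. *)
have ep : 0 < eps.
  rewrite lt0r e0 andbT; apply/eqP => e00; move: K; rewrite e00 mulr0 mul0r mulr0.
  by lra.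
have ae0 : 0 < alpha * eps by rewrite mulr_gt0.
rewrite inver gt_eqF// -EFinM lee_fin ler_pdivrMr//.
have -> : n%:R * (alpha * eps) = n%:R * eps * alpha by rewrite mulrA mulrAC.
by move: (n%:R * eps * alpha) K => z K; lra.
Qed.
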